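(* Let $M>0$, and let $\gamma,\kappa\in(0,1)$ be such that $\gamma+\kappa>1$. Let $\varepsilon>0$ and a sufficiently large $p\ge1$ so that $\varepsilon>\frac1{2p}$. Assume that $\sigma\in C^4(\mathbb{R})$ is a bounded function with bounded derivatives such that $$\|\sigma^{(j)}\|_\infty\le\frac{c_3}{M+1},\qquad j=0,1,2,$$ for some constant $c_3<\frac{c_2}{1+C(M)}\wedge c_1$, where $c_1,c_2,C(M)$ are the constants described in the context. Let $z(x)=\{z_t,\ t\in[0,1]\}$ be the solution, with $z_0=0$, of $$z_t-z_s=\int_s^t du\left(\int_u^1\sigma_M(x,z_\xi)\,dx_\xi\right)-(t-s)\int_0^1\xi\,\sigma_M(x,z_\xi)\,dx_\xi,\qquad 0\le s\le t\le1,$$ with control $x\in\mathcal{C}^{\gamma+\varepsilon}$. Then the map $x\mapsto z(x)$, defined on $\mathcal{C}^{\gamma+\varepsilon}$ with values in $\mathcal{C}^\kappa$, is Fréchet differentiable. Moreover, for all $h\in\mathcal{C}^{\gamma+\varepsilon}$, the Fréchet derivative of $z(x)$ is given by $$(Dz(x)\cdot h)_t=\int_0^1\Phi_s(t)\,dh_s,$$ where the kernels $\Phi_s(t)$ satisfy the equation $$\Phi_s(t)=\Psi_s(t)+G_M(x)\int_0^1K(t,\xi)\,\sigma'(z_\xi)\,\Phi_s(\xi)\,dx_\xi,$$ with $$\Psi_s(t)=G_M(x)\,\sigma(z_s)\,K(t,s)+2\varphi_M'(\|x\|_{\gamma,p}^{2p})\,\mu_s\,z_t$$ and $$\mu_s:=\int_0^s\int_s^1\rho_{\zeta\eta}\,d\zeta\,d\eta,\qquad\text{where}\quad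 \rho_{\zeta\eta}=2p\,\frac{(x_\zeta-x_\eta)^{2p-1}}{|\zeta-\eta|^{2\gamma p+2}}.$$
   Context: $K(t,\xi):=t\wedge\xi-t\xi$ for $t,\xi\in[0,1]$. $\mathcal{C}^\gamma$ is the space of continuous $f:[0,1]\to\mathbb{R}$ with $\|f\|_\gamma:=\|f\|_\infty+\sup_{0\le s<t\le1}\frac{|f_t-f_s|}{|t-s|^\gamma}<\infty$. Integrals of Hölder functions against Hölder functions (exponents summing to more than 1) are Young integrals. For $p\ge1$ put $\|f\|_{\gamma,p}:=\left(\int_0^1\int_0^1\frac{(f(\zeta)-f(\eta))^{2p}}{|\zeta-\eta|^{2p\gamma+2}}d\zeta d\eta\right)^{1/(2p)}$ (for non-integer $p$, $a^{2p}$ means $|a|^{2p}$ and $a^{2p-1}$ means $\mathrm{sgn}(a)|a|^{2p-1}$). If $\varepsilon>\frac1{2p}$, then $f\in\mathcal{C}^{\gamma+\varepsilon}$ implies $\|f\|_{\gamma,p}<\infty$. Cutoff: $\varphi_M\in C^\infty_b((0,\infty))$ is a function such that $\varphi_M(r)=0$ for all $r>M+1$ and $\varphi_M(r)=1$ for $r<M$ (also read as $\varphi_M(0)=1$). For $x$ with $\|x\|_{\gamma,p}<\infty$ and $y\in\mathbb{R}$, $G_M(x):=\varphi_M(\|x\|_{\gamma,p}^{2p})$ and $\sigma_M(x,y):=G_M(x)\sigma(y)$. Constants. $c_1<1$ and $C(M)$ are the constants of the following existence result: if $x\in\mathcal{C}^{\gamma+\varepsilon}$ and $\sigma\in C^2(\mathbb{R})$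 is bounded with bounded derivatives and $\|\sigma^{(j)}\|_\infty\le\frac{c_1}{M+1}$ for $j=0,1,2$, for a small enough constant $c_1<1$, then the equation for $z$ in the claim has a unique solution in $\mathcal{C}^\kappa$, and $\|z\|_\kappa\le C(M)$, with $C(M)$ a positive constant depending on $M$. $c_2<1$ is the constant of the following result: if $x\in\mathcal{C}^\gamma$ (with $G_M(x)$ defined) and $w,R\in\mathcal{C}^\kappa$ with $\|R\|_\kappa<\frac{c_2}{M+1}$ for some small enough constant $c_2<1$, then the linear equation $y_t=w_t-G_M(x)\int_0^1K(t,\xi)R_\xi y_\xi\,dx_\xi$, $t\in[0,1]$, has a unique solution $y\in\mathcal{C}^\kappa$, and $\|y\|_\kappa\le c(M)\|w\|_\kappa$ with $c(M)>0$ depending only on $M$.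
   Formalization: In Ψ_s(t) the printed factor z_t in the second term is replaced by ∫_0^1 K(t,ξ)σ(z_ξ)dx_ξ (i.e. z_t/G_M(x) where G_M(x)≠0); the printed formula fails, e.g. for constant σ at x with φ_M'≠0 and 0<G_M(x)<1. *)

(* Defs.v *)
From HB Require Import structures.
From mathcomp Require Import all_boot all_order all_algebra.
From mathcomp Require Import all_classical all_reals all_analysis.

Set Implicit Arguments.
Unset Strict Implicit.
Unset Printing Implicit Defensive.

Import Order.TTheory GRing.Theory Num.Theory.
Import numFieldNormedType.Exports.

Local Open Scope classical_set_scope.
Local Open Scope ring_scope.


Section hoelder_norm.
Context {R : realType}.
Implicit Types (a k t : R) (f g : R -> R).

Definition sup_enorm f : \bar R := ereal_sup [set `|f t|%:E | t in `[0, 1]].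

Definition hoelder_seminorm a f : \bar R :=
  ereal_sup [set (`|f st.2 - f st.1| / `|st.2 - st.1| `^ a)%:E | st in
    [set st : R * R | [/\ 0 <= st.1, st.1 < st.2 & st.2 <= 1]]].

Definition hoelder_enorm a f : \bar R :=
  (sup_enorm f + hoelder_seminorm a f)%E.

Definition is_hoelder a f :=
  {within `[0, 1], continuous f} /\ (hoelder_enorm a f < +oo)%E.

Lemma sup_enorm_ge f t : 0 <= t <= 1 -> (`|f t|%:E <= sup_enorm f)%E.
Proof. by move=> t01; apply: ereal_sup_ubound; exists t => //=; rewrite in_itv. Qed.

Lemma sup_enorm_ge0 f : (0 <= sup_enorm f)%E.
Proof.
by apply: (@le_trans _ _ (`|f 0|%:E)); rewrite ?lee_fin// sup_enorm_ge// lexx ler01.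
Qed.

Lemma hoelder_seminorm_ge a f s t : 0 <= s -> s < t -> t <= 1 ->
  ((`|f t - f s| / `|t - s| `^ a)%:E <= hoelder_seminorm a f)%E.
Proof. by move=> s0 st t1; apply: ereal_sup_ubound; exists (s, t). Qed.

Lemma hoelder_seminorm_ge0 a f : (0 <= hoelder_seminorm a f)%E.
Proof.
apply: (le_trans _ (hoelder_seminorm_ge a f (lexx 0) ltr01 (lexx 1))).
by rewrite lee_fin divr_ge0// powR_ge0.
Qed.

Lemma hoelder_enormD a f g :
  (hoelder_enorm a (f + g)%R <= hoelder_enorm a f + hoelder_enorm a g)%E.
Proof.
rewrite /hoelder_enorm addeACA; apply: leeD.
  apply: ge_ereal_sup => _ [t /= t01 <-]; rewrite in_itv/= in t01.
  apply: le_trans (leeD (sup_enorm_ge f t01) (sup_enorm_ge g t01)).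
  by rewrite -EFinD lee_fin ler_normD.
apply: ge_ereal_sup => _ [[s t] [/= s0 st t1] <-].
apply: le_trans (leeD (hoelder_seminorm_ge a f s0 st t1)
                      (hoelder_seminorm_ge a g s0 st t1)).
rewrite -EFinD lee_fin -mulrDl ler_wpM2r ?invr_ge0 ?powR_ge0//.
by rewrite !fctE opprD addrACA ler_normD.
Qed.

Lemma hoelder_enormZ_le a k f :
  (hoelder_enorm a (k *: f)%R <= `|k|%:E * hoelder_enorm a f)%E.
Proof.
rewrite /hoelder_enorm ge0_muleDr ?sup_enorm_ge0 ?hoelder_seminorm_ge0//.
apply: leeD; apply: ge_ereal_sup.
  move=> _ [t /= t01 <-]; rewrite in_itv/= in t01.
  by rewrite normrM EFinM lee_wpmul2l ?lee_fin ?sup_enorm_ge.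
move=> _ [[s t] [/= s0 st t1] <-].
rewrite !fctE -scalerBr normrM -mulrA EFinM.
by rewrite lee_wpmul2l ?lee_fin ?hoelder_seminorm_ge.
Qed.

Lemma hoelder_enorm_ge0 a f : (0 <= hoelder_enorm a f)%E.
Proof. by rewrite adde_ge0 ?sup_enorm_ge0 ?hoelder_seminorm_ge0. Qed.

Lemma hoelder_enorm0 a : hoelder_enorm a 0 = 0%E.
Proof.
apply/eqP; rewrite eq_le hoelder_enorm_ge0 andbT.
by have := hoelder_enormZ_le a 0 0; rewrite scale0r normr0 mul0e.
Qed.

Lemma hoelder_enormZ a k f :
  hoelder_enorm a (k *: f) = (`|k|%:E * hoelder_enorm a f)%E.
Proof.
have [->|k0] := eqVneq k 0; first by rewrite scale0r hoelder_enorm0 normr0 mul0e.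
apply/eqP; rewrite eq_le hoelder_enormZ_le/=.
have := hoelder_enormZ_le a k^-1 (k *: f).
rewrite scalerA mulVf// scale1r => /(lee_wpmul2l (_ : (0 <= `|k|%:E)%E)).
by rewrite lee_fin => /(_ (normr_ge0 k)) /le_trans; apply; rewrite muleA -EFinM
  -normrM divff// normr1 mul1e.
Qed.

(* A function on [0, 1] is represented by its extension by 0 to the real line *)
Definition hoelder_pred a : {pred R -> R} :=
  mem [set f : R -> R | f \_ `[0, 1] = f /\ is_hoelder a f].

Lemma hoelder_submod_closed a : submod_closed (hoelder_pred a).
Proof.
split=> [|k f g]; rewrite !inE/=.
  split; first by apply/funext => t; rewrite patchE; case: ifP.
  by split; [exact: cst_continuous|rewrite hoelder_enorm0].
move=> [f0 [fc fa]] [g0 [gc ga]]; split; [|split].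
- apply/funext => t; rewrite patchE -{2}f0 -{2}g0 !fctE !patchE.
  by case: ifP => // _; rewrite scaler0 addr0.
- move=> t; apply: cvgD; last exact: gc.
  by apply: cvgZr; exact: fc.
- apply: le_lt_trans (hoelder_enormD _ _ _) _.
  rewrite lte_add_pinfty// hoelder_enormZ lte_mul_pinfty//.
Qed.

HB.instance Definition _ a :=
  GRing.isSubmodClosed.Build R (R -> R) (hoelder_pred a) (hoelder_submod_closed a).

End hoelder_norm.

Record hoelderType (R : realType) (a : R) := Hoelder {
  hoelder_fun :> R -> R ;
  hoelderP : hoelder_fun \in hoelder_pred a }.

Section hoelder_normedModType.
Context (R : realType) (a : R).

HB.instance Definition _ := [isSub for @hoelder_fun R a].
HB.instance Definition _ := [Choice of hoelderType a by <:].
HB.instance Definition _ := [SubChoice_isSubLmodule of hoelderType a by <:].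

Implicit Types f g : hoelderType a.

Let norm f : R := fine (hoelder_enorm a f).

Let normE f : (norm f)%:E = hoelder_enorm a f.
Proof.
have := hoelderP f; rewrite inE => -[_ [_ foo]].
by rewrite fineK// ge0_fin_numE// hoelder_enorm_ge0.
Qed.

Let ler_normD f g : norm (f + g) <= norm f + norm g.
Proof. by rewrite -lee_fin EFinD !normE hoelder_enormD. Qed.

Let normrZ k f : norm (k *: f) = `|k| * norm f.
Proof. by apply: EFin_inj; rewrite EFinM !normE hoelder_enormZ. Qed.

Let normr0_eq0 f : norm f = 0 -> f = 0.
Proof.
move=> nf0; have := normE f; rewrite nf0 => f0; apply/val_inj/funext => t /=.
have := hoelderP f; rewrite inE => -[<- _]; rewrite patchE.
case: ifPn => // /[!inE]/= /[!in_itv]/= t01.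
apply/eqP; rewrite -normr_le0 -lee_fin [leRHS]f0.
by rewrite (le_trans (sup_enorm_ge f t01))// leeDl// hoelder_seminorm_ge0.
Qed.

HB.instance Definition _ :=
  Lmodule_isNormed.Build R (hoelderType a) ler_normD normrZ normr0_eq0.

End hoelder_normedModType.


Section young_integral.
Context {R : realType}.
Implicit Types (f g : R -> R) (a b : R) (s : seq R) (tag : nat -> R).

(* [a :: s] is the subdivision, see [itv_partition]. *)
Definition mesh a s : R :=
  \big[Num.max/0]_(0 <= i < size s) (nth a (a :: s) i.+1 - nth a (a :: s) i).

Definition tags a s tag := forall i, (i < size s)%N ->
  nth a (a :: s) i <= tag i <= nth a (a :: s) i.+1.

Definition riemann_sum f g a s tag : R :=
  \sum_(0 <= i < size s)
    f (tag i) * (g (nth a (a :: s) i.+1) - g (nth a (a :: s) i)).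

(* Hölder regularity is asked on [0, 1] although the integral is over [a, b]. *)
Definition is_young_integral f g a b (I : R) :=
  (exists alpha beta : R, [/\ 0 < alpha, 0 < beta, 1 < alpha + beta,
     is_hoelder alpha f & is_hoelder beta g]) /\
  (forall e : R, 0 < e -> exists2 d : R, 0 < d &
     forall s tag, itv_partition a b s -> tags a s tag -> mesh a s < d ->
       `|riemann_sum f g a s tag - I| < e).

Definition young_integral f g a b : R := xget 0 (is_young_integral f g a b).

End young_integral.

Notation "'\young_' ( u '=' a 'to' b ) f 'd' g" :=
  (young_integral (fun u => f) g a b)
  (at level 36, u name, a at level 50, b at level 50, f at level 36, g at level 8,
   format "'\young_' ( u  '='  a  'to'  b )  f  'd'  g") : ring_scope.


Section truncated_equation.
Context {R : realType}.
Local Notation mu := (@lebesgue_measure R).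
Implicit Types (gamma p : R) (phi sigma x y z w q : R -> R).

Definition green (t xi : R) : R := Num.min t xi - t * xi.

Definition sobolev_norm gamma p x : \bar R :=
  ((\int[mu]_(zeta in `[0%R, 1%R]) \int[mu]_(eta in `[0%R, 1%R])
     (`|x zeta - x eta| `^ (2 * p) /
      `|zeta - eta| `^ (2 * p * gamma + 2))%:E) `^ (2 * p)^-1)%E.

Definition sobolev_pow gamma p x : R := fine (sobolev_norm gamma p x) `^ (2 * p).

(* [phi] is only constrained on $[0, \infty)$. *)
Definition is_cutoff (M : R) phi :=
  [/\ forall n (r : R), 0 < r -> derivable phi^`(n)%classic r 1,
      forall n, exists B : R, forall r : R, 0 < r -> `|phi^`(n)%classic r| <= B,
      forall r : R, M + 1 < r -> phi r = 0 &
      forall r : R, 0 <= r < M -> phi r = 1].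

Definition cutoff gamma p phi x : R := phi (sobolev_pow gamma p x).

Definition sigma_trunc gamma p phi sigma x (y : R) : R :=
  cutoff gamma p phi x * sigma y.

Definition Cb (n : nat) sigma :=
  [/\ forall k, (k < n)%N -> forall y : R, derivable sigma^`(k)%classic y 1,
      continuous sigma^`(n)%classic &
      forall k, (k <= n)%N -> exists B : R, forall y : R, `|sigma^`(k)%classic y| <= B].

Definition C2_bound sigma (c : R) :=
  forall j, (j <= 2)%N -> forall y : R, `|sigma^`(j)%classic y| <= c.

Definition solves_bvp gamma p phi sigma x z :=
  z 0 = 0 /\
  forall s t : R, 0 <= s -> s <= t -> t <= 1 ->
    z t - z s =
      \int[mu]_(u in `[s, t])
        (\young_(xi = u to 1) sigma_trunc gamma p phi sigma x (z xi) d x)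
      - (t - s) *
        \young_(xi = 0 to 1) (xi * sigma_trunc gamma p phi sigma x (z xi)) d x.

Definition solves_linear gamma p phi x q w y :=
  forall t : R, 0 <= t <= 1 ->
    y t = w t - cutoff gamma p phi x *
      \young_(xi = 0 to 1) (green t xi * q xi * y xi) d x.

(* $\mathrm{sgn}(a)|a|^{2p-1}$ is the reading of $a^{2p-1}$ for real [p]. *)
Definition rho gamma p x (zeta eta : R) : R :=
  2 * p *
  (Num.sg (x zeta - x eta) * `|x zeta - x eta| `^ (2 * p - 1) /
   `|zeta - eta| `^ (2 * gamma * p + 2)).

Definition mu_kernel gamma p x (s : R) : R :=
  \int[mu]_(eta in `[0, s]) \int[mu]_(zeta in `[s, 1]) rho gamma p x zeta eta.

(* The second term comes from differentiating the factor [cutoff gamma p phi x]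
   of $z_t = G_M(x)\int_0^1 K(t,\xi)\sigma(z_\xi)\,dx_\xi$: what multiplies the
   derivative of $G_M$ is the integral without its prefactor, i.e. $z_t / G_M(x)$
   where $G_M(x) \ne 0$, and not $z_t$. *)
Definition Psi gamma p phi sigma x z (s t : R) : R :=
  cutoff gamma p phi x * sigma (z s) * green t s +
  2 * phi^`()%classic (sobolev_pow gamma p x) * mu_kernel gamma p x s *
    \young_(xi = 0 to 1) (green t xi * sigma (z xi)) d x.

End truncated_equation.


Section constants.
Context {R : realType}.
Implicit Types (M gamma kappa eps p c : R) (phi : R -> R).

(* "$c_1$ and $C(M)$ are admissible in the existence theorem for the truncated
   boundary value problem", for one fixed [M]; likewise for $c_2$ below. *)
Definition bvp_constants M gamma kappa eps p phi (c1 CM : R) :=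
  forall (sigma : R -> R) (x : hoelderType (gamma + eps)),
    Cb 2 sigma -> C2_bound sigma (c1 / (M + 1)) ->
    exists z : hoelderType kappa,
      [/\ solves_bvp gamma p phi sigma x z,
          forall z' : hoelderType kappa, solves_bvp gamma p phi sigma x z' -> z' = z &
          `|z| <= CM].

Definition linear_constant M gamma kappa p phi (c2 : R) :=
  exists2 cM : R, 0 < cM &
  forall (x : hoelderType gamma) (w q : hoelderType kappa),
    (sobolev_norm gamma p x < +oo)%E -> `|q| < c2 / (M + 1) ->
    exists y : hoelderType kappa,
      [/\ solves_linear gamma p phi x q w y,
          forall y' : hoelderType kappa, solves_linear gamma p phi x q w y' -> y' = y &
          `|y| <= cM * `|w|].

End constants.

(* Main.v *)
From HB Require Import structures.
Require Import Defs.
From mathcomp Require Import all_boot all_order all_algebra.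
From mathcomp Require Import all_classical all_reals all_analysis.
From mathcomp Require Import measurable_realfun ring lra.

Set Implicit Arguments.
Unset Strict Implicit.
Unset Printing Implicit Defensive.

Import Order.TTheory GRing.Theory Num.Theory.
Import numFieldNormedType.Exports.

Local Open Scope classical_set_scope.
Local Open Scope ring_scope.

(** Throughout, $G=G_M(x)$, $K$ is the Green function and [Lop x q] is the function
    $t\mapsto\int_0^1K(t,\xi)q_\xi\,dx_\xi$.

    The boundary value problem is the fixed point equation $z=G\int K\sigma(z)\,dx$
    ([bvp_Lop]). For two controls $x$ and $x+h$ write
    $\sigma(z')-\sigma(z)=q\,(z'-z)$ with the divided difference $q$ of $\sigma$. Then
    $\Delta=z(x+h)-z(x)$ solves exactly a linear equation
    $\Delta=w+G\int Kq\Delta\,dx$ whose source $w$ is of the order of $h$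
    ([increment_solution]). Since the Hölder constant of a divided difference is governed
    by the larger of the constants of its two arguments ([slope_norm]), the smallness
    assumed of $\sigma$ makes $q$ admissible for the linear solvability result, and
    $\|\Delta\|\le C\|h\|$ ([increment_lip]). Replacing $q$ by $\sigma'(z)$ and $w$ by its
    linear part changes the solution by $o(\|h\|)$: one needs the second-order estimate
    $\|q-\sigma'(z)\|\le C\|\Delta\|$ ([slope_near]), and the differentiability of the
    cutoff ([cutoff_expansion]). Hence $z$ is differentiable and $y=Dz(x)\cdot h$ is the
    solution of the linear equation with coefficient $\sigma'(z)$ and source
    $\varphi_M'\,(DN\cdot h)\int K\sigma(z)\,dx+G\int K\sigma(z)\,dh$, where
    $N(x)=\|x\|_{\gamma,p}^{2p}$ ([solution_differentiable]).

    Two facts turn this into an integral against $dh$. First, $K$ is symmetric, hence so is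
    the resolvent kernel $\Gamma_s(t)$, the solution with source $K(\cdot,s)$
    ([resolvent_sym]); by duality the solution with source $\int K\sigma(z)\,dh$ is
    $\int\Gamma_s(t)\sigma(z_s)\,dh_s$ ([duality]). Second, $DN\cdot h=
    \iint\rho_{\zeta\eta}(h_\zeta-h_\eta)\,d\zeta\,d\eta=2\int\mu_s\,dh_s$
    ([mu_kernel_young]). Formally this is Fubini's theorem for
    $h_\zeta-h_\eta=\int(1_{s<\zeta}-1_{s<\eta})\,dh_s$. As $h$ has no bounded variation, it
    is proved through the germs: $\mu$ is Hölder continuous with an exponent complementary
    to that of $h$ ([crossing_hld]), and the double integral with $h$ stopped at $t$ is, up
    to a superlinear error, a primitive of $\mu\,dh$ ([crossing_prim]). In both, the
    singularity $|\zeta-\eta|^{\delta-2}$ of $\rho$ has to be integrated over the pairs with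
    one coordinate in $[s,t]$ ([frame_region]).

    All Young integrals are handled through the notion [prim] of a primitive: a function
    whose increments are $f_s(g_t-g_s)$ up to a superlinear error. Such functions are
    unique up to constants ([prim_unique]), exist for complementary Hölder exponents
    ([prim_exists]) and compute the limit of Riemann sums ([prim_is_young]); linearity,
    associativity and integration by parts then amount to estimating germs. *)

(** * Powers and geometric sequences *)

Section powers.
Context {R : realType}.
Implicit Types (x y a b r c : R).

Lemma powR_le_base x y a : 0 <= a -> 0 <= x -> x <= y -> x `^ a <= y `^ a.
Proof.
by move=> a0 x0 xy; apply: ge0_ler_powR; rewrite ?nnegrE// (le_trans x0).
Qed.

Lemma powR_le_exp x a b : 0 <= x -> x <= 1 -> 0 < b -> b <= a ->
  x `^ a <= x `^ b.
Proof.
move=> x0 x1 b0 ba; have [->|xn0] := eqVneq x 0.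
  by rewrite !powR0 ?gt_eqF// (lt_le_trans b0).
by apply: ger_powR => //; rewrite lt_def xn0 x0 x1.
Qed.

Lemma powR_mulD x a b : 0 < a -> 0 < b -> x `^ (a + b) = x `^ a * x `^ b.
Proof. by move=> a0 b0; rewrite powRD// gt_eqF ?addr_gt0. Qed.

Lemma powR_mul_base x a : 0 <= x -> 0 < a -> x `^ (1 + a) = x * x `^ a.
Proof. by move=> x0 a0; rewrite powR_mulD// powRr1. Qed.

Lemma powR_expn x a n : 0 <= x -> (x ^+ n) `^ a = (x `^ a) ^+ n.
Proof.
move=> x0; elim: n => [|n IH]; first by rewrite !expr0 powR1.
by rewrite !exprS powRM ?exprn_ge0// IH.
Qed.

Lemma powR_half_lt1 a : 0 < a -> (2^-1 : R) `^ a < 1.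
Proof.
move=> a0; have /(gt0_ltr_powR a0) : (2^-1 : R) < 1 by lra.
by rewrite powR1; apply; rewrite nnegrE; lra.
Qed.

Lemma geometric_le0 x c r : 0 <= r -> r < 1 ->
  (forall n, x <= c * r ^+ n) -> x <= 0.
Proof.
move=> r0 r1 xc.
have h : (fun n => c * r ^+ n) @ \oo --> (0 : R).
  by apply: (@cvg_geometric R c r); rewrite ger0_norm.
rewrite -(cvg_lim (@Rhausdorff R) h); apply: limr_ge; first exact: (cvgP _ h).
by apply: nearW.
Qed.

(** The limit is the supremum of the lower ends of nested intervals; this gives
    existence and the rate at once. *)
Lemma geometric_limit (u : nat -> R) c r : 0 <= r -> r < 1 ->
  (forall n, `|u n.+1 - u n| <= c * r ^+ n) ->
  exists l, forall n, `|l - u n| <= c * r ^+ n / (1 - r).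
Proof.
move=> r0 r1 uc.
have r1' : 0 < 1 - r by rewrite subr_gt0.
pose e n := c * r ^+ n / (1 - r).
have eS n : e n - e n.+1 = c * r ^+ n.
  by rewrite /e exprS; field; rewrite gt_eqF.
have c0 n : 0 <= c * r ^+ n by apply: le_trans (uc n).
have e0 n : 0 <= e n by rewrite divr_ge0// ltW.
pose lo n := u n - e n.
pose hi n := u n + e n.
have loS n m : (n <= m)%N -> lo n <= lo m.
  move=> /subnK <-; elim: (m - n)%N => // k /le_trans; apply.
  have := uc (k + n)%N; rewrite ler_norml -(eS (k+n)%N) addSn /lo => /andP[? ?]; lra.
have hiS n m : (n <= m)%N -> hi m <= hi n.
  move=> /subnK <-; elim: (m - n)%N => // k; apply: le_trans.
  have := uc (k + n)%N; rewrite ler_norml -(eS (k+n)%N) addSn /hi => /andP[? ?]; lra.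
have lohi n m : lo n <= hi m.
  apply: (le_trans (loS _ _ (leq_maxl n m))).
  apply: le_trans (hiS _ _ (leq_maxr n m)).
  by rewrite /lo /hi; have := e0 (maxn n m); lra.
exists (sup (range lo)) => n.
have hs : has_sup (range lo).
  by split; [exists (lo 0%N), 0%N|exists (hi 0%N) => _ [k _ <-]].
have h1 : lo n <= sup (range lo).
  by apply: ub_le_sup; [case: hs|exists n].
have h2 : sup (range lo) <= hi n.
  by apply: ge_sup; [case: hs|move=> _ [k _ <-]].
by rewrite ler_norml; move: h1 h2; rewrite /lo /hi -/(e n) => ? ?; apply/andP; split; lra.
Qed.

End powers.

(** * Primitives of Young integrals *)

Section primitives.
Context {R : realType}.
Implicit Types (f g I : R -> R) (a b c s t u v : R).

Definition hld a c f := forall s t, 0 <= s -> s <= t -> t <= 1 ->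
  `|f t - f s| <= c * (t - s) `^ a.

Definition hold a f := exists c, hld a c f.

(** Indefinite Young integrals are characterised by their germs: [I] is a
    primitive of [f dg] when its increments agree with the left-point products up
    to a superlinear error. *)
Definition prim f g I := exists c a, 1 < a /\
  forall s t, 0 <= s -> s <= t -> t <= 1 ->
    `|I t - I s - f s * (g t - g s)| <= c * (t - s) `^ a.

Lemma hld_ge0 a c f : hld a c f -> 0 <= c.
Proof.
move=> /(_ 0 1 (lexx _) ler01 (lexx _)); rewrite subr0 powR1 mulr1.
exact: le_trans.
Qed.

(** Halving the interval [n] times divides a superlinear bound by a geometric
    factor. *)
Lemma superlinear_cst (D : R -> R) c a : 1 < a ->
  (forall s t, 0 <= s -> s <= t -> t <= 1 -> `|D t - D s| <= c * (t - s) `^ a) ->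
  forall s t, 0 <= s -> s <= t -> t <= 1 -> D t = D s.
Proof.
move=> a1 Dc s t s0 st t1.
pose r := (2^-1 : R) `^ (a - 1).
have a10 : 0 < a - 1 by rewrite subr_gt0.
have H n : forall s t, 0 <= s -> s <= t -> t <= 1 ->
    `|D t - D s| <= c * (t - s) `^ a * r ^+ n.
  elim: n => [|n IH] {}s {}t {}s0 {}st {}t1; first by rewrite expr0 mulr1 Dc.
  pose m := (s + t) / 2.
  have sm : s <= m by rewrite /m; lra.
  have mt : m <= t by rewrite /m; lra.
  have -> : D t - D s = (D t - D m) + (D m - D s) by ring.
  apply: le_trans (ler_normD _ _) _.
  apply: (le_trans (lerD (IH m t _ mt t1) (IH s m s0 sm _))); [lra|lra|].
  have -> : t - m = 2^-1 * (t - s) by rewrite /m; field.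
  have -> : m - s = 2^-1 * (t - s) by rewrite /m; field.
  rewrite powRM ?subr_ge0// exprS.
  have -> : (2^-1 : R) `^ a = 2^-1 * r.
    have -> : a = 1 + (a - 1) by ring.
    by rewrite powR_mul_base.
  rewrite le_eqVlt; apply/orP; left; by apply/eqP; field.
apply/eqP; rewrite -subr_eq0 -normr_le0.
apply: (@geometric_le0 _ _ (c * (t - s) `^ a) r) => [||n]; last exact: H.
- exact: powR_ge0.
- exact: powR_half_lt1.
Qed.

Lemma le_pow_min s t c c' a a' : 0 <= s -> s <= t -> t <= 1 ->
  1 < a -> 1 < a' -> 0 <= c -> 0 <= c' ->
  c * (t - s) `^ a + c' * (t - s) `^ a' <= (c + c') * (t - s) `^ Num.min a a'.
Proof.
move=> s0 st t1 a1 a1' c0 c0'.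
have h : (0 : R) < Num.min a a' by rewrite lt_min !(lt_trans ltr01).
rewrite mulrDl; apply: lerD; apply: ler_wpM2l => //; apply: powR_le_exp => //; try lra.
  by rewrite ge_min lexx.
by rewrite ge_min lexx orbT.
Qed.

Lemma bound_ge0 (D : R -> R -> R) c a :
  (forall s t, 0 <= s -> s <= t -> t <= 1 -> `|D s t| <= c * (t - s) `^ a) ->
  0 <= c.
Proof.
move=> /(_ 0 1 (lexx _) ler01 (lexx _)); rewrite subr0 powR1 mulr1.
exact: le_trans.
Qed.

Lemma prim_unique f g I I' : prim f g I -> prim f g I' ->
  forall s t, 0 <= s -> s <= t -> t <= 1 -> I t - I s = I' t - I' s.
Proof.
move=> [c [a [a1 H]]] [c' [a' [a1' H']]] s t s0 st t1.
have [c0 c0'] := (bound_ge0 H, bound_ge0 H').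
suff : I t - I' t = I s - I' s by lra.
apply: (@superlinear_cst (fun t => I t - I' t) (c + c') (Num.min a a')) => //.
  by rewrite lt_min a1.
move=> {s0 st t1}s' t' s0 st t1.
apply: le_trans (le_pow_min s0 st t1 a1 a1' c0 c0').
apply: le_trans (lerD (H _ _ s0 st t1) (H' _ _ s0 st t1)).
apply: le_trans (ler_normB _ _); rewrite le_eqVlt; apply/orP; left; apply/eqP.
congr `|_|; ring.
Qed.

Lemma primD f f' g g' h I I' : prim f g I -> prim f' g' I' ->
  (forall s t, 0 <= s -> s <= t -> t <= 1 ->
    h s t = f s * (g t - g s) + f' s * (g' t - g' s)) ->
  exists c a, 1 < a /\ forall s t, 0 <= s -> s <= t -> t <= 1 ->
    `|(I t + I' t) - (I s + I' s) - h s t| <= c * (t - s) `^ a.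
Proof.
move=> [c [a [a1 H]]] [c' [a' [a1' H']]] hE.
have [c0 c0'] := (bound_ge0 H, bound_ge0 H').
exists (c + c'), (Num.min a a'); split; first by rewrite lt_min a1.
move=> s t s0 st t1; apply: le_trans (le_pow_min s0 st t1 a1 a1' c0 c0').
apply: le_trans (lerD (H _ _ s0 st t1) (H' _ _ s0 st t1)).
apply: le_trans (ler_normD _ _); rewrite le_eqVlt; apply/orP; left; apply/eqP.
by congr `|_|; rewrite hE//; ring.
Qed.

Lemma prim_addl f f' g I I' : prim f g I -> prim f' g I' ->
  prim (fun t => f t + f' t) g (fun t => I t + I' t).
Proof. by move=> p p'; apply: (primD p p') => *; ring. Qed.

Lemma prim_addr f g g' I I' : prim f g I -> prim f g' I' ->
  prim f (fun t => g t + g' t) (fun t => I t + I' t).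
Proof. by move=> p p'; apply: (primD p p') => *; ring. Qed.

Lemma prim_scale_fun k f g h I :  prim f g I ->
  (forall s t, 0 <= s -> s <= t -> t <= 1 -> h s t = k * f s * (g t - g s)) ->
  exists c a, 1 < a /\ forall s t, 0 <= s -> s <= t -> t <= 1 ->
    `|k * I t - k * I s - h s t| <= c * (t - s) `^ a.
Proof.
move=> [c [a [a1 H]]] hE; exists (`|k| * c), a; split=> // s t s0 st t1.
have -> : k * I t - k * I s - h s t = k * (I t - I s - f s * (g t - g s)).
  by rewrite hE//; ring.
by rewrite normrM -mulrA ler_wpM2l// H.
Qed.

Lemma prim_scalel k f g I : prim f g I ->
  prim (fun t => k * f t) g (fun t => k * I t).
Proof. by move=> p; apply: (prim_scale_fun p) => *; ring. Qed.

Lemma prim_scaler k f g I : prim f g I ->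
  prim f (fun t => k * g t) (fun t => k * I t).
Proof. by move=> p; apply: (prim_scale_fun p) => *; ring. Qed.

Lemma eq_prim f f' g g' I I' :
  (forall t, 0 <= t <= 1 -> f t = f' t) -> (forall t, 0 <= t <= 1 -> g t = g' t) ->
  (forall t, 0 <= t <= 1 -> I t = I' t) ->
  prim f g I -> prim f' g' I'.
Proof.
move=> ff gg II [c [a [a1 H]]]; exists c, a; split=> // s t s0 st t1.
have ? : 0 <= s <= 1 by rewrite s0 (le_trans st).
have ? : 0 <= t <= 1 by rewrite t1 (le_trans s0).
by rewrite -ff// -!gg// -!II// H.
Qed.

(** If [G] is a primitive of [f dg] then [e dG] and [e f dg] have the same germ. *)
Lemma prim_assoc e f g G I : (exists B, forall t, 0 <= t <= 1 -> `|e t| <= B) ->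
  prim f g G -> prim (fun t => e t * f t) g I <-> prim e G I.
Proof.
move=> [B eB] [c [a [a1 H]]].
have c0 := bound_ge0 H.
have B0 : 0 <= B by rewrite (le_trans _ (eB 0 _))// lexx ler01.
have key s t : 0 <= s -> s <= t -> t <= 1 ->
    `|e s * (G t - G s) - e s * f s * (g t - g s)| <= B * c * (t - s) `^ a.
  move=> s0 st t1; have -> : e s * (G t - G s) - e s * f s * (g t - g s) =
    e s * (G t - G s - f s * (g t - g s)) by ring.
  rewrite normrM -mulrA ler_pM//; last exact: H.
  by rewrite eB// s0 (le_trans st).
have Bc0 : 0 <= B * c by rewrite mulr_ge0.
split=> -[c' [a' [a1' H']]]; have c0' := bound_ge0 H';
  exists (B * c + c'), (Num.min a a'); (split; first by rewrite lt_min a1);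
  move=> s t s0 st t1; apply: le_trans (le_pow_min s0 st t1 a1 a1' Bc0 c0');
  apply: le_trans (lerD (key _ _ s0 st t1) (H' _ _ s0 st t1)).
- rewrite [leRHS]addrC; apply: le_trans (ler_normB _ _); rewrite le_eqVlt; apply/orP; left.
  by apply/eqP; congr `|_|; ring.
- apply: le_trans (ler_normD _ _); rewrite le_eqVlt; apply/orP; left.
  by apply/eqP; congr `|_|; ring.
Qed.

End primitives.

(** * Existence of primitives *)

Section dyadic_sums.
Context {R : realType}.
Implicit Types (f g k : R -> R) (s t u v h A B : R) (E : R -> R -> R).

Fixpoint dyad n E u v : R :=
  if n is n'.+1 then dyad n' E u ((u + v) / 2) + dyad n' E ((u + v) / 2) v
  else E u v.

Lemma dyadS n E u v :
  dyad n.+1 E u v = dyad n (fun u v => E u ((u + v) / 2) + E ((u + v) / 2) v) u v.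
Proof.
elim: n u v => [//|n IH] u v.
by rewrite [LHS]/= -/(dyad n.+1 E _ _) -/(dyad n.+1 E _ _) !IH.
Qed.

Lemma dyadB n E E' E'' u v :
  (forall u v, 0 <= u -> u <= v -> v <= 1 -> E u v - E' u v = E'' u v) ->
  0 <= u -> u <= v -> v <= 1 -> dyad n E u v - dyad n E' u v = dyad n E'' u v.
Proof.
move=> EE; elim: n u v => [|n IH] u v u0 uv v1 /=; first exact: EE.
rewrite -!IH; [ring|lra|lra|lra|lra|lra|lra].
Qed.

Lemma dyad_additive n (c : R) g u v :
  dyad n (fun u v => c * (g v - g u)) u v = c * (g v - g u).
Proof. by elim: n u v => [//|n IH] u v /=; rewrite !IH; ring. Qed.

Definition clamp s t r : R := Num.max s (Num.min r t).

Lemma clamp_cases s t r : s <= t ->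
  [\/ r <= s /\ clamp s t r = s, s <= r <= t /\ clamp s t r = r |
      t <= r /\ clamp s t r = t].
Proof.
rewrite /clamp => st; have [rt|/ltW rt] := leP r t.
  have [sr|/ltW rs] := leP s r.
    by apply: Or32.
  by apply: Or31.
by apply: Or33; split=> //; apply/max_idPr.
Qed.

Lemma clamp_out s t u v : s <= t -> u <= v -> (v <= s) || (t <= u) ->
  clamp s t u = clamp s t v.
Proof.
rewrite /clamp => st uv /orP[vs|tu].
  rewrite (min_idPl (le_trans vs st)) (min_idPl (le_trans (le_trans uv vs) st)).
  by rewrite (max_idPl vs) (max_idPl (le_trans uv vs)).
by rewrite (min_idPr tu) (min_idPr (le_trans tu uv)).
Qed.

Lemma clamp_diff g s t w : 0 <= s -> s <= t -> 0 <= w ->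
  g (clamp 0 t w) - g (clamp 0 s w) = g (clamp s t w) - g s.
Proof.
rewrite /clamp => s0 st w0; have [ws|/ltW sw] := leP w s.
  rewrite (min_idPl (le_trans ws st)) (max_idPr w0) (max_idPl ws).
  by rewrite !subrr.
have w0' : 0 <= Num.min w t by rewrite le_min w0 (le_trans s0).
have sw' : s <= Num.min w t by rewrite le_min sw.
by rewrite (max_idPr s0) (max_idPr w0') (max_idPr sw').
Qed.

Lemma clamp_itv s t r : s <= t -> s <= clamp s t r <= t.
Proof. by move=> st; have [] := @clamp_cases s t r st; move=> [? ->]; lra. Qed.

Lemma clamp_lip s t u v : s <= t -> u <= v ->
  0 <= clamp s t v - clamp s t u <= v - u.
Proof.
move=> st uv.
have [] := @clamp_cases s t u st; move=> [? ->];
have [] := @clamp_cases s t v st; move=> [? ->]; lra.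
Qed.

Lemma split_indicator u m v s : u < m -> m < v ->
  (u < s < m)%R%:R + (m < s < v)%R%:R <= (u < s < v)%R%:R :> R.
Proof.
move=> um mv.
case: (ltP u s) => us; case: (ltP s m) => sm; case: (ltP m s) => ms;
 case: (ltP s v) => sv /=; lra.
Qed.

(** Among the dyadic intervals of length [h], those interior to [[s, t]] number at
    most [(t - s) / h], and at most two more contain an end point. The indicators
    make the bound additive in [(u, v)], hence provable by induction. *)
Lemma dyad_count E B h s t : 0 <= B -> 0 < h -> s <= t ->
  (forall u v, 0 <= u -> v <= 1 -> v - u = h -> `|E u v| <= B) ->
  (forall u v, 0 <= u -> u <= v -> v <= 1 -> (v <= s) || (t <= u) -> E u v = 0) ->
  forall n u v, 0 <= u -> v <= 1 -> v - u = 2 ^+ n * h ->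
  `|dyad n E u v| <= B * ((clamp s t v - clamp s t u) / h +
                          (u < s < v)%R%:R + (u < t < v)%R%:R).
Proof.
move=> B0 h0 st EB E0; elim=> [|n IH] u v u0 v1 uvh /=.
  rewrite expr0 mul1r in uvh.
  have uv : u <= v by lra.
  have cl0 : 0 <= (clamp s t v - clamp s t u) / h.
    by rewrite divr_ge0 ?(ltW h0)//; have := clamp_lip st uv; lra.
  have [out|] := boolP ((v <= s) || (t <= u)).
    by rewrite E0// normr0 mulr_ge0// !addr_ge0// ler0n.
  rewrite negb_or -!ltNge => /andP[sv ut].
  apply: (le_trans (EB u v u0 v1 uvh)); rewrite ler_peMr//.
  rewrite sv ut andbT /=.
  have [us|su] := ltP u s; first by rewrite /= addrAC lerDr addr_ge0// ler0n.
  have [tv|vt] := ltP t v; first by rewrite /= lerDr addr_ge0.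
  rewrite /= !addr0 /clamp.
  rewrite (min_idPl vt) (min_idPl (ltW ut)) (max_idPr su) (max_idPr (ltW sv)).
  by rewrite uvh divff// gt_eqF.
have hn0 : 0 < 2 ^+ n * h by rewrite mulr_gt0// exprn_gt0.
rewrite exprS in uvh.
set m := (u + v) / 2.
have um : m - u = 2 ^+ n * h by rewrite /m; lra.
have mv : v - m = 2 ^+ n * h by rewrite /m; lra.
apply: le_trans (ler_normD _ _) _.
apply: (le_trans (lerD (IH u m u0 _ um) (IH m v _ v1 mv))); [lra|lra|].
rewrite -mulrDr ler_wpM2l//.
have um' : u < m by lra.
have mv' : m < v by lra.
have := split_indicator s um' mv'; have := split_indicator t um' mv'.
have -> : (clamp s t v - clamp s t u) / h = (clamp s t m - clamp s t u) / h +
  (clamp s t v - clamp s t m) / h by rewrite -mulrDl; congr (_ / _); ring.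
by move=> ? ?; lra.
Qed.

Lemma hld_norm a A f s t : hld a A f -> 0 <= s <= 1 -> 0 <= t <= 1 ->
  `|f t - f s| <= A * `|t - s| `^ a.
Proof.
move=> fA /andP[s0 s1] /andP[t0 t1]; have [st|/ltW ts] := leP s t.
  by rewrite (ger0_norm (_ : 0 <= t - s)) ?subr_ge0// fA.
rewrite distrC (distrC t) (ger0_norm (_ : 0 <= s - t)) ?subr_ge0//.
exact: fA.
Qed.

Lemma clamp1 s t : s <= t -> t <= 1 -> clamp s t 1 = t.
Proof. by rewrite /clamp => st t1; rewrite (min_idPr t1) (max_idPr st). Qed.

Lemma clamp0 s t : 0 <= s -> s <= t -> clamp s t 0 = s.
Proof.
by rewrite /clamp => s0 st; rewrite (min_idPl (le_trans s0 st)) (max_idPl s0).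
Qed.

Lemma hld_clamp b B g s t u v : 0 <= b -> hld b B g -> 0 <= s -> s <= t -> t <= 1 ->
  u <= v -> `|g (clamp s t v) - g (clamp s t u)| <= B * Num.min (v - u) (t - s) `^ b.
Proof.
move=> b0 gB s0 st t1 uv; have B0 := hld_ge0 gB.
have /andP[lo hi] := clamp_lip st uv.
have /andP[u1 u2] := clamp_itv u st; have /andP[v1 v2] := clamp_itv v st.
rewrite subr_ge0 in lo.
apply: (le_trans (gB _ _ (le_trans s0 u1) lo (le_trans v2 t1))).
rewrite ler_wpM2l// powR_le_base ?subr_ge0// le_min hi /=.
by rewrite lerB.
Qed.

Section one_scale.
Variables (al be A B s t : R) (f k : R -> R).
Hypotheses (al0 : 0 < al) (be0 : 0 < be) (s0 : 0 <= s) (st : s <= t) (t1 : t <= 1).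
Hypotheses (fA : hld al A f) (kB : hld be B k).
Hypothesis k_out : forall u v, 0 <= u -> u <= v -> v <= 1 ->
  (v <= s) || (t <= u) -> k u = k v.

Let germ u v := f u * (k v - k u).

Lemma dyad_total n E b : 0 <= b ->
  (forall u v, 0 <= u -> v <= 1 -> v - u = 2^-1 ^+ n -> `|E u v| <= b) ->
  (forall u v, 0 <= u -> u <= v -> v <= 1 -> (v <= s) || (t <= u) -> E u v = 0) ->
  `|dyad n E 0 1| <= b * ((t - s) / 2^-1 ^+ n + 2).
Proof.
move=> b0 Eb E0; have h0 : (0 : R) < 2^-1 ^+ n by rewrite exprn_gt0// invr_gt0.
have := dyad_count b0 h0 st Eb E0 (n := n) (lexx 0) (lexx 1).
have e : 1 - 0 = 2 ^+ n * 2^-1 ^+ n :> R.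
  by rewrite -exprMn divff ?expr1n ?subr0// pnatr_eq0.
move=> /(_ e) /le_trans; apply; rewrite ler_wpM2l//.
have := clamp_itv 0 st; have := clamp_itv 1 st => ? ?.
have : (clamp s t 1 - clamp s t 0) / 2^-1 ^+ n <= (t - s) / 2^-1 ^+ n.
  by rewrite ler_wpM2r ?invr_ge0 ?(ltW h0)//; lra.
have := ler_norm ((0 < s < 1)%R%:R : R).
have : (0 < s < 1)%R%:R <= 1 :> R by case: (_ && _); rewrite ?ler01.
have : (0 < t < 1)%R%:R <= 1 :> R by case: (_ && _); rewrite ?ler01.
move=> ? ? ? ?; lra.
Qed.

(** Bisecting the intervals replaces each germ by its defect of additivity, which is of
    order [al + be > 1]; only the intervals meeting [[s, t]] have one. *)
Lemma dyad_refine n : `|dyad n.+1 germ 0 1 - dyad n germ 0 1| <=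
  A * B * (2^-1 ^+ n) `^ (al + be) * ((t - s) / 2^-1 ^+ n + 2).
Proof.
have A0 := hld_ge0 fA; have B0 := hld_ge0 kB.
pose m u v : R := (u + v) / 2.
rewrite dyadS (@dyadB n _ _
  (fun u v => (f (m u v) - f u) * (k v - k (m u v)))) ?lexx ?ler01//; last first.
  by move=> u v *; rewrite /germ /m; ring.
apply: dyad_total => [|u v u0 v1 uvh|u v u0 uv v1 out].
- by rewrite !mulr_ge0// powR_ge0.
- have h0 : (0 : R) < 2^-1 ^+ n by rewrite exprn_gt0// invr_gt0.
  have um : u <= m u v by rewrite /m; lra.
  have mv : m u v <= v by rewrite /m; lra.
  rewrite normrM powR_mulD// mulrACA ler_pM//.
    apply: (le_trans (fA u0 um (le_trans mv v1))).
    by rewrite ler_wpM2l// powR_le_base ?(ltW al0)//; rewrite /m; lra.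
  apply: (le_trans (kB (le_trans u0 um) mv v1)).
  by rewrite ler_wpM2l// powR_le_base ?(ltW be0)//; rewrite /m; lra.
- rewrite (_ : k (m u v) = k v) ?subrr ?mulr0//; apply: k_out; rewrite /m; lra.
Qed.

Hypothesis kst : forall u v, 0 <= u -> u <= v -> v <= 1 ->
  `|k v - k u| <= B * (t - s) `^ be.

(** At the scale of [t - s] at most four intervals contribute, and on them [f] is close
    to [f s]. *)
Lemma dyad_coarse n : 2^-1 ^+ n <= t - s -> t - s <= 2 * 2^-1 ^+ n ->
  `|dyad n germ 0 1 - f s * (k 1 - k 0)| <= 4 * (A * B * (t - s) `^ (al + be)).
Proof.
move=> hts tsh.
have A0 := hld_ge0 fA; have B0 := hld_ge0 kB.
have h0 : (0 : R) < 2^-1 ^+ n by rewrite exprn_gt0// invr_gt0.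
rewrite -(dyad_additive n (f s) k 0 1).
rewrite (@dyadB n _ _ (fun u v => (f u - f s) * (k v - k u))) ?lexx ?ler01//; last first.
  by move=> u v *; rewrite /germ; ring.
have b0 : 0 <= A * B * (t - s) `^ (al + be) by rewrite !mulr_ge0// powR_ge0.
suff /le_trans : `|dyad n (fun u v => (f u - f s) * (k v - k u)) 0 1| <=
  A * B * (t - s) `^ (al + be) * ((t - s) / 2^-1 ^+ n + 2).
  apply; rewrite [leRHS]mulrC ler_wpM2l//.
  have : (t - s) / 2^-1 ^+ n <= 2 by rewrite ler_pdivrMr.
  lra.
apply: dyad_total => // [u v u0 v1 uvh|u v u0 uv v1 out]; last first.
  by rewrite (k_out u0 uv v1 out) subrr mulr0.
have uv : u <= v by lra.
have [out|] := boolP ((v <= s) || (t <= u)).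
  by rewrite (k_out u0 uv v1 out) subrr mulr0 normr0.
rewrite negb_or -!ltNge => /andP[sv ut].
rewrite normrM powR_mulD// mulrACA ler_pM//; last exact: kst.
have us01 : 0 <= u <= 1 by lra.
have ss01 : 0 <= s <= 1 by rewrite s0 (le_trans st).
apply: (le_trans (hld_norm fA ss01 us01)); rewrite ler_wpM2l// powR_le_base ?(ltW al0)//.
by rewrite ler_norml; apply/andP; split; lra.
Qed.

End one_scale.

End dyadic_sums.

Section existence.
Context {R : realType}.
Implicit Types (f g k : R -> R) (s t u v h A B : R).

Lemma dyadic_scale (x : R) : 0 < x -> x <= 1 ->
  exists n, 2^-1 ^+ n <= x /\ x <= 2 * 2^-1 ^+ n.
Proof.
move=> x0 x1; have ex : exists n, 2^-1 ^+ n <= x.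
  apply: contrapT => /forallNP H.
  have : x <= 0.
    apply: (@geometric_le0 _ _ 1 2^-1) => [||n]; [lra|lra|].
    by rewrite mul1r ltW// ltNge; apply/negP/H.
  by rewrite leNgt x0.
exists (ex_minn ex); case: ex_minnP => n nx nmin; split=> //.
case: n nx nmin => [|n] nx nmin; first by rewrite expr0; lra.
rewrite exprS mulrA divff ?pnatr_eq0// mul1r leNgt; apply/negP => /ltW /nmin.
by rewrite ltnn.
Qed.

(** Left-point sums along dyadic subdivisions, for the integrator stopped at [t].
    Consecutive levels differ by a geometrically small amount, and the difference
    of the sums stopped at [t] and at [s] only sees the intervals meeting [[s, t]],
    which yields the superlinear error for all [s] and [t] at once. *)
Lemma prim_exists (al be : R) : 0 < al -> 0 < be -> 1 < al + be ->
  exists2 K, 0 <= K & forall f g A B, hld al A f -> hld be B g ->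
  exists I : R -> R, forall s t, 0 <= s -> s <= t -> t <= 1 ->
    `|I t - I s - f s * (g t - g s)| <= K * A * B * (t - s) `^ (al + be).
Proof.
move=> al0 be0 ab1.
set th := al + be; pose r := (2^-1 : R) `^ (th - 1).
have th10 : 0 < th - 1 by rewrite subr_gt0.
have r0 : 0 <= r by exact: powR_ge0.
have r1 : r < 1 by exact: powR_half_lt1.
have r1' : 0 < 1 - r by rewrite subr_gt0.
have hth n : (2^-1 ^+ n : R) `^ th = 2^-1 ^+ n * r ^+ n.
  have -> : th = 1 + (th - 1) by ring.
  by rewrite powR_mul_base ?exprn_ge0 ?invr_ge0// powR_expn ?invr_ge0.
exists (3 / (1 - r) + 4); first by rewrite addr_ge0// divr_ge0// ltW.
move=> f g A B fA gB; have A0 := hld_ge0 fA; have B0 := hld_ge0 gB.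
have AB0 : 0 <= A * B by rewrite mulr_ge0.
pose k s t r := g (clamp s t r).
have kB s t : 0 <= s -> s <= t -> t <= 1 -> hld be B (k s t).
  move=> s0 st t1 u v u0 uv v1; rewrite /k.
  apply: (le_trans (hld_clamp (ltW be0) gB s0 st t1 uv)).
  by rewrite ler_wpM2l// powR_le_base ?(ltW be0)// ?ge_min ?lexx// le_min !subr_ge0 uv.
have k_out s t : s <= t -> forall u v, 0 <= u -> u <= v -> v <= 1 ->
    (v <= s) || (t <= u) -> k s t u = k s t v.
  by move=> st u v u0 uv v1 out; rewrite /k (clamp_out st uv out).
pose a t n := dyad n (fun u v => f u * (k 0 t v - k 0 t u)) 0 1.
have aconv t : exists l, 0 <= t <= 1 -> forall n, `|l - a t n| <= 3 * (A * B) * r ^+ n / (1 - r).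
  have [/andP[t0 t1]|] := boolP (0 <= t <= 1); last by exists 0.
  have [|l lP] := @geometric_limit _ (a t) (3 * (A * B)) r r0 r1; last by exists l.
  have ko u v : 0 <= u -> u <= v -> v <= 1 -> (v <= 0) || (1 <= u) -> k 0 t u = k 0 t v.
    move=> u0 uv v1 out; suff -> : u = v by [].
    by apply/eqP; rewrite eq_le uv /=; move/orP: out => [] ?; lra.
  move=> n; apply: (le_trans (dyad_refine al0 be0 ler01 fA
    (kB _ _ (lexx 0) t0 t1) ko n)).
  rewrite subr0 hth; set h := 2^-1 ^+ n.
  have h0 : 0 < h by rewrite exprn_gt0// invr_gt0.
  have h1 : h <= 1 by rewrite exprn_ile1//; lra.
  have -> : A * B * (h * r ^+ n) * (1 / h + 2) = A * B * r ^+ n * (1 + 2 * h).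
    by field; rewrite gt_eqF.
  have -> : 3 * (A * B) * r ^+ n = A * B * r ^+ n * 3 by ring.
  by rewrite ler_wpM2l ?mulr_ge0 ?exprn_ge0//; lra.
have [I IP] := choice aconv.
exists I => s t s0 st t1.
move: st; rewrite le_eqVlt => /predU1P[<-|ts].
  rewrite !subrr mulr0 subrr normr0 !mulr_ge0 ?powR_ge0//.
  by rewrite addr_ge0// divr_ge0// ltW.
have st := ltW ts; have t0 := le_trans s0 st; have s1 := le_trans st t1.
have ts0 : 0 < t - s by rewrite subr_gt0.
have ts1 : t - s <= 1 by lra.
have [n [nlo nhi]] := dyadic_scale ts0 ts1.
pose germ u v := f u * (k s t v - k s t u).
have aE j : a t j - a s j = dyad j germ 0 1.
  rewrite /a; apply: dyadB; rewrite ?lexx ?ler01// => u v u0 uv v1.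
  have kE w : 0 <= w -> k 0 t w - k 0 s w = k s t w - g s.
    by move=> w0; exact: clamp_diff.
  rewrite /germ -mulrBr.
  have := kE u u0; have := kE v (le_trans u0 uv) => ku kv.
  by congr (_ * _); lra.
pose b j := a t (n + j)%N - a s (n + j)%N.
have bS j : `|b j.+1 - b j| <= 3 * (A * B) * (t - s) * r ^+ n * r ^+ j.
  rewrite /b !aE addnS.
  have := dyad_refine al0 be0 st fA (kB _ _ s0 st t1) (k_out _ _ st) (n + j)%N.
  move=> /le_trans; apply.
  rewrite hth; set h := 2^-1 ^+ (n + j).
  have h0 : 0 < h by rewrite exprn_gt0// invr_gt0.
  have hts : h <= t - s.
    apply: le_trans nlo; rewrite /h exprD ger_pMr ?exprn_gt0 ?invr_gt0//.
    by rewrite exprn_ile1//; lra.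
  have -> : A * B * (h * r ^+ (n + j)) * ((t - s) / h + 2) =
     A * B * r ^+ (n + j) * (t - s + 2 * h) by field; rewrite gt_eqF.
  have -> : 3 * (A * B) * (t - s) * r ^+ n * r ^+ j =
     A * B * r ^+ (n + j) * (3 * (t - s)) by rewrite exprD; ring.
  by rewrite ler_wpM2l ?mulr_ge0 ?exprn_ge0//; lra.
have [l lP] := geometric_limit r0 r1 bS.
have s01 : 0 <= s <= 1 by rewrite s0 s1.
have t01 : 0 <= t <= 1 by rewrite t0 t1.
have lE : l = I t - I s.
  apply/eqP; rewrite -subr_eq0 -normr_le0.
  apply: (@geometric_le0 _ _ (3 * (A * B) * (t - s) * r ^+ n / (1 - r) +
    2 * (3 * (A * B) * r ^+ n / (1 - r))) r r0 r1) => j.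
  have -> : l - (I t - I s) = (l - b j) - (I t - a t (n + j)%N) + (I s - a s (n + j)%N).
    by rewrite /b; ring.
  apply: le_trans (ler_normD _ _) _.
  apply: le_trans (lerD (ler_normB _ _) (lexx _)) _.
  apply: (le_trans (lerD (lerD (lP j) (IP t t01 (n + j)%N)) (IP s s01 (n + j)%N))).
  by rewrite exprD le_eqVlt; apply/orP; left; apply/eqP; field; rewrite gt_eqF.
have coarse := dyad_coarse al0 be0 s0 st t1 fA (kB _ _ s0 st t1) (k_out _ _ st) _ nlo nhi.
have kst u v : 0 <= u -> u <= v -> v <= 1 -> `|k s t v - k s t u| <= B * (t - s) `^ be.
  move=> u0 uv v1; rewrite /k.
  apply: (le_trans (hld_clamp (ltW be0) gB s0 st t1 uv)).
  rewrite ler_wpM2l// powR_le_base ?(ltW be0)// ?ge_min ?lexx ?orbT//.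
  by rewrite le_min !subr_ge0 uv.
have k1 : k s t 1 = g t by rewrite /k clamp1.
have k0 : k s t 0 = g s by rewrite /k clamp0.
have {coarse} := coarse kst; rewrite k1 k0 -/germ -aE => coarse.
have := lP 0%N; rewrite lE /b addn0 expr0 mulr1 => lim0.
have -> : I t - I s - f s * (g t - g s) = (I t - I s - (a t n - a s n)) +
  (a t n - a s n - f s * (g t - g s)) by ring.
apply: le_trans (ler_normD _ _) _; apply: le_trans (lerD lim0 coarse) _.
have rn : (t - s) * r ^+ n <= (t - s) `^ th.
  have -> : th = 1 + (th - 1) by ring.
  rewrite powR_mul_base ?(ltW ts0)// ler_wpM2l ?(ltW ts0)//.
  rewrite /r -powR_expn ?invr_ge0// powR_le_base ?exprn_ge0 ?invr_ge0//.
  exact: ltW.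
have -> : (3 / (1 - r) + 4) * A * B * (t - s) `^ th =
  3 / (1 - r) * (A * B) * (t - s) `^ th + 4 * (A * B * (t - s) `^ th) by ring.
rewrite lerD2r.
have -> : 3 * (A * B) * (t - s) * r ^+ n / (1 - r) =
  3 / (1 - r) * (A * B) * ((t - s) * r ^+ n) by field; rewrite gt_eqF.
by rewrite ler_wpM2l// mulr_ge0// divr_ge0// ltW.
Qed.

End existence.

(** * Riemann sums *)

Section riemann_sums.
Context {R : realType}.
Implicit Types (f g I : R -> R) (a b c dl s t u v : R) (l : seq R) (tag : nat -> R).

Lemma mesh_ge a l i : (i < size l)%N ->
  nth a (a :: l) i.+1 - nth a (a :: l) i <= mesh a l.
Proof.
move=> il; rewrite /mesh.
apply: (@le_bigmax_seq _ _ _ _ _ i) => //.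
by rewrite mem_index_iota.
Qed.

Lemma riemann_sum_cons f g a x l tag : riemann_sum f g a (x :: l) tag =
  f (tag 0%N) * (g x - g a) + riemann_sum f g x l (fun i => tag i.+1).
Proof.
rewrite /riemann_sum /= big_nat_recl//=; congr (_ + _).
apply: eq_big_nat => i /andP[_ il].
rewrite (set_nth_default x a il) (_ : nth a (x :: l) i = nth x (x :: l) i)//.
by apply: set_nth_default; rewrite /= ltnS ltnW.
Qed.

(** Over the pieces of the subdivision a superlinear error sums up to the total length
    times a positive power of the mesh. *)
Lemma riemann_sum_near f g I c dl a th l tag : 1 < th -> 0 <= c -> 0 <= dl ->
  (forall u w v, 0 <= u -> u <= w -> w <= v -> v <= 1 ->
    `|f w * (g v - g u) - (I v - I u)| <= c * (v - u) `^ th) ->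
  0 <= a -> path <%R a l -> last a l <= 1 -> tags a l tag ->
  (forall i, (i < size l)%N -> nth a (a :: l) i.+1 - nth a (a :: l) i <= dl) ->
  `|riemann_sum f g a l tag - (I (last a l) - I a)| <=
    c * dl `^ (th - 1) * (last a l - a).
Proof.
move=> th1 c0 dl0 H; elim: l a tag => [|x l IH] a tag a0 /=.
  by move=> *; rewrite /riemann_sum /= big_nil !subrr normr0 mulr0.
move=> /andP[ax xl] l1 tg step.
have th10 : 0 < th - 1 by rewrite subr_gt0.
have lx : x <= last x l.
  have := xl; rewrite lt_path_sortedE => /andP[/allP xall _].
  by have := mem_last x l; rewrite inE => /predU1P[->//|/xall /ltW].
have [t0 t1] := andP (tg 0%N isT).
have IHx := IH x (fun i => tag i.+1) (le_trans a0 (ltW ax)) xl l1.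
have {IHx} IHx : `|riemann_sum f g x l (fun i => tag i.+1) - (I (last x l) - I x)|
    <= c * dl `^ (th - 1) * (last x l - x).
  apply: IHx => [i il|i il].
    have := tg i.+1; rewrite /= ltnS => /(_ il).
    rewrite (set_nth_default x a il) (_ : nth a (x :: l) i = nth x (x :: l) i)//.
    by apply: set_nth_default; rewrite /= ltnS ltnW.
  have := step i.+1; rewrite /= ltnS => /(_ il).
  rewrite (set_nth_default x a il) (_ : nth a (x :: l) i = nth x (x :: l) i)//.
  by apply: set_nth_default; rewrite /= ltnS ltnW.
rewrite riemann_sum_cons.
have -> : f (tag 0%N) * (g x - g a) + riemann_sum f g x l (fun i => tag i.+1) -
  (I (last x l) - I a) = (f (tag 0%N) * (g x - g a) - (I x - I a)) +
  (riemann_sum f g x l (fun i => tag i.+1) - (I (last x l) - I x)) by ring.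
apply: le_trans (ler_normD _ _) _.
have -> : c * dl `^ (th - 1) * (last x l - a) =
  c * dl `^ (th - 1) * (x - a) + c * dl `^ (th - 1) * (last x l - x) by ring.
apply: lerD => //; apply: le_trans (H _ _ _ a0 t0 t1 (le_trans lx l1)) _.
rewrite -mulrA ler_wpM2l//.
have {1}-> : th = 1 + (th - 1) by ring.
have xa0 : 0 <= x - a by rewrite subr_ge0 ltW.
rewrite powR_mul_base// mulrC ler_wpM2r// powR_le_base ?(ltW th10)//.
exact: (step 0%N isT).
Qed.

Lemma fine_partition a b dl : a <= b -> 0 < dl ->
  exists l, itv_partition a b l /\ mesh a l < dl.
Proof.
rewrite le_eqVlt => /predU1P[<-|ab] dl0.
  by exists [::]; split; [split=> /=|rewrite /mesh /= big_nil].
pose n := (Num.trunc ((b - a) / dl)).+1.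
have n0 : 0 < n%:R :> R by rewrite ltr0n.
have ba0 : 0 < b - a by rewrite subr_gt0.
have nd : (b - a) / n%:R < dl.
  by rewrite ltr_pdivrMr// mulrC -ltr_pdivrMr// truncnS_gt.
pose u i : R := a + (b - a) / n%:R * i%:R.
pose l := [seq u i | i <- iota 1 n].
have sl : size l = n by rewrite size_map size_iota.
have nthl i : (i <= n)%N -> nth a (a :: l) i = u i.
  case: i => [_|i i_n] /=; first by rewrite /u mulr0 addr0.
  by rewrite (nth_map 0%N) ?size_iota// nth_iota// add1n.
have step i : u i.+1 - u i = (b - a) / n%:R.
  by rewrite /u -natr1; ring.
exists l; split; [split|].
- apply/(pathP a) => i; rewrite sl => i_n.
  rewrite nthl 1?ltnW// (_ : nth a l i = nth a (a :: l) i.+1)// nthl//.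
  by rewrite -subr_gt0 step divr_gt0.
- apply/eqP; rewrite (last_nth a) sl nthl// /u mulfVK ?gt_eqF//; ring.
- rewrite /mesh sl big_nat; elim/big_ind : _ => //.
    by move=> x y xd yd; rewrite gt_max xd.
  by move=> i /andP[_ i_n]; rewrite !nthl ?step// ltnW.
Qed.

Lemma young_unique f g a b (x y : R) : a <= b ->
  is_young_integral f g a b x -> is_young_integral f g a b y -> x = y.
Proof.
move=> ab [_ H] [_ H']; apply/eqP; rewrite -subr_eq0 -normr_le0 leNgt; apply/negP => e0.
have [dl dl0 Hd] := H (`|x - y| / 2) (divr_gt0 e0 (ltr0n _ 2)).
have [dl' dl'0 Hd'] := H' (`|x - y| / 2) (divr_gt0 e0 (ltr0n _ 2)).
have [|l [lp]] := @fine_partition a b (Num.min dl dl') ab; first by rewrite lt_min dl0.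
rewrite lt_min => /andP[ml ml'].
have tg : tags a l (fun i => nth a (a :: l) i).
  move=> i il; rewrite lexx /=; case: lp => /(pathP a) lp _.
  exact/ltW/lp.
have := Hd _ _ lp tg ml; have := Hd' _ _ lp tg ml'.
set S := riemann_sum _ _ _ _ _ => h' h.
have : `|x - y| <= `|S - x| + `|S - y|.
  by rewrite (distrC S x) ler_distD.
lra.
Qed.

Lemma hld_continuous a c f : 0 < a -> hld a c f -> {within `[0, 1], continuous f}.
Proof.
move=> a0 fc; have c0 := hld_ge0 fc.
pose F r := f (clamp 0 1 r).
have Fc : continuous F.
  move=> x; apply/cvgrPdist_lt => e e0.
  pose h := (e / (c + 1)) `^ a^-1.
  have ec0 : 0 < e / (c + 1) by rewrite divr_gt0//; lra.
  have h0 : 0 < h by rewrite powR_gt0.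
  near=> y.
  have xy : `|x - y| < h by near: y; exact: cvgr_dist_lt.
  have cl (r : R) : 0 <= clamp 0 1 r <= 1 by exact: clamp_itv ler01.
  apply: (le_lt_trans (hld_norm fc (cl y) (cl x))).
  have ch : `|clamp 0 1 x - clamp 0 1 y| <= h.
    apply: le_trans (ltW xy); have [yx|/ltW yx] := leP y x.
      by have /andP[p q] := clamp_lip ler01 yx; rewrite (ger0_norm p) (le_trans q)// ler_norm.
    have /andP[p q] := clamp_lip ler01 yx.
    by rewrite distrC (distrC x) (ger0_norm p) (le_trans q)// ler_norm.
  apply: le_lt_trans (_ : c * (e / (c + 1)) < e).
    rewrite ler_wpM2l//; apply: le_trans (powR_le_base (ltW a0) (normr_ge0 _) ch) _.
    by rewrite /h -powRrM mulVf ?gt_eqF// powRr1// ltW.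
  by rewrite mulrA ltr_pdivrMr; nra.
apply: (@subspace_eq_continuous _ _ _ F); last exact: continuous_subspaceT.
move=> x; rewrite inE/= in_itv/= => /andP[x0 x1]; rewrite /F; congr f.
by rewrite /clamp (min_idPl x1) (max_idPr x0).
Unshelve. all: by end_near. Qed.

Lemma hoelder_enorm_le a b c f : 0 < a -> hld a c f ->
  (forall t, 0 <= t <= 1 -> `|f t| <= b) -> (hoelder_enorm a f <= (b + c)%:E)%E.
Proof.
move=> a0 fc fb; rewrite /hoelder_enorm EFinD; apply: leeD.
  by apply: ge_ereal_sup => _ [t /= t01 <-]; rewrite in_itv/= in t01; rewrite lee_fin fb.
apply: ge_ereal_sup => _ [[s t] [/= s0 st t1] <-].
have ts : 0 < t - s by rewrite subr_gt0.
by rewrite lee_fin (ger0_norm (ltW ts)) ler_pdivrMr ?powR_gt0// fc// ltW.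
Qed.

Lemma hld_bound01 a c f : 0 < a -> hld a c f ->
  forall t, 0 <= t <= 1 -> `|f t| <= `|f 0| + c.
Proof.
move=> a0 fc t /andP[t0 t1]; have c0 := hld_ge0 fc.
have -> : f t = f 0 + (f t - f 0) by ring.
apply: le_trans (ler_normD _ _) _; rewrite lerD2l.
apply: (le_trans (fc _ _ (lexx 0) t0 t1)); rewrite subr0 ler_piMr//.
by have := powR_le_base (ltW a0) t0 t1; rewrite powR1.
Qed.

Lemma hold_is_hoelder a f : 0 < a -> hold a f -> is_hoelder a f.
Proof.
move=> a0 [c fc]; split; first exact: hld_continuous fc.
apply: (le_lt_trans (hoelder_enorm_le a0 fc (hld_bound01 a0 fc))).
exact: ltry.
Qed.

(** The Riemann sums of [f dg] converge to the increments of any primitive,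
    whatever the tags: moving the tags costs another superlinear error. *)
Lemma prim_is_young (al be : R) f g I a b : 0 < al -> 0 < be -> 1 < al + be ->
  hold al f -> hold be g -> prim f g I -> 0 <= a -> a <= b -> b <= 1 ->
  is_young_integral f g a b (I b - I a).
Proof.
move=> al0 be0 ab1 fh gh [c [th [th1 H]]] a0 ab b1.
split; first by exists al, be; split=> //; exact: hold_is_hoelder.
have [A fA] := fh; have [B gB] := gh.
have A0 := hld_ge0 fA; have B0 := hld_ge0 gB; have c0 := bound_ge0 H.
pose C := A * B + c; pose th' := Num.min (al + be) th.
have th'1 : 1 < th' by rewrite lt_min ab1.
have th'0 : 0 < th' - 1 by rewrite subr_gt0.
have C0 : 0 <= C by rewrite addr_ge0// mulr_ge0.
have key u w v : 0 <= u -> u <= w -> w <= v -> v <= 1 ->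
    `|f w * (g v - g u) - (I v - I u)| <= C * (v - u) `^ th'.
  move=> u0 uw wv v1; have uv := le_trans uw wv.
  have -> : f w * (g v - g u) - (I v - I u) =
    (f w - f u) * (g v - g u) - (I v - I u - f u * (g v - g u)) by ring.
  apply: le_trans (ler_normB _ _) _.
  apply: le_trans (le_pow_min u0 uv v1 ab1 th1 (mulr_ge0 A0 B0) c0).
  apply: lerD; last exact: H.
  rewrite normrM powR_mulD// mulrACA ler_pM//; last exact: gB.
  apply: (le_trans (fA _ _ u0 uw (le_trans wv v1))).
  by rewrite ler_wpM2l// powR_le_base ?(ltW al0)// ?subr_ge0// lerD2r.
move=> e e0; pose h := (e / (C + 1)) `^ (th' - 1)^-1.
have ec0 : 0 < e / (C + 1) by rewrite divr_gt0//; lra.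
have h0 : 0 < h by rewrite powR_gt0.
exists h => // l tag [lp /eqP lb] tg lm.
have := @riemann_sum_near f g I C h a th' l tag th'1 C0 (ltW h0) key a0 lp.
rewrite lb => /(_ b1 tg) near_; apply: le_lt_trans (near_ _) _.
  by move=> i il; apply: le_trans (mesh_ge a il) (ltW lm).
rewrite /h -powRrM mulVf ?gt_eqF// powRr1 ?(ltW ec0)//.
apply: le_lt_trans (_ : C * (e / (C + 1)) < e).
  rewrite ler_piMr//; first by rewrite mulr_ge0 ?(ltW ec0).
  by apply: le_trans b1; rewrite lerBlDr lerDl.
by rewrite mulrA ltr_pdivrMr; nra.
Qed.

Lemma young_integralE (al be : R) f g I a b : 0 < al -> 0 < be -> 1 < al + be ->
  hold al f -> hold be g -> prim f g I -> 0 <= a -> a <= b -> b <= 1 ->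
  young_integral f g a b = I b - I a.
Proof.
move=> al0 be0 ab1 fh gh fgI a0 ab b1.
have H := prim_is_young al0 be0 ab1 fh gh fgI a0 ab b1.
rewrite /young_integral; apply: (young_unique ab); last exact: H.
by case: xgetP => [y -> //|/(_ _ H)].
Qed.

End riemann_sums.

(** * Hölder spaces *)

Section hoelder_type_basics.
Context {R : realType}.
Implicit Types (a b c s t : R).

Lemma hoelder_normE a (f : hoelderType a) : (`|f|)%:E = hoelder_enorm a f.
Proof.
have := hoelderP f; rewrite inE => -[_ [_ foo]].
by rewrite fineK// ge0_fin_numE// hoelder_enorm_ge0.
Qed.

Lemma hoelder_sup a (f : hoelderType a) t : 0 <= t <= 1 -> `|f t| <= `|f|.
Proof.
move=> t01; rewrite -lee_fin hoelder_normE; apply: (le_trans (sup_enorm_ge f t01)).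
by rewrite leeDl// hoelder_seminorm_ge0.
Qed.

Lemma hoelder_hld a (f : hoelderType a) : hld a `|f| f.
Proof.
move=> s t s0; rewrite le_eqVlt => /predU1P[<- _|st t1].
  by rewrite subrr normr0 mulr_ge0 ?powR_ge0.
have ts : 0 < t - s by rewrite subr_gt0.
rewrite -ler_pdivrMr ?powR_gt0// -lee_fin hoelder_normE.
apply: le_trans (_ : (hoelder_seminorm a f <= _)%E); last by rewrite leeDr// sup_enorm_ge0.
by have := hoelder_seminorm_ge a f s0 st t1; rewrite (ger0_norm (ltW ts)).
Qed.

Lemma hoelder_hold a (f : hoelderType a) : hold a f.
Proof. by exists `|f|; exact: hoelder_hld. Qed.

Lemma hoelder_ext a (f g : hoelderType a) :
  (forall t, 0 <= t <= 1 -> f t = g t) -> f = g.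
Proof.
move=> fg; apply/val_inj/funext => t /=.
have := hoelderP f; have := hoelderP g; rewrite !inE => -[<- _] -[<- _].
rewrite !patchE; case: ifPn => // /[!inE]/= /[!in_itv]/= t01.
exact: fg.
Qed.

Lemma hoelder_build a (f : R -> R) : 0 < a -> hold a f ->
  exists F : hoelderType a, forall t, 0 <= t <= 1 -> F t = f t.
Proof.
move=> a0 [c fc].
pose g := f \_ `[0, 1].
have gf t : 0 <= t <= 1 -> g t = f t.
  by move=> t01; rewrite /g patchE ifT// inE/= in_itv/=.
have gP : g \in hoelder_pred a.
  rewrite inE/=; split.
    by apply/funext => t; rewrite /g !patchE; case: (t \in _).
  apply: hold_is_hoelder => //; exists c => s t s0 st t1.
  by rewrite !gf ?s0 ?t1 ?(le_trans s0)//= ?(le_trans st)// fc.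
by exists (Hoelder gP) => t; exact: gf.
Qed.

(** The value is chosen by its graph, so that no proof of regularity occurs in the
    terms; it is the expected one as soon as [f] is regular, see [restrE]. *)
Definition restr a (f : R -> R) : hoelderType a :=
  xget 0 [set F : hoelderType a | forall t, 0 <= t <= 1 -> F t = f t].

Lemma restrE a f t : 0 < a -> hold a f -> 0 <= t <= 1 -> restr a f t = f t.
Proof.
move=> a0 fh t01; rewrite /restr; case: xgetP => [F _ /= ->//|].
by have [F FP] := hoelder_build a0 fh => /(_ F FP).
Qed.

Lemma hoelder_norm_le a b c (f : hoelderType a) : 0 < a ->
  hld a c f -> (forall t, 0 <= t <= 1 -> `|f t| <= b) -> `|f| <= b + c.
Proof. by move=> a0 fc fb; rewrite -lee_fin hoelder_normE hoelder_enorm_le. Qed.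

Lemma restr_norm a b c f : 0 < a -> hld a c f ->
  (forall t, 0 <= t <= 1 -> `|f t| <= b) -> `|restr a f| <= b + c.
Proof.
move=> a0 fc fb; have fh : hold a f by exists c.
apply: hoelder_norm_le => // [s t s0 st t1|t t01]; last by rewrite restrE// fb.
by rewrite !restrE ?s0 ?t1 ?(le_trans s0)//= ?(le_trans st)// fc.
Qed.

End hoelder_type_basics.

Section hold_closure.
Context {R : realType}.
Implicit Types (a b c s t : R) (f g : R -> R).

Lemma hldW a b c f : 0 < b -> b <= a -> hld a c f -> hld b c f.
Proof.
move=> b0 ba fc s t s0 st t1; apply: (le_trans (fc _ _ s0 st t1)).
rewrite ler_wpM2l ?(hld_ge0 fc)//; apply: powR_le_exp => //; rewrite ?subr_ge0//.
by rewrite lerBlDr; lra.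
Qed.

Lemma hld_le a b c f : b <= c -> hld a b f -> hld a c f.
Proof.
move=> bc fb s t s0 st t1; apply: (le_trans (fb _ _ s0 st t1)).
by rewrite ler_wpM2r ?powR_ge0.
Qed.

Lemma hldD a b c f g : hld a b f -> hld a c g -> hld a (b + c) (fun t => f t + g t).
Proof.
move=> fb gc s t s0 st t1.
have -> : f t + g t - (f s + g s) = (f t - f s) + (g t - g s) by ring.
by rewrite mulrDl (le_trans (ler_normD _ _))// lerD ?fb ?gc.
Qed.

Lemma hldZ a c k f : hld a c f -> hld a (`|k| * c) (fun t => k * f t).
Proof.
by move=> fc s t s0 st t1; rewrite -mulrBr normrM -mulrA ler_wpM2l// fc.
Qed.

Lemma hldM a b c b' c' f g : (forall t, 0 <= t <= 1 -> `|f t| <= b) -> hld a c f ->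
  (forall t, 0 <= t <= 1 -> `|g t| <= b') -> hld a c' g ->
  hld a (b * c' + b' * c) (fun t => f t * g t).
Proof.
move=> fb fc gb gc s t s0 st t1.
have s01 : 0 <= s <= 1 by rewrite s0 (le_trans st).
have t01 : 0 <= t <= 1 by rewrite t1 (le_trans s0).
have -> : f t * g t - f s * g s = f s * (g t - g s) + g t * (f t - f s) by ring.
rewrite mulrDl (le_trans (ler_normD _ _))// !normrM -!mulrA.
by rewrite lerD// ler_pM// ?fb ?gb ?fc ?gc.
Qed.

Lemma hold_bounded a f : 0 < a -> hold a f ->
  exists B, forall t, 0 <= t <= 1 -> `|f t| <= B.
Proof. by move=> a0 [c fc]; exists (`|f 0| + c) => t; exact: hld_bound01 fc t. Qed.

Lemma holdW a b f : 0 < b -> b <= a -> hold a f -> hold b f.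
Proof. by move=> b0 ba [c fc]; exists c; exact: hldW fc. Qed.

Lemma holdD a f g : hold a f -> hold a g -> hold a (fun t => f t + g t).
Proof. by move=> [b fb] [c gc]; exists (b + c); exact: hldD. Qed.

Lemma holdZ a k f : hold a f -> hold a (fun t => k * f t).
Proof. by move=> [c fc]; exists (`|k| * c); exact: hldZ. Qed.

Lemma holdN a f : hold a f -> hold a (fun t => - f t).
Proof.
move=> [c fc]; exists c => s t s0 st t1.
by rewrite -opprD normrN fc.
Qed.

Lemma holdB a f g : hold a f -> hold a g -> hold a (fun t => f t - g t).
Proof. by move=> hf hg; apply: holdD => //; exact: holdN. Qed.

Lemma holdM a f g : 0 < a -> hold a f -> hold a g -> hold a (fun t => f t * g t).
Proof.
move=> a0 hf hg; have [bf bfP] := hold_bounded a0 hf; have [bg bgP] := hold_bounded a0 hg.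
by case: hf hg => c fc [c' gc]; exists (bf * c' + bg * c); exact: hldM.
Qed.

Lemma hold_cst a k : hold a (fun=> k).
Proof. by exists 0 => s t *; rewrite subrr normr0 mul0r. Qed.

Lemma hold_id : hold 1 (fun t : R => t).
Proof.
exists 1 => s t s0 st t1; rewrite mul1r powRr1 ?subr_ge0// ger0_norm ?subr_ge0//.
Qed.

Lemma eq_hold a f g : (forall t, 0 <= t <= 1 -> f t = g t) -> hold a f -> hold a g.
Proof.
move=> fg [c fc]; exists c => s t s0 st t1.
by rewrite -!fg ?s0 ?t1 ?(le_trans s0)//= ?(le_trans st)// fc.
Qed.

Lemma hld_green t : 0 <= t <= 1 -> hld 1 2 (green t).
Proof.
move=> t01 s u s0 su u1; rewrite powRr1 ?subr_ge0// /green ler_norml.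
have := le_refl u; case: (leP t u) => ?; case: (leP t s) => ? ?;
  apply/andP; split; nra.
Qed.

Lemma green_sym t s : green t s = green s t.
Proof. by rewrite /green minC mulrC. Qed.

End hold_closure.

(** * Calculus of Young integrals *)

Section young_calculus.
Context {R : realType}.
Variables (al be : R).
Hypotheses (al0 : 0 < al) (be0 : 0 < be) (ab1 : 1 < al + be).
Implicit Types (f g h I : R -> R) (s t : R).

Definition yprim f g t := young_integral f g 0 t.

Lemma yprimP f g : hold al f -> hold be g -> prim f g (yprim f g).
Proof.
move=> fh gh; have [K K0 KP] := prim_exists al0 be0 ab1.
have [A fA] := fh; have [B gB] := gh.
have [I IP] := KP _ _ _ _ fA gB.
have pI : prim f g I by exists (K * A * B), (al + be).
apply: (@eq_prim _ f f g g (fun t => I t - I 0)) => // [t /andP[t0 t1]|].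
  by rewrite /yprim (young_integralE al0 be0 ab1 fh gh pI).
case: pI => c [a [a1 H]]; exists c, a; split=> // s t s0 st t1.
by rewrite (_ : _ - (I s - I 0) = I t - I s); [exact: H|ring].
Qed.

Lemma young_yprim f g s t : hold al f -> hold be g -> 0 <= s -> s <= t -> t <= 1 ->
  young_integral f g s t = yprim f g t - yprim f g s.
Proof.
by move=> fh gh s0 st t1; apply: (young_integralE al0 be0) => //; exact: yprimP.
Qed.

Lemma yprim0 f g : hold al f -> hold be g -> yprim f g 0 = 0.
Proof.
move=> fh gh; rewrite /yprim.
by rewrite (young_integralE al0 be0 ab1 fh gh (yprimP fh gh)) ?subrr.
Qed.

Lemma yprimE f g I t : hold al f -> hold be g -> prim f g I -> 0 <= t <= 1 ->
  yprim f g t = I t - I 0.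
Proof.
move=> fh gh pI /andP[t0 t1].
by rewrite /yprim (young_integralE al0 be0 ab1 fh gh pI).
Qed.

Lemma yprim_bound : exists2 K, 0 <= K & forall f g b A B,
  (forall t, 0 <= t <= 1 -> `|f t| <= b) -> hld al A f -> hld be B g ->
  hld be ((b + K * A) * B) (yprim f g).
Proof.
have [K K0 KP] := prim_exists al0 be0 ab1.
exists K => // f g b A B fb fA gB s t s0 st t1.
have fh : hold al f by exists A.
have gh : hold be g by exists B.
have [I IP] := KP _ _ _ _ fA gB.
have pI : prim f g I by exists (K * A * B), (al + be).
rewrite !(yprimE fh gh pI) ?s0 ?t1 ?(le_trans s0)//= ?(le_trans st)//.
have -> : I t - I 0 - (I s - I 0) =
  f s * (g t - g s) + (I t - I s - f s * (g t - g s)) by ring.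
apply: le_trans (ler_normD _ _) _; rewrite !mulrDl; apply: lerD.
  by rewrite normrM -mulrA ler_pM ?gB// fb// s0 (le_trans st).
apply: (le_trans (IP _ _ s0 st t1)); rewrite ler_wpM2l//.
  by rewrite !mulr_ge0// ?(hld_ge0 fA) ?(hld_ge0 gB).
by apply: powR_le_exp => //; [lra|lra|rewrite lerDr ltW].
Qed.

Lemma yprim_hold f g : hold al f -> hold be g -> hold be (yprim f g).
Proof.
move=> fh gh; have [b fb] := hold_bounded al0 fh.
case: fh gh => A fA [B gB]; have [K K0 KP] := yprim_bound.
by exists ((b + K * A) * B); exact: KP.
Qed.

Lemma young_lin f f' g k k' : hold al f -> hold al f' -> hold be g ->
  young_integral (fun t => k * f t + k' * f' t) g 0 1 =
  k * young_integral f g 0 1 + k' * young_integral f' g 0 1.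
Proof.
move=> fh fh' gh; have p := yprimP fh gh; have p' := yprimP fh' gh.
have fk : hold al (fun t => k * f t + k' * f' t) by apply: holdD; exact: holdZ.
rewrite (young_integralE al0 be0 ab1 fk gh
  (prim_addl (prim_scalel k p) (prim_scalel k' p')))//.
by rewrite /yprim -!/(yprim _ _ _) !yprim0// !mulr0; ring.
Qed.

Lemma young_linr f g g' k k' : hold al f -> hold be g -> hold be g' ->
  young_integral f (fun t => k * g t + k' * g' t) 0 1 =
  k * young_integral f g 0 1 + k' * young_integral f g' 0 1.
Proof.
move=> fh gh gh'; have p := yprimP fh gh; have p' := yprimP fh gh'.
have gk : hold be (fun t => k * g t + k' * g' t) by apply: holdD; exact: holdZ.
rewrite (young_integralE al0 be0 ab1 fh gk
  (prim_addr (prim_scaler k p) (prim_scaler k' p')))//.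
by rewrite -!/(yprim _ _ _) !yprim0// !mulr0; ring.
Qed.

Lemma eq_young f f' g g' a b : 0 <= a -> a <= b -> b <= 1 ->
  hold al f -> hold be g ->
  (forall t, 0 <= t <= 1 -> f t = f' t) -> (forall t, 0 <= t <= 1 -> g t = g' t) ->
  young_integral f g a b = young_integral f' g' a b.
Proof.
move=> a0 ab b1 fh gh ff gg.
have p := yprimP fh gh.
have fh' : hold al f' by exact: eq_hold ff fh.
have gh' : hold be g' by exact: eq_hold gg gh.
have p' : prim f' g' (yprim f g) by exact: (eq_prim ff gg _ p).
by rewrite (young_integralE al0 be0 ab1 fh gh p)// (young_integralE al0 be0 ab1 fh' gh' p').
Qed.

End young_calculus.

(** * The Green function of the boundary value problem *)

Section green_operator.
Context {R : realType}.
Variable (be : R).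
Hypothesis be0 : 0 < be.
Implicit Types (P Q f g h I : R -> R) (s t : R).

Let one0 : (0 : R) < 1 := ltr01.
Let be11 : 1 < be + 1. Proof. by rewrite ltrDr. Qed.
Let be11' : 1 < 1 + be. Proof. by rewrite ltrDl. Qed.

(** In the boundary value problem with $dQ=\sigma(z)\,dx$ the inner integral is
    [tail Q] and the outer one is [tail_int Q]. *)
Definition tail Q t : R := Q 1 - Q t.
Definition tail_int Q : R -> R := yprim (tail Q) (fun t => t).

(** This is the function $t\mapsto\int_0^1K(t,\xi)\,dQ_\xi$, see [young_green]. *)
Definition lam Q t : R := tail_int Q t - t * tail_int Q 1.

Lemma hld_tail c Q : hld be c Q -> hld be c (tail Q).
Proof.
move=> Qc s t s0 st t1; rewrite /tail (_ : _ - (Q 1 - Q s) = - (Q t - Q s)).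
  by rewrite normrN Qc.
ring.
Qed.

Lemma tail_bound c Q t : hld be c Q -> 0 <= t <= 1 -> `|tail Q t| <= c.
Proof.
move=> Qc /andP[t0 t1]; apply: (le_trans (Qc _ _ t0 t1 (lexx 1))).
rewrite ler_piMr ?(hld_ge0 Qc)//.
have := powR_le_base (ltW be0) (_ : 0 <= 1 - t) (_ : 1 - t <= 1).
by rewrite powR1 subr_ge0; apply => //; rewrite gerBl.
Qed.

Lemma hold_tail Q : hold be Q -> hold be (tail Q).
Proof. by move=> [c Qc]; exists c; exact: hld_tail. Qed.

Lemma tail_intP Q : hold be Q -> prim (tail Q) (fun t => t) (tail_int Q).
Proof. move=> Qh; apply: (yprimP be0 one0 be11); [exact: hold_tail|exact: hold_id]. Qed.

Lemma tail_int0 Q : hold be Q -> tail_int Q 0 = 0.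
Proof. by move=> Qh; apply: (yprim0 be0 one0 be11); [exact: hold_tail|exact: hold_id]. Qed.

Lemma tail_int_bound : exists2 K, 0 <= K & forall Q c, hld be c Q ->
  hld 1 (K * c) (tail_int Q).
Proof.
have [K K0 KP] := yprim_bound be0 one0 be11.
exists (1 + K) => [|Q c Qc]; first by rewrite addr_ge0.
have i1 : hld 1 1 (fun t : R => t).
  by move=> s t s0 st t1; rewrite mul1r powRr1 ?subr_ge0// ger0_norm ?subr_ge0.
have := KP _ _ _ _ _ (fun t => tail_bound Qc) (hld_tail Qc) i1.
by rewrite mulr1 mulrDl mul1r.
Qed.

Lemma lam_bound : exists2 K, 0 <= K & forall Q c, hld be c Q ->
  hld 1 (K * c) (lam Q) /\ forall t, 0 <= t <= 1 -> `|lam Q t| <= K * c.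
Proof.
have [K K0 KP] := tail_int_bound.
exists (2 * K) => [|Q c Qc]; first by rewrite mulr_ge0.
have Qh : hold be Q by exists c.
have BL := KP _ _ Qc.
have c0 := hld_ge0 Qc.
have Kc : 0 <= K * c by rewrite mulr_ge0.
have B1 : `|tail_int Q 1| <= K * c.
  have := BL 0 1 (lexx _) ler01 (lexx _).
  by rewrite tail_int0// !subr0 powR1 mulr1.
have L : hld 1 (2 * K * c) (lam Q).
  move=> s t s0 st t1; rewrite /lam.
  have -> : tail_int Q t - t * tail_int Q 1 - (tail_int Q s - s * tail_int Q 1) =
    (tail_int Q t - tail_int Q s) - (t - s) * tail_int Q 1 by ring.
  apply: (le_trans (ler_normB _ _)).
  have -> : 2 * K * c * (t - s) `^ 1 = K * c * (t - s) `^ 1 + K * c * (t - s) `^ 1.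
    ring.
  apply: lerD; first exact: BL.
  rewrite normrM powRr1 ?subr_ge0// ger0_norm ?subr_ge0// mulrC.
  by rewrite ler_wpM2r ?subr_ge0.
split=> // t /andP[t0 t1].
have := L 0 t (lexx _) t0 t1.
rewrite {2}/lam tail_int0// mul0r !subr0 powRr1// => /le_trans; apply.
by rewrite ler_piMr// -mulrA mulr_ge0.
Qed.

Lemma lam_hold Q : hold be Q -> hold 1 (lam Q).
Proof.
by move=> [c Qc]; have [K _ KP] := lam_bound; exists (K * c); case: (KP _ _ Qc).
Qed.

(** Integration by parts of $\min(t,\cdot)$ against [Q]. *)
Lemma prim_min Q t : hold be Q -> 0 <= t <= 1 ->
  prim (Num.min t) Q (fun s => tail_int Q (Num.min t s) - Num.min t s * tail Q s).
Proof.
move=> Qh /andP[t0 t1]; have [c [a [a1 H]]] := tail_intP Qh; have c0 := bound_ge0 H.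
have [B QB] := Qh; have B0 := hld_ge0 QB.
exists (c + B), (Num.min a (1 + be)); split; first by rewrite lt_min a1.
move=> u v u0 uv v1.
set m := Num.min t.
have mm : 0 <= m v - m u <= v - u.
  by rewrite /m; case: (leP t u) => ?; case: (leP t v) => ?; lra.
have m0 : 0 <= m u by rewrite le_min t0.
have m1 : m v <= 1 by rewrite ge_min t1.
have muv : m u <= m v by lra.
have -> : tail_int Q (m v) - m v * tail Q v - (tail_int Q (m u) - m u * tail Q u) -
    m u * (Q v - Q u) = (tail_int Q (m v) - tail_int Q (m u) - tail Q (m u) * (m v - m u))
    + (tail Q (m u) - tail Q v) * (m v - m u).
  by rewrite /tail; ring.
apply: le_trans (ler_normD _ _) _.
apply: le_trans (le_pow_min u0 uv v1 a1 be11' c0 B0); apply: lerD.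
  apply: (le_trans (H _ _ m0 muv m1)).
  by rewrite ler_wpM2l// powR_le_base//; lra.
have [tu|ut] := leP t u.
  rewrite /m (min_idPl tu) (min_idPl (le_trans tu uv)) subrr mulr0 normr0.
  by rewrite mulr_ge0 ?powR_ge0.
rewrite {1}/m (min_idPr (ltW ut)) normrM powR_mul_base ?subr_ge0// mulrCA mulrC.
rewrite ler_pM//; last by rewrite distrC (hld_tail QB).
by rewrite ger0_norm; lra.
Qed.

(** On [[0, 1]] the kernel is $t\wedge\xi-t(1\wedge\xi)$, to which integration by parts
    applies term by term. *)
Lemma prim_green Q t : hold be Q -> 0 <= t <= 1 ->
  exists2 I, prim (green t) Q I & I 1 - I 0 = lam Q t.
Proof.
move=> Qh t01; have /andP[t0 t1] := t01.
have p1 := prim_min Qh (_ : 0 <= 1 <= 1); rewrite lexx ler01 in p1.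
have pt := prim_min Qh t01.
exists (fun s => (tail_int Q (Num.min t s) - Num.min t s * tail Q s) +
  - t * (tail_int Q (Num.min 1 s) - Num.min 1 s * tail Q s)).
  apply: (eq_prim _ _ _ (prim_addl pt (prim_scalel (- t) (p1 isT)))) => // s /andP[s0 s1].
  by rewrite /green (min_idPr s1); ring.
rewrite /lam /tail (min_idPl t1) (min_idPr t0) (min_idPl (lexx 1)) (min_idPr ler01).
by rewrite tail_int0//; ring.
Qed.

Lemma young_green Q t : hold be Q -> 0 <= t <= 1 ->
  young_integral (green t) Q 0 1 = lam Q t.
Proof.
move=> Qh t01; have [I pI <-] := prim_green Qh t01.
by apply: (young_integralE one0 be0 be11') => //; exists 2; exact: hld_green.
Qed.

Lemma tail_int_young Q : hold be Q ->
  young_integral (fun t => t) Q 0 1 = tail_int Q 1.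
Proof.
move=> Qh; have p1 := prim_min Qh (_ : 0 <= 1 <= 1); rewrite lexx ler01 in p1.
have p : prim (fun t => t) Q (fun s => tail_int Q (Num.min 1 s) - Num.min 1 s * tail Q s).
  by apply: (eq_prim _ _ _ (p1 isT)) => // s /andP[s0 s1]; rewrite (min_idPr s1).
rewrite (young_integralE one0 be0 be11' (hold_id (R := R)) Qh p)//.
by rewrite (min_idPl (lexx 1)) (min_idPr ler01) /tail tail_int0//; ring.
Qed.

Lemma lam_prim Q : hold be Q ->
  prim (fun t => tail Q t - tail_int Q 1) (fun t => t) (lam Q).
Proof.
move=> Qh; have [c [a [a1 H]]] := tail_intP Qh.
exists c, a; split=> // s t s0 st t1.
rewrite (_ : _ - _ = tail_int Q t - tail_int Q s - tail Q s * (t - s)); first exact: H.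
by rewrite /lam; ring.
Qed.

(** Integration by parts turns the double integral into
    $\int J_PJ_Q\,dt-\int J_P\,dt\int J_Q\,dt$, which is symmetric. *)
Lemma lam_young Q P : hold be Q -> hold be P ->
  young_integral (lam Q) P 0 1 =
  young_integral (fun t => tail P t * tail Q t) (fun t => t) 0 1 -
  tail_int Q 1 * tail_int P 1.
Proof.
move=> Qh Ph; have Lh := lam_hold Qh.
have tP := hold_tail Ph; have tQ := hold_tail Qh.
have PQ : hold be (fun t => tail P t * tail Q t) by exact: holdM.
have p1 := yprimP be0 one0 be11 PQ (hold_id (R := R)).
have p2 : prim (fun t => tail P t * (tail Q t - tail_int Q 1)) (fun t => t)
   (fun t => yprim (fun t => tail P t * tail Q t) (fun t => t) t +
     - tail_int Q 1 * tail_int P t).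
  apply: (eq_prim _ _ _ (prim_addl p1 (prim_scalel (- tail_int Q 1) (tail_intP Ph)))) => //.
  by move=> t _; ring.
have bP := hold_bounded be0 tP.
have [c [a [a1 H]]] := (prim_assoc _ bP (lam_prim Qh)).1 p2.
have c0 := bound_ge0 H.
have [cL LL] := Lh; have [cP LP] := Ph.
have pL : prim (lam Q) P (fun t => yprim (fun t => tail P t * tail Q t) (fun t => t) t +
     - tail_int Q 1 * tail_int P t - lam Q t * tail P t).
  exists (c + cL * cP), (Num.min a (1 + be)); split; first by rewrite lt_min a1.
  move=> s t s0 st t1.
  set I := yprim _ _.
  have -> : I t + - tail_int Q 1 * tail_int P t - lam Q t * tail P t -
    (I s + - tail_int Q 1 * tail_int P s - lam Q s * tail P s) - lam Q s * (P t - P s) =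
    (I t + - tail_int Q 1 * tail_int P t - (I s + - tail_int Q 1 * tail_int P s) -
     tail P s * (lam Q t - lam Q s)) + (lam Q t - lam Q s) * (P t - P s).
    by rewrite /tail; ring.
  apply: le_trans (ler_normD _ _) _.
  have cLP : 0 <= cL * cP by rewrite mulr_ge0 ?(hld_ge0 LL) ?(hld_ge0 LP).
  apply: le_trans (le_pow_min s0 st t1 a1 be11' c0 cLP); apply: lerD; first exact: H.
  by rewrite normrM powR_mulD// mulrACA ler_pM ?LL ?LP.
rewrite (young_integralE one0 be0 be11' Lh Ph pL)//.
rewrite -!/(yprim _ _ _) (yprim0 be0 one0 be11 PQ (hold_id (R := R))).
rewrite /lam /tail !tail_int0//; ring.
Qed.

Lemma lam_sym Q P : hold be Q -> hold be P ->
  young_integral (lam Q) P 0 1 = young_integral (lam P) Q 0 1.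
Proof.
move=> Qh Ph; rewrite !lam_young// [in RHS]mulrC; congr (_ - _).
apply: (eq_young be0 one0 be11) => //; [|exact: hold_id|by move=> t _; rewrite mulrC].
by apply: holdM => //; exact: hold_tail.
Qed.

End green_operator.

(** * The integral form of the equation and its resolvent *)

Section lebesgue_primitive.
Context {R : realType}.
Local Notation mu := (@lebesgue_measure R).
Implicit Types (f : R -> R) (a s t : R).

Lemma hold_integrable a f s t : 0 < a -> hold a f -> 0 <= s -> t <= 1 ->
  mu.-integrable `[s, t] (EFin \o f).
Proof.
move=> a0 [c fc] s0 t1.
have sub : `[s, t]%classic `<=` `[0, 1]%classic.
  by move=> x /=; rewrite !in_itv/= => /andP[sx xt]; rewrite (le_trans s0)//= (le_trans xt).
have int01 : mu.-integrable `[0%R, 1%R] (EFin \o f).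
  apply: continuous_compact_integrable; first exact: segment_compact.
  exact: hld_continuous fc.
by apply: (integrableS (mu := mu) _ _ sub int01) => //.
Qed.

(** A Lebesgue integral of a Hölder function is a Young integral against the identity,
    so that uniqueness of primitives applies to the outer integral of the equation. *)
Lemma Rintegral_prim a f : 0 < a -> hold a f ->
  prim f (fun t => t) (fun t => \int[mu]_(u in `[0, t]) f u).
Proof.
move=> a0 fh; have [c fc] := fh; have c0 := hld_ge0 fc.
exists c, (1 + a); split; first by rewrite ltrDl.
move=> s t s0; rewrite le_eqVlt => /predU1P[<- _|st t1].
  by rewrite !subrr mulr0 subrr normr0 mulr_ge0 ?powR_ge0.
have st' := ltW st.
have int_st := hold_integrable a0 fh s0 t1.
rewrite (@Rintegral_itvB _ f (BLeft 0) (BRight t) s); last 3 first.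
- exact: (hold_integrable a0 fh (lexx 0) t1).
- by rewrite bnd_simp.
- by rewrite bnd_simp.
rewrite Rintegral_itv_obnd_cbnd; last first.
  by apply: integrableS int_st => //; exact: subset_itv_oc_cc.
have mst : mu `[s, t]%classic = (t - s)%:E by rewrite lebesgue_measure_itv/= lte_fin st.
have icst (k : R) : mu.-integrable `[s, t] (EFin \o (fun=> k)).
  by apply: (hold_integrable a0) => //; exact: hold_cst.
have -> : f s * (t - s) = \int[mu]_(u in `[s, t]) f s.
  by rewrite Rintegral_cst//; congr (_ * _); rewrite /= lebesgue_measure_itv/= lte_fin st.
rewrite -RintegralB//.
have iB : mu.-integrable `[s, t] (EFin \o (fun u => f u - f s)).
  by apply: (hold_integrable a0) => //; apply: holdB => //; exact: hold_cst.
apply: le_trans (le_normr_Rintegral _ iB) _ => //.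
have -> : c * (t - s) `^ (1 + a) = \int[mu]_(u in `[s, t]) (c * (t - s) `^ a).
  rewrite Rintegral_cst//= lebesgue_measure_itv/= lte_fin st /=.
  by rewrite powR_mul_base ?subr_ge0//; ring.
apply: le_Rintegral => //.
- exact: (integrable_abse iB).
- move=> u /=; rewrite in_itv/= => /andP[su ut].
  apply: (le_trans (fc _ _ s0 su (le_trans ut t1))).
  by rewrite ler_wpM2l// powR_le_base ?(ltW a0)// ?subr_ge0// lerD2r.
Qed.

End lebesgue_primitive.

Section green_young.
Context {R : realType}.
Variables (kap gam : R).
Hypotheses (kap0 : 0 < kap) (kap1 : kap <= 1) (gam0 : 0 < gam).
Hypothesis kg1 : 1 < kap + gam.
Implicit Types (b f g q u v w x y z V : R -> R) (s t : R).

(** The right-hand sides of both the nonlinear and the linear equation are values of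
    this operator times the cutoff. *)
Definition Lop x q t : R := \young_(xi = 0 to 1) (green t xi * q xi) d x.

Let kapW f : hold 1 f -> hold kap f. Proof. exact: holdW. Qed.

Let green_hold t : 0 <= t <= 1 -> hold 1 (green t).
Proof. by move=> t01; exists 2; exact: hld_green. Qed.

Lemma young_assoc f q x : hold kap f -> hold kap q -> hold gam x ->
  \young_(s = 0 to 1) (f s * q s) d x = \young_(s = 0 to 1) (f s) d (yprim q x).
Proof.
move=> fh qh xh.
have fq : hold kap (fun s => f s * q s) by exact: holdM.
have Qh := yprim_hold kap0 gam0 kg1 qh xh.
have p := yprimP kap0 gam0 kg1 fh Qh.
have p' := (prim_assoc _ (hold_bounded kap0 fh) (yprimP kap0 gam0 kg1 qh xh)).2 p.
rewrite (young_integralE kap0 gam0 kg1 fq xh p')//.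
by rewrite (yprim0 kap0 gam0 kg1 fh Qh) subr0.
Qed.

Lemma Lop_lam x q t : hold kap q -> hold gam x -> 0 <= t <= 1 ->
  Lop x q t = lam (yprim q x) t.
Proof.
move=> qh xh t01; rewrite /Lop young_assoc//; last exact/kapW/green_hold.
by apply: (young_green gam0) => //; exact: (yprim_hold kap0 gam0 kg1 qh xh).
Qed.

Lemma Lop_bound : exists2 K, 0 <= K & forall x q a A B,
  (forall t, 0 <= t <= 1 -> `|q t| <= a) -> hld kap A q -> hld gam B x ->
  hld 1 (K * (a + A) * B) (Lop x q) /\
  forall t, 0 <= t <= 1 -> `|Lop x q t| <= K * (a + A) * B.
Proof.
have [K1 K10 K1P] := yprim_bound kap0 gam0 kg1.
have [K2 K20 K2P] := lam_bound gam0.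
exists (K2 * (1 + K1)) => [|x q a A B qa qA xB]; first by rewrite mulr_ge0// addr_ge0.
have qh : hold kap q by exists A.
have xh : hold gam x by exists B.
have a0 : 0 <= a by apply: le_trans (qa 0 _); rewrite ?lexx ?ler01.
have [A0 B0] := (hld_ge0 qA, hld_ge0 xB).
have [L1 L2] := K2P _ _ (K1P _ _ _ _ _ qa qA xB).
have le1 : K2 * ((a + K1 * A) * B) <= K2 * (1 + K1) * (a + A) * B.
  rewrite -!mulrA ler_wpM2l// !mulrA ler_wpM2r//.
  have := mulr_ge0 K10 a0; have := mulr_ge0 K10 A0; nra.
split=> [s t s0 st t1|t t01].
  rewrite !Lop_lam ?s0 ?t1 ?(le_trans s0)//= ?(le_trans st)//.
  exact: (hld_le le1 L1).
by rewrite Lop_lam//; apply: le_trans le1; exact: L2.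
Qed.

Lemma Lop_hold x q : hold kap q -> hold gam x -> hold kap (Lop x q).
Proof.
move=> qh xh; apply: kapW; have [a qa] := hold_bounded kap0 qh.
case: qh xh => A qA [B xB]; have [K _ KP] := Lop_bound.
by exists (K * (a + A) * B); case: (KP _ _ _ _ _ qa qA xB).
Qed.

Let green_mul_hold q t : hold kap q -> 0 <= t <= 1 -> hold kap (fun s => green t s * q s).
Proof. by move=> qh t01; apply: holdM => //; exact/kapW/green_hold. Qed.

Lemma Lop_linq x q q' k k' t : hold kap q -> hold kap q' -> hold gam x -> 0 <= t <= 1 ->
  Lop x (fun s => k * q s + k' * q' s) t = k * Lop x q t + k' * Lop x q' t.
Proof.
move=> qh qh' xh t01; rewrite /Lop.
rewrite -(young_lin kap0 gam0 kg1 k k' (green_mul_hold qh t01) (green_mul_hold qh' t01) xh).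
apply: (eq_young kap0 gam0 kg1) => //; last by move=> s _; ring.
by apply: green_mul_hold => //; apply: holdD; exact: holdZ.
Qed.

Lemma Lop_linx x x' q k k' t : hold kap q -> hold gam x -> hold gam x' -> 0 <= t <= 1 ->
  Lop (fun s => k * x s + k' * x' s) q t = k * Lop x q t + k' * Lop x' q t.
Proof.
move=> qh xh xh' t01; rewrite /Lop.
by rewrite (young_linr kap0 gam0 kg1)//; exact: green_mul_hold.
Qed.

Lemma eq_Lop x x' q q' t : hold kap q -> hold gam x ->
  (forall s, 0 <= s <= 1 -> q s = q' s) -> (forall s, 0 <= s <= 1 -> x s = x' s) ->
  0 <= t <= 1 -> Lop x q t = Lop x' q' t.
Proof.
move=> qh xh qq xx t01; apply: (eq_young kap0 gam0 kg1) => //.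
  exact: green_mul_hold.
by move=> s s01; rewrite qq.
Qed.

(** Absorbing the coefficient in the integrator $F=\int G\sigma(z)\,dx$ leaves the two
    iterated integrals of $dF$ of which the Green function is the kernel. *)
Lemma bvp_Lop (p : R) (phi sigma : R -> R) x z :
  hold kap (fun t => sigma (z t)) -> hold gam x -> solves_bvp gam p phi sigma x z ->
  forall t, 0 <= t <= 1 -> z t = cutoff gam p phi x * Lop x (fun s => sigma (z s)) t.
Proof.
move=> szh xh [z0 Hz] t t01; have /andP[t0 t1] := t01.
set G := cutoff _ _ _ _.
pose f s := G * sigma (z s).
have fh : hold kap f by exact: holdZ.
pose F := yprim f x.
have Fh : hold gam F by exact: (yprim_hold kap0 gam0 kg1 fh xh).
have -> : G * Lop x (fun s => sigma (z s)) t = lam F t.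
  rewrite -(Lop_lam fh xh t01) -[LHS]addr0 -(mul0r (Lop x (fun s => sigma (z s)) t)).
  rewrite -Lop_linq//; apply: eq_Lop => //; last by move=> s _; rewrite /f mul0r addr0.
  by apply: holdD; exact: holdZ.
have := Hz 0 t (lexx _) t0 t1; rewrite z0 !subr0 => ->.
congr (_ - _ * _).
  transitivity (\int[@lebesgue_measure R]_(u in `[0, t]) tail F u).
    apply: eq_Rintegral => u; rewrite inE/= in_itv/= => /andP[u0 ut].
    rewrite (eq_young kap0 gam0 kg1 u0 (le_trans ut t1) (lexx 1) (f' := f) (g' := x))//.
    by rewrite (young_yprim kap0 gam0 kg1) ?(le_trans ut).
  have p1 := Rintegral_prim gam0 (hold_tail Fh).
  have p2 := tail_intP gam0 Fh.
  have := prim_unique p1 p2 (lexx 0) t0 t1.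
  by rewrite set_itv1 Rintegral_set1 (tail_int0 gam0 Fh) !subr0.
rewrite -(tail_int_young gam0 Fh) -young_assoc//; last exact/kapW/hold_id.
Qed.

Lemma young_source g P W t : hold kap g -> hold gam P -> hold gam W -> 0 <= t <= 1 ->
  (forall s, 0 <= s <= 1 -> g s = green t s + lam P s) ->
  \young_(s = 0 to 1) (g s) d W = lam W t + \young_(s = 0 to 1) (lam P s) d W.
Proof.
move=> gh Ph Wh t01 gE; rewrite -(young_green gam0 Wh t01).
rewrite -[\young_(u = 0 to 1) green t u d W]mul1r -[X in _ + X]mul1r.
rewrite -(young_lin kap0 gam0 kg1 1 1 _ _ Wh) //; last 2 first.
- exact/kapW/green_hold.
- by apply: kapW; exact: (lam_hold gam0 Ph).
by apply: (eq_young kap0 gam0 kg1) => // u u01; rewrite gE// !mul1r.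
Qed.

(** If [g] solves the linear equation with source $K(t,\cdot)$ and [y] the one with
    source $\int_0^1K(\cdot,\xi)\,dV_\xi$, then pairing the two equations and using
    the symmetry of the kernel shows that [g] represents the evaluation of [y] at
    [t]. *)
Lemma duality x b g y V t : hold gam x -> hold kap b -> hold kap g -> hold kap y ->
  hold gam V -> 0 <= t <= 1 ->
  (forall s, 0 <= s <= 1 -> g s = green t s + Lop x (fun r => b r * g r) s) ->
  (forall s, 0 <= s <= 1 -> y s = lam V s + Lop x (fun r => b r * y r) s) ->
  y t = \young_(s = 0 to 1) (g s) d V.
Proof.
move=> xh bh gh yh Vh t01 gE yE.
pose P := yprim (fun r => b r * g r) x; pose Y := yprim (fun r => b r * y r) x.
have bg : hold kap (fun r => b r * g r) by exact: holdM.
have byh : hold kap (fun r => b r * y r) by exact: holdM.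
have Ph : hold gam P by exact: (yprim_hold kap0 gam0 kg1 bg xh).
have Yh : hold gam Y by exact: (yprim_hold kap0 gam0 kg1 byh xh).
have grk : hold kap (green t) by exact/kapW/green_hold.
have lk Q : hold gam Q -> hold kap (lam Q).
  by move=> Qh; apply: kapW; exact: (lam_hold gam0 Qh).
have one : (1 : R) * 1 = 1 by rewrite mulr1.
have split_y W : hold gam W -> \young_(s = 0 to 1) (y s) d W =
    \young_(s = 0 to 1) (lam V s) d W + \young_(s = 0 to 1) (lam Y s) d W.
  move=> Wh.
  rewrite -[\young_(s = 0 to 1) (lam V s) d W]mul1r -[X in _ + X]mul1r.
  rewrite -(young_lin kap0 gam0 kg1 1 1 (lk _ Vh) (lk _ Yh) Wh).
  apply: (eq_young kap0 gam0 kg1) => // s s01.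
  by rewrite yE// Lop_lam// !mul1r.
have cross : \young_(s = 0 to 1) (g s) d Y = \young_(s = 0 to 1) (y s) d P.
  rewrite -!young_assoc//; apply: (eq_young kap0 gam0 kg1) => //.
    exact: holdM.
  by move=> s _; ring.
have yt : y t = lam V t + lam Y t by rewrite yE// Lop_lam.
have gE' (u : R) : 0 <= u <= 1 -> g u = green t u + lam P u by move=> u01; rewrite (gE u u01) (Lop_lam bg xh u01).
have e1 := split_y _ Ph; rewrite (lam_sym gam0 Vh Ph) (lam_sym gam0 Yh Ph) in e1.
have e2 := young_source gh Ph Yh t01 gE'; rewrite cross in e2.
rewrite yt (young_source gh Ph Vh t01 gE'); congr (_ + _).
by apply: (addIr (\young_(s = 0 to 1) (lam P s) d Y)); rewrite -e2 e1.
Qed.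

(** Integrating each of the two solutions against the integrator of the other equation
    gives the same number, and only symmetric terms remain in the difference. *)
Lemma resolvent_sym x b gs gt s t : hold gam x -> hold kap b -> hold kap gs ->
  hold kap gt -> 0 <= s <= 1 -> 0 <= t <= 1 ->
  (forall r, 0 <= r <= 1 -> gs r = green s r + Lop x (fun r => b r * gs r) r) ->
  (forall r, 0 <= r <= 1 -> gt r = green t r + Lop x (fun r => b r * gt r) r) ->
  gs t = gt s.
Proof.
move=> xh bh gsh gth s01 t01 gsE gtE.
have bgs : hold kap (fun r => b r * gs r) by exact: holdM.
have bgt : hold kap (fun r => b r * gt r) by exact: holdM.
set Ps := yprim (fun r => b r * gs r) x; set Pt := yprim (fun r => b r * gt r) x.
have Psh : hold gam Ps by exact: (yprim_hold kap0 gam0 kg1 bgs xh).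
have Pth : hold gam Pt by exact: (yprim_hold kap0 gam0 kg1 bgt xh).
have cross : \young_(s = 0 to 1) (gt s) d Ps = \young_(s = 0 to 1) (gs s) d Pt.
  rewrite -!young_assoc//; apply: (eq_young kap0 gam0 kg1) => //.
    exact: holdM.
  by move=> u _; ring.
have gsE' (u : R) : 0 <= u <= 1 -> gs u = green s u + lam Ps u.
  by move=> u01; rewrite gsE// Lop_lam.
have gtE' (u : R) : 0 <= u <= 1 -> gt u = green t u + lam Pt u.
  by move=> u01; rewrite gtE// Lop_lam.
rewrite (gsE' t t01) (gtE' s s01) green_sym; congr (_ + _).
have e1 := young_source gth Pth Psh t01 gtE'; rewrite cross in e1.
have e2 := young_source gsh Psh Pth s01 gsE'; rewrite (lam_sym gam0 Psh Pth) in e2.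
by apply: (addIr (\young_(s = 0 to 1) (lam Pt s) d Ps)); rewrite -e1 -e2.
Qed.

End green_young.

(** * Integrals of powers of the distance *)

Section power_integrals.
Context {R : realType}.
Local Notation mu := (@lebesgue_measure R).
Implicit Types (f F : R -> R) (a b c r s t u v B : R).

(** The interval is exhausted from inside, where the fundamental theorem of calculus
    applies; the integrand may therefore be singular at the end points. *)
Lemma ge0_integral_le_increment f F a b B :
  (forall x, a < x < b -> is_derive x 1 F (f x)) ->
  (forall x, a < x < b -> {for x, continuous f}) ->
  (forall x, a < x < b -> 0 <= f x) -> 0 <= B ->
  (forall u v, a < u -> u < v -> v < b -> F v - F u <= B) ->
  (\int[mu]_(x in `]a, b[) (f x)%:E <= B%:E)%E.
Proof.
move=> dF cf f0 B0 FB.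
have mf : measurable_fun `]a, b[ (EFin \o f).
  apply/measurable_EFinP.
  apply: open_continuous_measurable_fun; first exact: interval_open.
  by move=> x; rewrite inE/= in_itv/=; exact: cf.
pose An (n : nat) : set R := `[a + n.+1%:R^-1, b - n.+1%:R^-1]%classic.
have An_sub n : An n `<=` `]a, b[.
  move=> x; rewrite /An/= !in_itv/= => /andP[ax xb].
  have n0 : 0 < n.+1%:R^-1 :> R by rewrite invr_gt0 ltr0n.
  by rewrite (lt_le_trans _ ax) ?ltrDl//= (le_lt_trans xb)// gtrBl.
have inv_le (n m : nat) : (n <= m)%N -> m.+1%:R^-1 <= n.+1%:R^-1 :> R.
  by move=> nm; rewrite lef_pV2 ?posrE ?ltr0n// ler_nat.
have An_mono (n m : nat) (x : R) : (n <= m)%N -> An n x -> An m x.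
  move=> /inv_le nm; rewrite /An/= !in_itv/= => /andP[h1 h2].
  by rewrite (le_trans _ h1) ?lerD2l//= (le_trans h2)// lerD2l lerN2.
have UA : \bigcup_n An n = `]a, b[%classic.
  apply/seteqP; split=> [x [n _]|x]; first exact: An_sub.
  rewrite /= in_itv/= => /andP[ax xb].
  have m0 : 0 < Num.min (x - a) (b - x) by rewrite lt_min !subr_gt0 ax.
  exists (Num.trunc (Num.min (x - a) (b - x))^-1) => //.
  set n := Num.trunc _.
  have : n.+1%:R^-1 <= Num.min (x - a) (b - x).
    by rewrite invf_ple ?posrE ?ltr0n//; exact/ltW/truncnS_gt.
  rewrite le_min /An/= in_itv/= => /andP[h1 h2].
  by rewrite -lerBrDl h1 /= lerBrDr addrC -lerBrDr.
have cvgA : (\int[mu]_(x in An n) (EFin \o f) x)%E @[n --> \oo] -->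
    (\int[mu]_(x in \bigcup_n An n) (EFin \o f) x)%E.
  apply: ge0_nondecreasing_set_cvg_integral.
  - by move=> n m nm; apply/subsetPset => x; exact: An_mono.
  - by move=> n; exact: measurable_itv.
  - by move=> n; apply: measurable_funS mf => //; exact: An_sub.
  - by move=> n x /An_sub; rewrite /= in_itv/= lee_fin => /f0.
rewrite -UA -(cvg_lim _ cvgA)//; apply: lime_le; first by apply: (cvgP _ cvgA).
apply: nearW => n.
have [uv|vu] := ltP (a + n.+1%:R^-1) (b - n.+1%:R^-1); last first.
  move: vu; rewrite le_eqVlt => /predU1P[e|vu].
    by rewrite /An e set_itv1 integral_set1 lee_fin.
  by rewrite /An set_itv_ge ?integral_set0 ?lee_fin// bnd_simp -ltNge.
have n0 : 0 < n.+1%:R^-1 :> R by rewrite invr_gt0 ltr0n.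
have dFx x : a < x < b -> derivable F x 1 by move=> /dF d'; exact: @ex_derive.
have cF x : a < x < b -> {for x, continuous F}.
  by move=> /dFx ?; apply: differentiable_continuous; exact/derivable1_diffP.
have inside (x : R) : a + n.+1%:R^-1 <= x -> x <= b - n.+1%:R^-1 -> a < x < b.
  by move=> ax xb; rewrite (lt_le_trans _ ax) ?ltrDl//= (le_lt_trans xb)// gtrBl.
rewrite (@continuous_FTC2 _ f F)//.
- by rewrite -EFinB lee_fin FB// ?ltrDl// gtrBl.
- apply: continuous_in_subspaceT => x; rewrite inE/= in_itv/= => /andP[ax xb].
  by apply: cf; exact: inside.
- split.
  + move=> x; rewrite in_itv/= => /andP[ax xb]; apply: dFx.
    by apply: inside; exact: ltW.
  + by apply: cvg_at_right_filter; apply: cF; apply: inside => //; exact: ltW.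
  + by apply: cvg_at_left_filter; apply: cF; apply: inside => //; exact: ltW.
- move=> x; rewrite in_itv/= => /andP[ax xb].
  have /dF dx : a < x < b by apply: inside; exact: ltW.
  by rewrite derive1E; exact: derive_val.
Qed.

Lemma is_derive_pow_right c r x : c < x ->
  is_derive x 1 (fun y => (y - c) `^ r) (r * (x - c) `^ (r - 1)).
Proof.
move=> cx; have d1 : is_derive x 1 (fun y => y - c) (1 : R).
  by apply: is_derive_eq; rewrite oppr0 addr0.
have xc : 0 < x - c by rewrite subr_gt0.
have d2 := is_derive1_powR r xc.
have := @is_derive1_comp _ (fun y => y `^ r) (fun y => y - c) x _ _ d2 d1.
by rewrite mulr1.
Qed.

Lemma is_derive_pow_left c r x : x < c ->
  is_derive x 1 (fun y => (c - y) `^ r) (- (r * (c - x) `^ (r - 1))).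
Proof.
move=> cx; have d1 : is_derive x 1 (fun y => c - y) (- 1 : R).
  by apply: is_derive_eq; rewrite add0r mul1r.
have xc : 0 < c - x by rewrite subr_gt0.
have d2 := is_derive1_powR r xc.
have := @is_derive1_comp _ (fun y => y `^ r) (fun y => c - y) x _ _ d2 d1.
by rewrite mulrN1.
Qed.

Definition gap r (x y : R) : R := `|x - y| `^ r.

Lemma gapC r x y : gap r x y = gap r y x.
Proof. by rewrite /gap distrC. Qed.

Lemma gap_ge0 r x y : 0 <= gap r x y.
Proof. exact: powR_ge0. Qed.

(** The exponent may be below $-1$: the increments of the power are then bounded when the
    interval stays away from [c]. *)
Lemma integral_gap_right r c a b B : r + 1 != 0 -> c <= a -> 0 <= B ->
  (forall u v, a < u -> u < v -> v < b ->
    (v - c) `^ (r + 1) / (r + 1) - (u - c) `^ (r + 1) / (r + 1) <= B) ->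
  (\int[mu]_(x in `]a, b[) (gap r x c)%:E <= B%:E)%E.
Proof.
move=> r1 ca B0 FB.
rewrite [leLHS](_ : _ = \int[mu]_(x in `]a, b[) ((x - c) `^ r)%:E)%E; last first.
  apply: eq_integral => x; rewrite inE/= in_itv/= => /andP[ax _].
  by rewrite /gap ger0_norm// subr_ge0 ltW// (le_lt_trans ca).
apply: (ge0_integral_le_increment (F := fun x => (x - c) `^ (r + 1) / (r + 1))) => //.
- move=> x /andP[ax _]; have cx := le_lt_trans ca ax.
  have d1 := is_derive_pow_right (r + 1) cx.
  rewrite (_ : (fun y => _ / _) = (fun y => (r + 1)^-1 *: (y - c) `^ (r + 1))); last first.
    by apply/funext => y; rewrite mulrC.
  apply: is_derive_eq; rewrite addrK /GRing.scale/= mulrA mulVf// mul1r//.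
- move=> x /andP[ax _]; have cx := le_lt_trans ca ax.
  apply: differentiable_continuous; apply/derivable1_diffP.
  by apply: ex_derive; exact: is_derive_pow_right.
- by move=> x _; exact: powR_ge0.
Qed.

Lemma integral_gap_left r c a b B : r + 1 != 0 -> b <= c -> 0 <= B ->
  (forall u v, a < u -> u < v -> v < b ->
    (c - u) `^ (r + 1) / (r + 1) - (c - v) `^ (r + 1) / (r + 1) <= B) ->
  (\int[mu]_(x in `]a, b[) (gap r x c)%:E <= B%:E)%E.
Proof.
move=> r1 bc B0 FB.
rewrite [leLHS](_ : _ = \int[mu]_(x in `]a, b[) ((c - x) `^ r)%:E)%E; last first.
  apply: eq_integral => x; rewrite inE/= in_itv/= => /andP[_ xb].
  by rewrite /gap distrC ger0_norm// subr_ge0 ltW// (lt_le_trans xb).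
apply: (ge0_integral_le_increment (F := fun x => - ((c - x) `^ (r + 1) / (r + 1)))) => //.
- move=> x /andP[_ xb]; have xc := lt_le_trans xb bc.
  have d1 := is_derive_pow_left (r + 1) xc.
  rewrite (_ : (fun y => - (_ / _)) = (fun y => - (r + 1)^-1 *: (c - y) `^ (r + 1))); last first.
    by apply/funext => y; rewrite /GRing.scale/= mulNr mulrC.
  apply: is_derive_eq; rewrite addrK /GRing.scale/= mulrNN mulrA mulVf// mul1r//.
- move=> x /andP[_ xb]; have xc := lt_le_trans xb bc.
  apply: differentiable_continuous; apply/derivable1_diffP.
  by apply: ex_derive; exact: is_derive_pow_left.
- by move=> x _; exact: powR_ge0.
- by move=> u v au uv vb; rewrite opprK addrC FB.
Qed.

Lemma measurable_gap_fun r c : measurable_fun setT (fun x : R => gap r x c).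
Proof.
apply: (measurableT_comp (measurable_powR r)).
apply: measurableT_comp => //; exact: measurable_funB.
Qed.

Lemma integral_gap_inside r c a b : -1 < r -> a <= c -> c <= b ->
  (\int[mu]_(x in `[a, b]) (gap r x c)%:E <= (2 / (r + 1) * (b - a) `^ (r + 1))%:E)%E.
Proof.
move=> r1 ac cb; have r10 : 0 < r + 1 by lra.
have r1n : r + 1 != 0 by rewrite gt_eqF.
have mg (S : set R) : measurable_fun S (fun x => (gap r x c)%:E).
  by apply/measurable_EFinP; apply: measurable_funTS; exact: measurable_gap_fun.
have half u v : u <= v -> c = u \/ c = v -> a <= u -> v <= b ->
    (\int[mu]_(x in `]u, v[) (gap r x c)%:E <= ((b - a) `^ (r + 1) / (r + 1))%:E)%E.
  move=> uv cuv au vb.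
  have B0 : 0 <= (b - a) `^ (r + 1) / (r + 1) by rewrite divr_ge0 ?powR_ge0// ltW.
  case: cuv => e.
    apply: integral_gap_right => //; first by rewrite e.
    move=> u' v' uu' uv' vv'; apply: le_trans (_ : (v' - c) `^ (r + 1) / (r + 1) <= _).
      by rewrite gerBl divr_ge0 ?powR_ge0// ltW.
    rewrite ler_wpM2r ?invr_ge0 ?(ltW r10)// powR_le_base ?(ltW r10)//; lra.
  apply: integral_gap_left => //; first by rewrite e.
  move=> u' v' uu' uv' vv'; apply: le_trans (_ : (c - u') `^ (r + 1) / (r + 1) <= _).
    by rewrite gerBl divr_ge0 ?powR_ge0// ltW.
  rewrite ler_wpM2r ?invr_ge0 ?(ltW r10)// powR_le_base ?(ltW r10)//; lra.
have -> : `[a, b]%classic = `[a, c]%classic `|` `]c, b]%classic.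
  by rewrite -itv_bndbnd_setU// bnd_simp.
rewrite ge0_integral_setU//=; last 3 first.
- exact: mg.
- by move=> x _; rewrite lee_fin gap_ge0.
- apply/disj_setPS => x [] /=; rewrite !in_itv/= => /andP[_ xc] /andP[cx _].
  by move: (lt_le_trans cx xc); rewrite ltxx.
rewrite (integral_itv_bndoo true false)// (integral_itv_bndoo false false)//.
have -> : 2 / (r + 1) * (b - a) `^ (r + 1) =
  (b - a) `^ (r + 1) / (r + 1) + (b - a) `^ (r + 1) / (r + 1) by ring.
by rewrite EFinD; apply: leeD; apply: half => //; [right|left].
Qed.

(** For an exponent below $-1$ the mass far from [c] is governed by the distance of
    [c] to the interval. *)
Lemma integral_gap_outside dl c a b : 0 < dl -> dl < 1 -> a <= b -> c < a \/ b < c ->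
  (\int[mu]_(x in `[a, b]) (gap (dl - 2) x c)%:E <=
    ((Num.max (a - c) (c - b)) `^ (dl - 1) / (1 - dl))%:E)%E.
Proof.
move=> dl0 dl1 ab out.
have e : dl - 2 + 1 = dl - 1 by ring.
have n0 : dl - 2 + 1 != 0 by rewrite e lt_eqF// subr_lt0.
have dlN : dl - 1 = - (1 - dl) by ring.
have dl1' : 0 < 1 - dl by rewrite subr_gt0.
have mono u v : 0 < u -> u <= v -> v `^ (dl - 1) <= u `^ (dl - 1).
  move=> u0 uv; rewrite dlN !powRN lef_pV2 ?posrE ?powR_gt0 ?(lt_le_trans u0)//.
  by rewrite powR_le_base ?(ltW dl1') ?(ltW u0).
have mg : measurable_fun `]a, b[ (fun x => (gap (dl - 2) x c)%:E).
  by apply/measurable_EFinP; apply: measurable_funTS; exact: measurable_gap_fun.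
rewrite (integral_itv_bndoo true false)//.
have B0 : 0 <= (Num.max (a - c) (c - b)) `^ (dl - 1) / (1 - dl).
  by rewrite divr_ge0 ?powR_ge0// ltW.
have inv : (dl - 2 + 1)^-1 = - (1 - dl)^-1 by rewrite e dlN invrN.
case: out => [ca|bc].
- have mE : Num.max (a - c) (c - b) = a - c by apply/max_idPl; lra.
  apply: integral_gap_right => //; first exact: ltW.
  move=> u v au uv vb; rewrite inv e mE !mulrN opprK addrC.
  apply: le_trans (_ : (u - c) `^ (dl - 1) / (1 - dl) <= _).
    by rewrite gerBl divr_ge0 ?powR_ge0// ltW.
  by rewrite ler_wpM2r ?invr_ge0 ?(ltW dl1')// mono//; lra.
- have mE : Num.max (a - c) (c - b) = c - b by apply/max_idPr; lra.
  apply: integral_gap_left => //; first exact: ltW.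
  move=> u v au uv vb; rewrite inv e mE !mulrN opprK addrC.
  apply: le_trans (_ : (c - v) `^ (dl - 1) / (1 - dl) <= _).
    by rewrite gerBl divr_ge0 ?powR_ge0// ltW.
  by rewrite ler_wpM2r ?invr_ge0 ?(ltW dl1')// mono//; lra.
Qed.

End power_integrals.

(** * Integrals over parts of the square *)

Section rectangles.
Context {d1 d2 : measure_display} {T1 : measurableType d1} {T2 : measurableType d2}.
Context {R : realType}.
Variables (m1 : {sigma_finite_measure set T1 -> \bar R}).
Variables (m2 : {sigma_finite_measure set T2 -> \bar R}).
Implicit Types (A : set T1) (B : set T2).

Lemma patch_rect (V : pointedType) A B (f : T1 * T2 -> V) x y :
  (f \_ (A `*` B)) (x, y) = ((fun x => ((fun y => f (x, y)) \_ B) y) \_ A) x.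
Proof.
rewrite !patchE; case: ifPn => [|]; rewrite ?inE ?notin_setE /=.
  by move=> [xA yB]; rewrite !mem_set.
move=> nAB; case: ifPn => //; rewrite inE => xA; case: ifPn => //.
by rewrite inE => yB; exfalso; exact: nAB.
Qed.

Lemma tonelli_rect1 A B (f : T1 * T2 -> \bar R) : measurable A -> measurable B ->
  measurable_fun setT f -> (forall z, 0 <= f z)%E ->
  (\int[m1 \x m2]_(z in A `*` B) f z = \int[m1]_(x in A) \int[m2]_(y in B) f (x, y))%E.
Proof.
move=> mA mB mf f0; rewrite integral_mkcond.
have mAB : measurable (A `*` B) by exact: measurableX.
rewrite (@fubini_tonelli1 _ _ _ _ _ m1 m2 (f \_ (A `*` B))); last 2 first.
- by apply/(measurable_restrictT _ mAB); exact: measurable_funTS.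
- by move=> z; rewrite patchE; case: ifP.
rewrite [RHS]integral_mkcond; apply: eq_integral => x _; rewrite /fubini_F patchE.
case: ifPn => xA.
  rewrite [RHS]integral_mkcond; apply: eq_integral => y _.
  by rewrite patch_rect patchE xA.
by apply: integral0_eq => y _; rewrite patch_rect patchE (negbTE xA).
Qed.

Lemma tonelli_rect2 A B (f : T1 * T2 -> \bar R) : measurable A -> measurable B ->
  measurable_fun setT f -> (forall z, 0 <= f z)%E ->
  (\int[m1 \x m2]_(z in A `*` B) f z = \int[m2]_(y in B) \int[m1]_(x in A) f (x, y))%E.
Proof.
move=> mA mB mf f0; rewrite integral_mkcond.
have mAB : measurable (A `*` B) by exact: measurableX.
rewrite (@fubini_tonelli2 _ _ _ _ _ m1 m2 (f \_ (A `*` B))); last 2 first.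
- by apply/(measurable_restrictT _ mAB); exact: measurable_funTS.
- by move=> z; rewrite patchE; case: ifP.
rewrite [RHS]integral_mkcond; apply: eq_integral => y _; rewrite /fubini_G patchE.
case: ifPn => yB.
  rewrite [RHS]integral_mkcond; apply: eq_integral => x _.
  by rewrite patch_rect !patchE yB.
by apply: integral0_eq => x _; rewrite patch_rect !patchE (negbTE yB); case: ifP.
Qed.

Lemma measurable_inner A (f : T1 * T2 -> \bar R) : measurable A ->
  measurable_fun setT f -> (forall z, 0 <= f z)%E ->
  measurable_fun setT (fun y => \int[m1]_(x in A) f (x, y))%E.
Proof.
move=> mA mf f0; have mAT : measurable (A `*` [set: T2]) by exact: measurableX.
have := @measurable_fun_fubini_tonelli_G _ _ _ _ R m1 (f \_ (A `*` setT)).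
have -> : fubini_G m1 (f \_ (A `*` setT)) = (fun y => \int[m1]_(x in A) f (x, y))%E.
  apply/funext => y; rewrite /fubini_G [RHS]integral_mkcond.
  by apply: eq_integral => x _; rewrite patch_rect !patchE in_setT.
apply; first by apply/(measurable_restrictT _ mAT); exact: measurable_funTS.
by move=> z; rewrite patchE; case: ifP.
Qed.

Lemma Rintegral_rect2 A B (f : T1 * T2 -> R) : measurable A -> measurable B ->
  (m1 \x m2)%E.-integrable (A `*` B) (EFin \o f) ->
  \int[(m1 \x m2)%E]_(z in A `*` B) f z =
  \int[m2]_(y in B) \int[m1]_(x in A) f (x, y).
Proof.
move=> mA mB intf; have mAB : measurable (A `*` B) by exact: measurableX.
have intT := (integrable_mkcond (EFin \o f) mAB).1 intf.
rewrite /Rintegral integral_mkcond -integral21_prod_meas1//; congr fine.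
rewrite [RHS]integral_mkcond.
have GE y : fubini_G m1 ((EFin \o f) \_ (A `*` B)) y =
    ((fun y => \int[m1]_(x in A) (f (x, y))%:E)%E \_ B) y.
  rewrite /fubini_G patchE; case: ifPn => yB.
    rewrite [RHS]integral_mkcond; apply: eq_integral => x _.
    by rewrite patch_rect !patchE yB.
  by apply: integral0_eq => x _; rewrite patch_rect !patchE (negbTE yB); case: ifP.
have mG := measurable_fubini_G intT.
apply: ae_eq_integral => //.
  have -> : (EFin \o (fun y => fine (\int[m1]_(x in A) (f (x, y))%:E)%E)) \_ B =
     EFin \o (fine \o fubini_G m1 ((EFin \o f) \_ (A `*` B))).
    by apply/funext => y; rewrite patchE /= GE patchE; case: ifP.
  by apply/measurable_EFinP; exact: measurableT_comp.
have := ae_integrable2 intT; apply: filterS => y inty _.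
rewrite GE !patchE; case: ifPn => // yB /=; rewrite fineK//.
have -> : (\int[m1]_(x in A) (f (x, y))%:E)%E = fubini_G m1 ((EFin \o f) \_ (A `*` B)) y.
  by rewrite GE patchE yB.
exact: integrable_fin_num.
Qed.

Lemma Rintegral_rect1 A B (f : T1 * T2 -> R) : measurable A -> measurable B ->
  (m1 \x m2)%E.-integrable (A `*` B) (EFin \o f) ->
  \int[(m1 \x m2)%E]_(z in A `*` B) f z =
  \int[m1]_(x in A) \int[m2]_(y in B) f (x, y).
Proof.
move=> mA mB intf; have mAB : measurable (A `*` B) by exact: measurableX.
have intT := (integrable_mkcond (EFin \o f) mAB).1 intf.
rewrite /Rintegral integral_mkcond -integral12_prod_meas1//; congr fine.
rewrite [RHS]integral_mkcond.
have GE x : fubini_F m2 ((EFin \o f) \_ (A `*` B)) x =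
    ((fun x => \int[m2]_(y in B) (f (x, y))%:E)%E \_ A) x.
  rewrite /fubini_F patchE; case: ifPn => xA.
    rewrite [RHS]integral_mkcond; apply: eq_integral => y _.
    by rewrite patch_rect !patchE xA.
  by apply: integral0_eq => y _; rewrite patch_rect !patchE (negbTE xA).
have mG := measurable_fubini_F intT.
apply: ae_eq_integral => //.
  have -> : (EFin \o (fun x => fine (\int[m2]_(y in B) (f (x, y))%:E)%E)) \_ A =
     EFin \o (fine \o fubini_F m2 ((EFin \o f) \_ (A `*` B))).
    by apply/funext => x; rewrite patchE /= GE patchE; case: ifP.
  by apply/measurable_EFinP; exact: measurableT_comp.
have := ae_integrable1 intT; apply: filterS => x intx _.
rewrite GE !patchE; case: ifPn => // xA /=; rewrite fineK//.
have -> : (\int[m2]_(y in B) (f (x, y))%:E)%E = fubini_F m2 ((EFin \o f) \_ (A `*` B)) x.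
  by rewrite GE patchE xA.
exact: integrable_fin_num.
Qed.

End rectangles.

Section dominated_regions.
Context {dsp : measure_display} {T : measurableType dsp} {R : realType}.
Variable m : {measure set T -> \bar R}.
Implicit Types (S U V : set T) (f : T -> \bar R).

Lemma ge0_integral_setU_le S U f : measurable S -> measurable U ->
  measurable_fun setT f -> (forall z, 0 <= f z)%E ->
  (\int[m]_(z in S `|` U) f z <= \int[m]_(z in S) f z + \int[m]_(z in U) f z)%E.
Proof.
move=> mS mU mf f0.
have -> : S `|` U = S `|` (U `\` S).
  apply/seteqP; split=> x [Sx|]; [by left| |by left|by move=> [Ux _]; right].
  by move=> Ux; have [Sx|nS] := pselect (S x); [left|right].
rewrite ge0_integral_setU//; last 3 first.
- exact: measurableD.
- exact: measurable_funTS.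
- by apply/disj_setPS => x [Sx [_ nS]].
rewrite leeD2l// ge0_subset_integral//; first exact: measurableD.
exact: measurable_funTS.
Qed.

(** A function vanishing off [U `|` V] is bounded in mean by separate bounds on [V]
    and on [U `\` V]. *)
Lemma integral_two_regions (D U V : set T) (G gU gV : T -> R) (a b : R) :
  measurable D -> measurable U -> measurable V ->
  measurable_fun setT G -> measurable_fun setT gU -> measurable_fun setT gV ->
  U `<=` D -> V `<=` D ->
  (forall z, 0 <= gU z) -> (forall z, 0 <= gV z) ->
  (forall z, U z -> ~ V z -> `|G z| <= gU z) -> (forall z, V z -> `|G z| <= gV z) ->
  (forall z, D z -> ~ U z -> ~ V z -> G z = 0) ->
  (\int[m]_(z in U) (gU z)%:E <= a%:E)%E -> (\int[m]_(z in V) (gV z)%:E <= b%:E)%E ->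
  m.-integrable D (EFin \o G) /\ `|\int[m]_(z in D) G z| <= a + b.
Proof.
move=> mD mU mV mG mgU mgV UD VD gU0 gV0 GU GV G0 intU intV.
have mG' : measurable_fun setT (fun z => (`|G z|)%:E).
  by apply/measurable_EFinP; exact: measurableT_comp.
have bound : (\int[m]_(z in D) (`|G z|)%:E <= (a + b)%:E)%E.
  have mUV : measurable (U `\` V) by exact: measurableD.
  have mW : measurable (D `\` (V `|` (U `\` V))).
    by apply: measurableD => //; exact: measurableU.
  have DE : D = (V `|` (U `\` V)) `|` (D `\` (V `|` (U `\` V))).
    apply/seteqP; split=> z; last by move=> [[/VD//|[/UD//]]|[]].
    by move=> Dz; have [?|?] := pselect ((V `|` (U `\` V)) z); [left|right].
  rewrite DE; apply: le_trans (ge0_integral_setU_le _ _ mG' _) _ => //.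
    exact: measurableU.
  rewrite [X in (_ + X)%E](_ : _ = 0)%E; last first.
    apply: integral0_eq => z [Dz nz]; rewrite G0 ?normr0//.
      by move=> Uz; apply: nz; have [Vz|nV] := pselect (V z); [left|right].
    by move=> Vz; apply: nz; left.
  rewrite adde0; apply: le_trans (ge0_integral_setU_le _ _ mG' _) _ => //.
  rewrite addrC EFinD; apply: leeD.
    apply: le_trans intU.
    apply: le_trans (_ : \int[m]_(z in U `\` V) (gU z)%:E <= _)%E.
      apply: ge0_le_integral => //.
      - exact: measurable_funTS.
      - by apply/measurable_EFinP; exact: measurable_funTS.
      - by move=> z [Uz nV]; rewrite lee_fin GU.
    apply: ge0_subset_integral => //.
    - by apply/measurable_EFinP; exact: measurable_funTS.
    - by move=> z _; rewrite lee_fin.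
  apply: le_trans intV; apply: ge0_le_integral => //.
  - exact: measurable_funTS.
  - by apply/measurable_EFinP; exact: measurable_funTS.
have intG : m.-integrable D (EFin \o G).
  apply/integrableP; split.
    by apply/measurable_EFinP; exact: measurable_funTS.
  by apply: le_lt_trans bound _; rewrite ltry.
split=> //; rewrite -lee_fin EFin_normr_Rintegral//.
apply: le_trans (le_abse_integral m mD _) _.
  by apply/measurable_EFinP; exact: measurable_funTS.
exact: bound.
Qed.

End dominated_regions.

Section gap_regions.
Context {R : realType}.
Local Notation T := (measurableTypeR R).
Local Notation mu := (@lebesgue_measure R).
Implicit Types (A B : set T) (s t c r dl : R).

Definition mu2 := (mu \x mu)%E.

Definition unit_square : set (T * T) := `[0%R, 1%R]%classic `*` `[0%R, 1%R]%classic.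

Definition gap2 r (z : T * T) : R := gap r z.1 z.2.

Lemma measurable_gap2 r : measurable_fun setT (gap2 r).
Proof.
apply: (measurableT_comp (measurable_powR r)).
apply: measurableT_comp => //.
by apply: measurable_funB; [exact: measurable_fst|exact: measurable_snd].
Qed.

Let mgE r : measurable_fun setT (fun z => (gap2 r z)%:E).
Proof. by apply/measurable_EFinP; exact: measurable_gap2. Qed.

Let g0 r z : (0 <= (gap2 r z)%:E)%E.
Proof. by rewrite lee_fin gap_ge0. Qed.

Lemma rect_le A s t (f : T * T -> \bar R) (g : T -> R) : measurable A ->
  measurable_fun setT f -> (forall z, 0 <= f z)%E -> measurable_fun setT g ->
  (forall y : R, s < y < t -> (\int[mu]_(x in A) f (x, y) <= (g y)%:E)%E) ->
  (\int[mu2]_(z in A `*` `[s, t]%classic) f z <= \int[mu]_(y in `[s, t]) (g y)%:E)%E.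
Proof.
move=> mA mf f0 mg fg; rewrite /mu2 tonelli_rect2//.
have mG : measurable_fun `]s, t[ (fun y => (g y)%:E).
  by apply/measurable_EFinP; exact: measurable_funTS.
have mF := @measurable_inner _ _ _ _ _ mu _ _ mA mf f0.
have mF' := measurable_funTS (D := `]s, t[%classic) mF.
pose F y := (\int[mu]_(x in A) f (x, y))%E.
rewrite -[leLHS]/(\int[mu]_(y in `[s, t]) F y)%E.
rewrite (@integral_itv_bndoo R s t F true false mF').
rewrite (integral_itv_bndoo true false)//.
apply: ge0_le_integral => //.
- by move=> y _; exact: integral_ge0.
Qed.

Lemma gap2_swap r A B : measurable A -> measurable B ->
  (\int[mu2]_(z in A `*` B) (gap2 r z)%:E = \int[mu2]_(z in B `*` A) (gap2 r z)%:E)%E.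
Proof.
move=> mA mB; rewrite /mu2.
rewrite (tonelli_rect1 mu mu mA mB (mgE r) (g0 r)).
rewrite (tonelli_rect2 mu mu mB mA (mgE r) (g0 r)).
by apply: eq_integral => x _; apply: eq_integral => y _; rewrite /gap2/= gapC.
Qed.

Lemma gap2_square r s t : -1 < r -> s <= t ->
  (\int[mu2]_(z in `[s, t]%classic `*` `[s, t]%classic) (gap2 r z)%:E <=
    (2 / (r + 1) * (t - s) `^ (r + 2))%:E)%E.
Proof.
move=> r1 st; have r10 : 0 < r + 1 by lra.
apply: (le_trans (@rect_le `[s, t]%classic s t _
  (fun=> 2 / (r + 1) * (t - s) `^ (r + 1)) _ (mgE r) (g0 r) _ _)) => //.
  by move=> y /andP[sy yt]; apply: integral_gap_inside => //; exact: ltW.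
rewrite integral_cst//= lebesgue_measure_itv/= lte_fin.
have -> : r + 2 = 1 + (r + 1) by ring.
move: st; rewrite le_eqVlt => /predU1P[->|st].
  by rewrite ltxx mule0 subrr powR0 ?mulr0// gt_eqF//; lra.
rewrite st -EFinD -EFinM lee_fin powR_mul_base ?subr_ge0 ?(ltW st)//.
by rewrite le_eqVlt; apply/orP; left; apply/eqP; ring.
Qed.

(** The inner integral is a power [dl - 1] of the distance to the common side of the two
    intervals, which is still integrable. *)
Lemma gap2_side dl a b s t : 0 < dl -> dl < 1 -> a <= b -> s <= t ->
  b <= s \/ t <= a ->
  (\int[mu2]_(z in `[a, b]%classic `*` `[s, t]%classic) (gap2 (dl - 2) z)%:E <=
    (2 / dl / (1 - dl) * (t - s) `^ dl)%:E)%E.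
Proof.
move=> dl0 dl1 ab st out; have dl1' : 0 < 1 - dl by rewrite subr_gt0.
pose c := if b <= s then s else t.
have mh : measurable_fun setT (fun y : T => gap (dl - 1) y c).
  exact: measurable_gap_fun.
apply: (le_trans (@rect_le `[a, b]%classic s t _ (fun y => gap (dl - 1) y c / (1 - dl))
  _ (mgE _) (g0 _) _ _)) => //.
- by apply: measurable_funM.
- move=> y /andP[sy yt]; rewrite /gap2/=.
  have out' : y < a \/ b < y by case: out => ?; [right|left]; lra.
  apply: (le_trans (integral_gap_outside dl0 dl1 ab out')).
  rewrite lee_fin ler_wpM2r ?invr_ge0 ?(ltW dl1')// /gap.
  have -> : dl - 1 = - (1 - dl) by ring.
  have cy : 0 < `|y - c|.
    rewrite normr_gt0 subr_eq0 /c; case: ifP => _.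
      by rewrite gt_eqF.
    by rewrite lt_eqF.
  have cm : `|y - c| <= Num.max (a - y) (y - b).
    rewrite le_max /c; case: ifPn => [bs|]; rewrite -?ltNge.
      by apply/orP; right; rewrite ger0_norm ?subr_ge0 ?(ltW sy)// lerD2l lerN2.
    move=> sb; have ta : t <= a by case: out => // bs; move: (lt_le_trans sb bs); rewrite ltxx.
    apply/orP; left; rewrite ler0_norm ?subr_le0 ?(ltW yt)// opprB lerD2r.
    exact: ta.
  rewrite !powRN lef_pV2 ?posrE ?powR_gt0 ?(lt_le_trans cy)//.
  by rewrite powR_le_base// ltW.
have -> : (\int[mu]_(y in `[s, t]) (gap (dl - 1) y c / (1 - dl))%:E =
    (1 - dl)^-1%:E * \int[mu]_(y in `[s, t]) (gap (dl - 1) y c)%:E)%E.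
  rewrite -ge0_integralZl_EFin//.
  - by apply: eq_integral => y _; rewrite -EFinM mulrC.
  - by move=> y _; rewrite lee_fin gap_ge0.
  - by apply/measurable_EFinP; apply: measurable_funTS.
  - by rewrite invr_ge0 ltW.
have -> : 2 / dl / (1 - dl) * (t - s) `^ dl = (1 - dl)^-1 * (2 / dl * (t - s) `^ dl).
  ring.
rewrite EFinM lee_wpmul2l ?lee_fin ?invr_ge0 ?(ltW dl1')//.
have cst : s <= c <= t by rewrite /c; case: ifP => _; rewrite lexx ?andbT.
have dlm1 : -1 < dl - 1 by lra.
have /andP[sc ct] := cst.
by have := integral_gap_inside dlm1 sc ct; rewrite subrK.
Qed.

(** Altering a path on [[s, t]] only affects the increments over the pairs of this
    frame and of the square it surrounds. *)
Definition frame s t : set (T * T) :=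
  ((`[0%R, s]%classic `*` `[s, t]%classic) `|` (`[t, 1%R]%classic `*` `[s, t]%classic)) `|`
  ((`[s, t]%classic `*` `[0%R, s]%classic) `|` (`[s, t]%classic `*` `[t, 1%R]%classic)).

Lemma unit_squareE (x y : R) : unit_square (x, y) = (0 <= x <= 1) && (0 <= y <= 1) :> Prop.
Proof.
apply/propext; rewrite /unit_square/= !in_itv/=; split=> [[-> ->//]|].
by move=> /andP[-> ->].
Qed.

Lemma frameE s t (x y : R) : frame s t (x, y) =
  ((s <= y <= t) && ((0 <= x <= s) || (t <= x <= 1))) ||
  ((s <= x <= t) && ((0 <= y <= s) || (t <= y <= 1))) :> Prop.
Proof.
apply/propext; rewrite /frame/= !in_itv/=; split.
  by move=> [[|]|[|]] [-> ->]; rewrite ?orbT.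
move=> /orP[] /andP[-> /orP[]->]; [left; left|left; right|right; left|right; right] => //.
Qed.

Lemma frame_sub s t (x y : R) : 0 <= s -> s <= t -> t <= 1 ->
  frame s t (x, y) -> unit_square (x, y).
Proof.
rewrite frameE unit_squareE => s0 st t1.
by move=> /orP[] /andP[/andP[h1 h2] /orP[] /andP[h3 h4]];
  apply/andP; split; apply/andP; split; lra.
Qed.

Lemma square_frame s t (x y : R) : 0 <= s -> t <= 1 -> s <= x <= t -> s <= y <= t ->
  ~ frame s t (x, y) -> (s < x < t) && (s < y < t).
Proof.
rewrite frameE => s0 t1 /andP[sx xt] /andP[sy yt] /negP.
rewrite negb_or sx xt sy yt /= (le_trans s0 sx) (le_trans s0 sy) /=.
rewrite (le_trans xt t1) (le_trans yt t1) !andbT !negb_or -!ltNge.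
by move=> /andP[/andP[-> ->] /andP[-> ->]].
Qed.

Lemma off_frame s t (x y : R) : 0 <= x <= 1 -> 0 <= y <= 1 ->
  ~ (s <= x <= t /\ s <= y <= t) -> ~ frame s t (x, y) ->
  ~~ (s <= x <= t) /\ ~~ (s <= y <= t).
Proof.
rewrite frameE => /andP[x0 x1] /andP[y0 y1] nS /negP nF.
split; apply/negP => h.
  move: nF; rewrite h /= x0 y0 x1 y1 !andbT /= negb_or => /andP[_].
  rewrite negb_or -!ltNge => /andP[sy yt]; apply: nS.
  by rewrite h (ltW sy) (ltW yt).
move: nF; rewrite h /= x0 y0 x1 y1 !andbT /= negb_or => /andP[].
rewrite negb_or -!ltNge => /andP[sx xt] _; apply: nS.
by rewrite h (ltW sx) (ltW xt).
Qed.

Lemma measurable_frame s t : measurable (frame s t).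
Proof. by apply: measurableU; apply: measurableU; apply: measurableX. Qed.

Lemma gap2_frame dl s t : 0 < dl -> dl < 1 -> 0 <= s -> s <= t -> t <= 1 ->
  (\int[mu2]_(z in frame s t) (gap2 (dl - 2) z)%:E <=
    (8 / dl / (1 - dl) * (t - s) `^ dl)%:E)%E.
Proof.
move=> dl0 dl1 s0 st t1.
have mX (a b c e : R) : measurable ((`[a, b]%classic : set T) `*` (`[c, e]%classic : set T)).
  by apply: measurableX.
apply: le_trans (ge0_integral_setU_le mu2 _ _ (mgE _) (g0 _)) _; try exact: measurableU.
set K := 2 / dl / (1 - dl) * (t - s) `^ dl.
have -> : 8 / dl / (1 - dl) * (t - s) `^ dl = (K + K) + (K + K) by rewrite /K; ring.
have h1 := @gap2_side dl 0 s s t dl0 dl1 s0 st (or_introl (lexx s)).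
have h2 := @gap2_side dl t 1 s t dl0 dl1 t1 st (or_intror (lexx t)).
rewrite EFinD; apply: leeD; apply: le_trans (ge0_integral_setU_le mu2 _ _ (mgE _) (g0 _)) _ => //;
  rewrite EFinD; apply: leeD => //.
- by rewrite gap2_swap.
- by rewrite gap2_swap.
Qed.

Lemma unit_square_region (G : T * T -> R) r c : -1 < r -> 0 <= c ->
  measurable_fun setT G -> (forall z, unit_square z -> `|G z| <= c * gap2 r z) ->
  mu2.-integrable unit_square (EFin \o G) /\
  `|\int[mu2]_(z in unit_square) G z| <= c * (2 / (r + 1)).
Proof.
move=> r1 c0 mG Gc.
have mD : measurable unit_square by apply: measurableX.
have := @integral_two_regions _ _ _ mu2 unit_square unit_square set0 G
  (fun z => c * gap2 r z) (fun=> 0) (c * (2 / (r + 1))) 0 mD mD measurable0 mG.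
rewrite addr0; apply => //.
- by apply: measurable_funM => //; exact: measurable_gap2.
- by move=> z; rewrite mulr_ge0// gap_ge0.
- by move=> z Uz _; exact: Gc.
- rewrite (_ : (\int[mu2]_(z in unit_square) (c * gap2 r z)%:E =
      c%:E * \int[mu2]_(z in unit_square) (gap2 r z)%:E)%E); last first.
    rewrite -ge0_integralZl_EFin//; exact: measurable_funTS.
  rewrite EFinM lee_wpmul2l ?lee_fin//.
  by have := gap2_square r1 ler01; rewrite subr0 powR1 mulr1.
- by rewrite integral_set0.
Qed.

(** The increments of a path altered on [[s, t]] gain a power of the distance for pairs
    inside the square over [[s, t]], and nothing on the frame; both contributions are
    nevertheless small with [t - s], the frame being thin. *)
Lemma frame_region (G : T * T -> R) r dl c c' s t : -1 < r -> 0 < dl -> dl < 1 ->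
  0 <= c -> 0 <= c' -> 0 <= s -> s <= t -> t <= 1 -> measurable_fun setT G ->
  (forall x y : R, s < x < t -> s < y < t -> `|G (x, y)| <= c * gap r x y) ->
  (forall x y : R, 0 <= x <= 1 -> 0 <= y <= 1 -> `|G (x, y)| <= c' * gap (dl - 2) x y) ->
  (forall x y : R, 0 <= x <= 1 -> 0 <= y <= 1 -> ~~ (s <= x <= t) -> ~~ (s <= y <= t) ->
    G (x, y) = 0) ->
  mu2.-integrable unit_square (EFin \o G) /\
  `|\int[mu2]_(z in unit_square) G z| <=
    c * (2 / (r + 1)) * (t - s) `^ (r + 2) +
    c' * (8 / dl / (1 - dl)) * (t - s) `^ dl.
Proof.
move=> r1 dl0 dl1 c0 c'0 s0 st t1 mG G1 G2 G3.
have mD : measurable unit_square by apply: measurableX.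
have mS : measurable ((`[s, t]%classic : set T) `*` (`[s, t]%classic : set T)).
  by apply: measurableX.
apply: (@integral_two_regions _ _ _ mu2 unit_square
  ((`[s, t]%classic : set T) `*` (`[s, t]%classic : set T)) (frame s t) G
  (fun z => c * gap2 r z) (fun z => c' * gap2 (dl - 2) z)) => //.
- exact: measurable_frame.
- by apply: measurable_funM => //; exact: measurable_gap2.
- by apply: measurable_funM => //; exact: measurable_gap2.
- move=> [x y] /= []; rewrite !in_itv/= => /andP[sx xt] /andP[sy yt].
  rewrite unit_squareE (le_trans s0 sx) (le_trans s0 sy) (le_trans xt t1).
  exact: le_trans yt t1.
- by move=> [x y]; exact: frame_sub.
- by move=> z; rewrite mulr_ge0// gap_ge0.
- by move=> z; rewrite mulr_ge0// gap_ge0.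
- move=> [x y] /= []; rewrite !in_itv/= => sx sy nF.
  by have /andP[] := square_frame s0 t1 sx sy nF; exact: G1.
- move=> [x y] /(frame_sub s0 st t1); rewrite unit_squareE => /andP[].
  exact: G2.
- move=> [x y]; rewrite unit_squareE => /andP[x01 y01] nS nF.
  have nS' : ~ (s <= x <= t /\ s <= y <= t).
    by move=> [sx sy]; apply: nS; split; rewrite /= in_itv.
  by have [] := off_frame x01 y01 nS' nF; exact: G3.
- rewrite (_ : (\int[mu2]_(z in _) (c * gap2 r z)%:E = c%:E *
      \int[mu2]_(z in (`[s, t]%classic : set T) `*` (`[s, t]%classic : set T)) (gap2 r z)%:E)%E);
    last by rewrite -ge0_integralZl_EFin//; exact: measurable_funTS.
  by rewrite -mulrA EFinM lee_wpmul2l ?lee_fin//; exact: gap2_square.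
- rewrite (_ : (\int[mu2]_(z in frame s t) (c' * gap2 (dl - 2) z)%:E = c'%:E *
      \int[mu2]_(z in frame s t) (gap2 (dl - 2) z)%:E)%E); last first.
    rewrite -ge0_integralZl_EFin//; first exact: measurable_frame.
    exact: measurable_funTS.
  by rewrite -mulrA EFinM lee_wpmul2l ?lee_fin//; exact: gap2_frame.
Qed.

End gap_regions.

(** * The Sobolev functional and its derivative *)

Section signed_powers.
Context {R : realType}.
Implicit Types (a b c u v q P : R).

Definition spow q a : R := Num.sg a * `|a| `^ q.

Lemma spowN q a : spow q (- a) = - spow q a.
Proof. by rewrite /spow sgrN normrN mulNr. Qed.

Lemma spow_ge0E q a : 0 <= a -> 0 < q -> spow q a = a `^ q.
Proof.
move=> a0 q0; rewrite /spow ger0_norm//; move: a0; rewrite le_eqVlt => /predU1P[<-|a0].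
  by rewrite sgr0 mul0r powR0// gt_eqF.
by rewrite gtr0_sg// mul1r.
Qed.

Lemma norm_spow q a : 0 < q -> `|spow q a| = `|a| `^ q.
Proof.
move=> q0; have [a0|/ltW a0] := leP 0 a.
  by rewrite spow_ge0E// !ger0_norm// powR_ge0.
rewrite -[a]opprK spowN !normrN spow_ge0E ?oppr_ge0//.
by rewrite (ger0_norm (powR_ge0 _ _)) ler0_norm.
Qed.

Lemma spow_mul q a : 0 < q -> spow q a * a = `|a| `^ (1 + q).
Proof.
move=> q0; rewrite powR_mul_base ?normr_ge0// /spow.
by rewrite mulrAC -normrEsg.
Qed.

(** The tangent to a convex power lies below its graph (Young's inequality). *)
Lemma powR_tangent P u v : 1 <= P -> 0 <= u -> 0 <= v ->
  P * (u `^ (P - 1) * v) <= v `^ P + (P - 1) * u `^ P.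
Proof.
move=> P1 u0 v0; have P0 : 0 < P by lra.
move: P1; rewrite le_eqVlt => /predU1P[<-|P1].
  by rewrite subrr mul0r addr0 powRr0 !mul1r powRr1.
have P10 : 0 < P - 1 by lra.
have q0 : 0 < P / (P - 1) by rewrite divr_gt0.
have conj : P^-1 + (P / (P - 1))^-1 = 1 by field; rewrite !gt_eqF.
have := conjugate_powR v0 (powR_ge0 u (P - 1)) P0 q0 conj.
rewrite -powRrM (_ : (P - 1) * (P / (P - 1)) = P); last by field; rewrite gt_eqF.
move=> h; rewrite -ler_pdivlMl// [_ `^ _ * v]mulrC; apply: (le_trans h).
by rewrite le_eqVlt; apply/orP; left; apply/eqP; field; rewrite !gt_eqF.
Qed.

(** On a half line this is the tangent inequality; across the origin the two powers are
    bounded separately. *)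
Lemma spow_lip q u v m : 1 <= q -> `|u| <= m -> `|v| <= m ->
  `|spow q u - spow q v| <= q * m `^ (q - 1) * `|u - v|.
Proof.
move=> q1; have q0 : 0 < q by lra.
have q10 : 0 <= q - 1 by lra.
have ordered x y : 0 <= y -> y <= x -> x <= m ->
    `|spow q x - spow q y| <= q * m `^ (q - 1) * `|x - y|.
  move=> y0 yx xm; have x0 := le_trans y0 yx.
  rewrite !spow_ge0E// !ger0_norm ?subr_ge0//; last by rewrite powR_le_base// ltW.
  have xq : x `^ q = x `^ (q - 1) * x.
    have [->|xn0] := eqVneq x 0; first by rewrite mulr0 powR0// gt_eqF.
    by rewrite -{3}(powRr1 x0) -powRD ?subrK// xn0 implybT.
  have := powR_tangent q1 x0 y0.
  have : q * x `^ (q - 1) * (x - y) <= q * m `^ (q - 1) * (x - y).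
    by rewrite ler_wpM2r ?subr_ge0// ler_wpM2l ?(ltW q0)// powR_le_base.
  rewrite xq; nra.
have nonneg x y : 0 <= y -> 0 <= x -> x <= m -> y <= m ->
    `|spow q x - spow q y| <= q * m `^ (q - 1) * `|x - y|.
  move=> y0 x0 xm ym; have [yx|/ltW xy] := leP y x; first exact: ordered.
  by rewrite distrC (distrC x); exact: ordered.
have opposite x y : 0 <= x -> y <= 0 -> x <= m -> - y <= m ->
    `|spow q x - spow q y| <= q * m `^ (q - 1) * `|x - y|.
  move=> x0 y0 xm ym; have y0' : 0 <= - y by rewrite oppr_ge0.
  rewrite -{1}[y]opprK spowN opprK !spow_ge0E// !ger0_norm ?addr_ge0 ?powR_ge0//.
  have single w : 0 <= w -> w <= m -> w `^ q <= m `^ (q - 1) * w.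
    move=> w0 wm; have [->|wn0] := eqVneq w 0; first by rewrite mulr0 powR0// gt_eqF.
    rewrite (_ : w `^ q = w `^ (q - 1) * w).
      by rewrite ler_wpM2r// powR_le_base.
    by rewrite -{3}(powRr1 w0) -powRD ?subrK// wn0 implybT.
  have := single _ x0 xm; have := single _ y0' ym.
  have mq := powR_ge0 m (q - 1).
  have : m `^ (q - 1) * (x - y) <= q * m `^ (q - 1) * (x - y).
    by rewrite -mulrA ler_peMl// mulr_ge0//; lra.
  by move=> ? ? ?; lra.
rewrite !ler_norml => /andP[um1 um2] /andP[vm1 vm2]; rewrite -ler_norml.
have [u0|/ltW u0] := leP 0 u; have [v0|/ltW v0] := leP 0 v.
- exact: nonneg.
- by apply: opposite => //; rewrite lerNl.
- by rewrite distrC (distrC u); apply: opposite => //; rewrite lerNl.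
- have u0' : 0 <= - u by rewrite oppr_ge0.
  have v0' : 0 <= - v by rewrite oppr_ge0.
  have um' : - u <= m by rewrite lerNl.
  have vm' : - v <= m by rewrite lerNl.
  have := nonneg _ _ v0' u0' um' vm'; rewrite !spowN.
  have -> : - spow q u - - spow q v = - (spow q u - spow q v) by ring.
  have -> : - u - - v = - (u - v) by ring.
  by rewrite !normrN.
Qed.

(** The lower bound is the tangent inequality at [a], the upper one the tangent
    inequality at [a + b]; the slopes differ by at most [spow_lip]. *)
Lemma abs_pow_taylor P a b m : 2 <= P -> `|a| <= m -> `|a + b| <= m ->
  0 <= `|a + b| `^ P - `|a| `^ P - P * spow (P - 1) a * b <=
    P * (P - 1) * m `^ (P - 2) * b ^+ 2.
Proof.
move=> P2 am abm; have P1 : 1 <= P by lra.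
have P10 : 0 < P - 1 by lra.
have P0 : 0 < P by lra.
have self c : spow (P - 1) c * c = `|c| `^ P.
  by rewrite spow_mul//; congr (_ `^ _); ring.
have tangent x c : P * (spow (P - 1) x * c) <= `|c| `^ P + (P - 1) * `|x| `^ P.
  apply: le_trans (powR_tangent P1 (normr_ge0 x) (normr_ge0 c)).
  rewrite ler_wpM2l ?(ltW P0)// -norm_spow//.
  by apply: le_trans (ler_norm _) _; rewrite normrM.
have lo := tangent a (a + b); have hi := tangent (a + b) a.
have sa := self a; have sab := self (a + b).
have lip := spow_lip (_ : 1 <= P - 1) abm am.
have {}lip : (spow (P - 1) (a + b) - spow (P - 1) a) * b <=
   (P - 1) * m `^ (P - 2) * b ^+ 2.
  apply: le_trans (ler_norm _) _; rewrite normrM -(real_normK (num_real b)) expr2 mulrA.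
  rewrite ler_wpM2r//; apply: le_trans (lip _) _; first lra.
  have -> : P - 1 - 1 = P - 2 by ring.
  by have -> : a + b - a = b by ring.
have Plip := ler_wpM2l (ltW P0) lip.
apply/andP; split.
  rewrite mulrDr sa in lo; move: lo.
  by rewrite mulrDr; lra.
rewrite mulrDr in sab; move: Plip hi; set X := spow _ (a + b); set E := `|a + b| `^ P.
have {}sab : P * (X * a) + P * (X * b) = P * E by rewrite -mulrDr sab.
by move=> Plip hi; lra.
Qed.

End signed_powers.

Section sobolev_functional.
Context {R : realType}.
Local Notation T := (measurableTypeR R).
Implicit Types (f g h x : R -> R) (A B c s t u v : R).

Lemma hoelder_measurable a (f : hoelderType a) : measurable_fun [set: T] (f : T -> R).
Proof.
have := hoelderP f; rewrite inE/= => -[fE [fc _]]; rewrite -fE.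
have mI : measurable (`[0%R, 1%R]%classic : set T) by exact: measurable_itv.
apply/(measurable_restrictT _ mI).
exact: subspace_continuous_measurable_fun.
Qed.

Lemma spow_maxE q (a : R) : 0 < q ->
  spow q a = (Num.max a 0) `^ q - (Num.max (- a) 0) `^ q.
Proof.
move=> q0; have q0' : q != 0 by rewrite gt_eqF.
case: (boolP (0 <= a)) => [a0|]; last rewrite -ltNge => /ltW a0.
  rewrite spow_ge0E// (max_idPl a0) (max_idPr _) ?oppr_le0//.
  by rewrite powR0// subr0.
rewrite -{1}[a]opprK spowN spow_ge0E ?oppr_ge0//.
by rewrite (max_idPr a0) (max_idPl _) ?oppr_ge0// powR0// sub0r.
Qed.

Section measurability.
Context {dsp : measure_display} {U : measurableType dsp}.

Lemma measurable_spow q (g : U -> R) : 0 < q -> measurable_fun setT g ->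
  measurable_fun setT (fun z => spow q (g z)).
Proof.
move=> q0 mg.
rewrite (_ : (fun z => _) =
  (fun z => (Num.max (g z) 0) `^ q - (Num.max (- g z) 0) `^ q)); last first.
  by apply/funext => z; exact: spow_maxE.
apply: measurable_funB; apply: (measurableT_comp (measurable_powR q)).
  exact: measurable_maxr.
by apply: measurable_maxr => //; exact: measurableT_comp.
Qed.

End measurability.

Lemma measurable_incr f : measurable_fun [set: T] (f : T -> R) ->
  measurable_fun [set: T * T] (fun z : T * T => f z.1 - f z.2).
Proof.
move=> mf; apply: measurable_funB.
  by apply: (measurableT_comp mf); exact: measurable_fst.
by apply: (measurableT_comp mf); exact: measurable_snd.
Qed.

Lemma measurable_dist_pow r :
  measurable_fun [set: T * T] (fun z : T * T => `|z.1 - z.2| `^ r : R).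
Proof. exact: measurable_gap2. Qed.

Lemma div_gap c e1 e2 r u v (X : R) : e2 != 0 -> r = e1 - e2 -> 0 <= c ->
  X <= c * `|u - v| `^ e1 -> X / `|u - v| `^ e2 <= c * gap r u v.
Proof.
move=> e2n -> c0 Xc; rewrite /gap; have [->|uv] := eqVneq u v.
  by rewrite subrr normr0 (powR0 e2n) invr0 mulr0 mulr_ge0// powR_ge0.
have uv0 : 0 < `|u - v| by rewrite normr_gt0 subr_eq0.
rewrite ler_pdivrMr ?powR_gt0// -mulrA -powRD ?subrK//.
by rewrite normr_eq0 subr_eq0 uv implybT.
Qed.

Variables (gam p be : R).
Hypotheses (p1 : 1 <= p) (gam0 : 0 < gam) (be0 : 0 < be).
Hypothesis pbe : 1 < 2 * p * (be - gam).

Let p0 : 0 <= p. Proof. by have := p1; lra. Qed.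
Let P0 : 0 < 2 * p. Proof. by have := p1; lra. Qed.
Let P10 : 0 < 2 * p - 1. Proof. by have := p1; lra. Qed.
Let e0 : 2 * p * gam + 2 != 0.
Proof. by rewrite gt_eqF// addr_gt0// mulr_gt0. Qed.
Let rE : 2 * p * (be - gam) - 2 = 2 * p * be - (2 * p * gam + 2). Proof. by ring. Qed.
Let r1 : -1 < 2 * p * (be - gam) - 2. Proof. by have := pbe; lra. Qed.

Definition density x (z : T * T) : R :=
  `|x z.1 - x z.2| `^ (2 * p) / `|z.1 - z.2| `^ (2 * p * gam + 2).

(** $\|x\|_{\gamma,p}^{2p}$ as a single integral over the square, see [sobolev_normE]. *)
Definition sobI x : R := \int[mu2]_(z in unit_square) density x z.

(** The derivative of [sobI] at [x] in the direction [h]. *)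
Definition pairing x h : R :=
  \int[mu2]_(z in unit_square) (rho gam p x z.1 z.2 * (h z.1 - h z.2)).

Lemma rhoE x u v : rho gam p x u v =
  2 * p * (spow (2 * p - 1) (x u - x v) / `|u - v| `^ (2 * p * gam + 2)).
Proof. by rewrite /rho /spow (_ : 2 * gam * p = 2 * p * gam)//; ring. Qed.

Lemma rhoC x u v : rho gam p x u v = - rho gam p x v u.
Proof. by rewrite !rhoE -[x u - x v]opprB spowN distrC; ring. Qed.

Lemma measurable_density x : measurable_fun [set: T] (x : T -> R) ->
  measurable_fun [set: T * T] (density x).
Proof.
move=> mx; rewrite (_ : density x = fun z => `|x z.1 - x z.2| `^ (2 * p) *
    `|z.1 - z.2| `^ (- (2 * p * gam + 2))); last first.
  by apply/funext => z; rewrite powRN.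
apply: measurable_funM; last exact: measurable_dist_pow.
apply: (measurableT_comp (measurable_powR _)).
by apply: measurableT_comp => //; exact: measurable_incr.
Qed.

Lemma measurable_rho x : measurable_fun [set: T] (x : T -> R) ->
  measurable_fun [set: T * T] (fun z : T * T => rho gam p x z.1 z.2).
Proof.
move=> mx; rewrite (_ : (fun z => _) = fun z : T * T => 2 * p *
   (spow (2 * p - 1) (x z.1 - x z.2) * `|z.1 - z.2| `^ (- (2 * p * gam + 2)))).
  apply: measurable_funM => //; apply: measurable_funM; last exact: measurable_dist_pow.
  by apply: measurable_spow => //; exact: measurable_incr.
by apply/funext => z; rewrite rhoE powRN.
Qed.

Lemma measurable_rho_mul x (g : T * T -> R) : measurable_fun [set: T] (x : T -> R) ->
  measurable_fun [set: T * T] g ->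
  measurable_fun [set: T * T] (fun z : T * T => rho gam p x z.1 z.2 * g z).
Proof. by move=> mx mg; apply: measurable_funM => //; exact: measurable_rho. Qed.

Lemma incr_bound A x u v : hld be A x -> 0 <= u <= 1 -> 0 <= v <= 1 ->
  `|x u - x v| <= A * `|u - v| `^ be.
Proof. by move=> xA u01 v01; exact: hld_norm xA v01 u01. Qed.

Lemma pow_incr A q (d1 : R) : 0 <= A -> 0 <= q -> 0 <= d1 ->
  (A * d1 `^ be) `^ q = A `^ q * d1 `^ (be * q).
Proof. by move=> A0 q0 d0; rewrite powRM ?powR_ge0// -powRrM. Qed.

Lemma density_bound A x u v : hld be A x -> 0 <= u <= 1 -> 0 <= v <= 1 ->
  `|density x (u, v)| <= A `^ (2 * p) * gap (2 * p * (be - gam) - 2) u v.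
Proof.
move=> xA u01 v01; have A0 := hld_ge0 xA.
rewrite ger0_norm; last by rewrite divr_ge0 ?powR_ge0.
rewrite /density/=; apply: (div_gap e0 rE); first exact: powR_ge0.
have h := incr_bound xA u01 v01.
apply: (le_trans (powR_le_base (ltW P0) (normr_ge0 _) h)).
by rewrite pow_incr ?(ltW P0)// mulrC [be * _]mulrC mulrC.
Qed.

Lemma density_integrable A x : measurable_fun [set: T] (x : T -> R) -> hld be A x ->
  mu2.-integrable unit_square (EFin \o density x).
Proof.
move=> mx xA.
apply: (unit_square_region r1 (powR_ge0 A (2 * p)) (measurable_density mx) _).1.
by move=> [u v]; rewrite unit_squareE => /andP[]; exact: density_bound.
Qed.

Lemma rho_bound A x u v : hld be A x -> 0 <= u <= 1 -> 0 <= v <= 1 ->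
  `|rho gam p x u v| <= 2 * p * A `^ (2 * p - 1) *
     gap (be * (2 * p - 1) - (2 * p * gam + 2)) u v.
Proof.
move=> xA u01 v01; have A0 := hld_ge0 xA.
rewrite rhoE normrM (ger0_norm (ltW P0)) -[leRHS]mulrA ler_wpM2l ?(ltW P0)//.
rewrite normrM norm_spow// normfV (ger0_norm (powR_ge0 _ _)).
apply: (div_gap e0 erefl); first exact: powR_ge0.
apply: (le_trans (powR_le_base (ltW P10) (normr_ge0 _) (incr_bound xA u01 v01))).
by rewrite pow_incr ?(ltW P10).
Qed.

Lemma pairing_density_bound A B x h u v : hld be A x -> hld be B h ->
  0 <= u <= 1 -> 0 <= v <= 1 ->
  `|rho gam p x u v * (h u - h v)| <=
    2 * p * A `^ (2 * p - 1) * B * gap (2 * p * (be - gam) - 2) u v.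
Proof.
move=> xA hB u01 v01; have [A0 B0] := (hld_ge0 xA, hld_ge0 hB).
rewrite rhoE (_ : _ * (h u - h v) = 2 * p * (spow (2 * p - 1) (x u - x v) *
  (h u - h v) / `|u - v| `^ (2 * p * gam + 2))); last by ring.
rewrite [leRHS](_ : _ = 2 * p * (A `^ (2 * p - 1) * B *
  gap (2 * p * (be - gam) - 2) u v)); last by ring.
rewrite normrM (ger0_norm (ltW P0)) ler_wpM2l ?(ltW P0)//.
rewrite normrM normfV (ger0_norm (powR_ge0 `|u - v| _)).
apply: (div_gap e0 rE); first by rewrite mulr_ge0// powR_ge0.
rewrite normrM norm_spow//.
have hx := powR_le_base (ltW P10) (normr_ge0 _) (incr_bound xA u01 v01).
have hh := incr_bound hB u01 v01.
apply: (le_trans (ler_pM (powR_ge0 _ _) (normr_ge0 _) hx hh)).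
rewrite pow_incr ?(ltW P10)// mulrACA -powR_mulD ?mulr_gt0//.
by rewrite (_ : be * (2 * p - 1) + be = 2 * p * be)//; ring.
Qed.

Lemma pairing_region A B x h : measurable_fun [set: T] (x : T -> R) ->
  measurable_fun [set: T] (h : T -> R) -> hld be A x -> hld be B h ->
  mu2.-integrable unit_square
    (EFin \o (fun z : T * T => rho gam p x z.1 z.2 * (h z.1 - h z.2))) /\
  `|pairing x h| <= 2 * p * A `^ (2 * p - 1) * B * (2 / (2 * p * (be - gam) - 2 + 1)).
Proof.
move=> mx mh xA hB; apply: unit_square_region => //.
- by rewrite !mulr_ge0 ?(ltW P0) ?powR_ge0 ?(hld_ge0 hB).
- by apply: measurable_rho_mul => //; exact: measurable_incr.
- by move=> [u v]; rewrite unit_squareE => /andP[]; exact: pairing_density_bound.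
Qed.

Lemma remainder_bound A B x h u v : hld be A x -> hld be B h ->
  0 <= u <= 1 -> 0 <= v <= 1 ->
  `|density (fun s => x s + h s) (u, v) - density x (u, v) -
    rho gam p x u v * (h u - h v)| <=
  2 * p * (2 * p - 1) * (A + B) `^ (2 * p - 2) * B ^+ 2 *
    gap (2 * p * (be - gam) - 2) u v.
Proof.
move=> xA hB u01 v01; have [A0 B0] := (hld_ge0 xA, hld_ge0 hB).
set a := x u - x v; set b := h u - h v.
set m := (A + B) * `|u - v| `^ be.
have hx := incr_bound xA u01 v01; have hh := incr_bound hB u01 v01.
have dist0 := powR_ge0 `|u - v| be.
have am : `|a| <= m.
  by apply: (le_trans hx); rewrite ler_wpM2r// lerDl.
have abm : `|a + b| <= m.
  by apply: (le_trans (ler_normD _ _)); rewrite /m mulrDl lerD.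
have P2 : 2 <= 2 * p by have := p1; lra.
have /andP[lo hi] := abs_pow_taylor P2 am abm.
rewrite rhoE -/a -/b /density/= -/a (_ : x u + h u - (x v + h v) = a + b); last first.
  by rewrite /a /b; ring.
rewrite (_ : _ - _ - _ = (`|a + b| `^ (2 * p) - `|a| `^ (2 * p) -
   2 * p * spow (2 * p - 1) a * b) / `|u - v| `^ (2 * p * gam + 2)); last by ring.
rewrite normrM (ger0_norm lo) normfV (ger0_norm (powR_ge0 _ _)).
apply: (div_gap e0 rE).
  by rewrite !mulr_ge0 ?(ltW P0) ?(ltW P10) ?powR_ge0 ?exprn_ge0.
apply: (le_trans hi).
have PP : 0 <= 2 * p * (2 * p - 1) by rewrite mulr_ge0 ?(ltW P0) ?(ltW P10).
rewrite [leLHS](_ : _ = 2 * p * (2 * p - 1) * (m `^ (2 * p - 2) * b ^+ 2)); last by ring.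
rewrite [leRHS](_ : _ = 2 * p * (2 * p - 1) *
  ((A + B) `^ (2 * p - 2) * B ^+ 2 * `|u - v| `^ (2 * p * be))); last by ring.
rewrite ler_wpM2l// /m pow_incr//; [|by rewrite addr_ge0|by have := p1; lra].
have b2 : b ^+ 2 <= B ^+ 2 * `|u - v| `^ (be * 2).
  have -> : `|u - v| `^ (be * 2) = (`|u - v| `^ be) ^+ 2.
    by rewrite powRrM -[in RHS]powR_mulrn.
  by rewrite -exprMn -(real_normK (num_real b)) lerXn2r ?nnegrE ?mulr_ge0.
apply: le_trans (ler_wpM2l _ b2) _; first by rewrite mulr_ge0 ?powR_ge0.
rewrite [leLHS](_ : _ = (A + B) `^ (2 * p - 2) * B ^+ 2 *
  (`|u - v| `^ (be * (2 * p - 2)) * `|u - v| `^ (be * 2))); last by ring.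
have es : be * (2 * p - 2) + be * 2 = 2 * p * be by ring.
have c : (be * (2 * p - 2) + be * 2 == 0) ==> (`|u - v| != 0).
  by rewrite es gt_eqF// mulr_gt0.
by rewrite -(powRD c) es.
Qed.

(** Second-order expansion of the functional, with the explicit remainder given by
    convexity of the power. *)
Lemma sobI_taylor A B x h : measurable_fun [set: T] (x : T -> R) ->
  measurable_fun [set: T] (h : T -> R) -> hld be A x -> hld be B h ->
  `|sobI (fun s => x s + h s) - sobI x - pairing x h| <=
  2 * p * (2 * p - 1) * (A + B) `^ (2 * p - 2) * B ^+ 2 *
    (2 / (2 * p * (be - gam) - 2 + 1)).
Proof.
move=> mx mh xA hB; have [A0 B0] := (hld_ge0 xA, hld_ge0 hB).
have mxh : measurable_fun [set: T] (fun s : T => x s + h s) by exact: measurable_funD.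
have mD : measurable (@unit_square R) by apply: measurableX.
have i1 := density_integrable mxh (hldD xA hB).
have i2 := density_integrable mx xA.
have [i3 _] := pairing_region mx mh xA hB.
rewrite /sobI /pairing -RintegralB// -RintegralB//; last first.
  by have := integrableB mD i1 i2.
apply: (unit_square_region r1 _ _ _).2.
- by rewrite !mulr_ge0 ?(ltW P0) ?(ltW P10) ?powR_ge0 ?exprn_ge0.
- apply: measurable_funB; last by apply: measurable_rho_mul => //; exact: measurable_incr.
  by apply: measurable_funB; exact: measurable_density.
- by move=> [u v]; rewrite unit_squareE => /andP[]; exact: remainder_bound.
Qed.

Lemma pairing_lin x h h' k k' A B B' : measurable_fun [set: T] (x : T -> R) ->
  measurable_fun [set: T] (h : T -> R) -> measurable_fun [set: T] (h' : T -> R) ->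
  hld be A x -> hld be B h -> hld be B' h' ->
  pairing x (fun s => k * h s + k' * h' s) = k * pairing x h + k' * pairing x h'.
Proof.
move=> mx mh mh' xA hB hB'.
have mD : measurable (@unit_square R) by apply: measurableX.
have [i1 _] := pairing_region mx mh xA hB.
have [i2 _] := pairing_region mx mh' xA hB'.
rewrite /pairing -!RintegralZl// -RintegralD//.
- by apply: eq_Rintegral => z _; ring.
- exact: (integrableZl mD k i1).
- exact: (integrableZl mD k' i2).
Qed.

Lemma sobI_ge0 x : 0 <= sobI x.
Proof. by apply: Rintegral_ge0 => z _; rewrite divr_ge0 ?powR_ge0. Qed.

(** A zero of the functional is a minimum, so the derivative vanishes there. *)
Lemma pairing_at_zero A B x h : measurable_fun [set: T] (x : T -> R) ->
  measurable_fun [set: T] (h : T -> R) -> hld be A x -> hld be B h ->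
  sobI x = 0 -> pairing x h = 0.
Proof.
move=> mx mh xA hB x0; have [A0 B0] := (hld_ge0 xA, hld_ge0 hB).
have p22 : 0 <= 2 * p - 2 by have := p1; lra.
have K0 : 0 <= 2 / (2 * p * (be - gam) - 2 + 1).
  by rewrite divr_ge0//; have := pbe; lra.
pose C := 2 * p * (2 * p - 1) * (A + B) `^ (2 * p - 2) * B ^+ 2 *
    (2 / (2 * p * (be - gam) - 2 + 1)).
have key (l : R) : `|l| <= 1 -> 0 <= l * pairing x h + C * `|l| ^+ 2.
  move=> l1.
  have lB : hld be (`|l| * B) (fun s => l * h s) by exact: hldZ.
  have mlh : measurable_fun [set: T] (fun s : T => l * h s) by exact: measurable_funM.
  have plh : pairing x (fun s => l * h s) = l * pairing x h.
    rewrite -[RHS]addr0 -(mul0r (pairing x h)) -(pairing_lin _ _ mx mh mh xA hB hB).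
    by rewrite /pairing; apply: eq_Rintegral => z _; ring.
  have := sobI_taylor mx mlh xA lB; rewrite x0 subr0 plh ler_norml => /andP[_ hi].
  have := sobI_ge0 (fun s => x s + l * h s).
  set X := 2 * p * _ * _ * _ * _ in hi.
  have XC : X <= C * `|l| ^+ 2.
    have lel : (A + `|l| * B) `^ (2 * p - 2) <= (A + B) `^ (2 * p - 2).
      by rewrite powR_le_base ?lerD2l ?ler_piMl// addr_ge0// mulr_ge0.
    pose c0 := 2 * p * (2 * p - 1) * (`|l| * B) ^+ 2 * (2 / (2 * p * (be - gam) - 2 + 1)).
    have -> : X = c0 * (A + `|l| * B) `^ (2 * p - 2) by rewrite /X /c0; ring.
    have -> : C * `|l| ^+ 2 = c0 * (A + B) `^ (2 * p - 2) by rewrite /C /c0; ring.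
    by rewrite ler_wpM2l// /c0 mulr_ge0// mulr_ge0 ?exprn_ge0 ?mulr_ge0// ltW.
  move=> N0; apply: (le_trans N0); rewrite -lerBlDl; exact: le_trans hi XC.
apply/eqP; rewrite -normr_le0; apply: (@geometric_le0 _ _ C 2^-1) => [||n].
- lra.
- lra.
have h0 : (0 : R) <= 2^-1 ^+ n by rewrite exprn_ge0.
have h0' : (0 : R) < 2^-1 ^+ n by rewrite exprn_gt0.
have h1 : 2^-1 ^+ n <= 1 :> R by rewrite exprn_ile1//; lra.
have := key (2^-1 ^+ n); have := key (- 2^-1 ^+ n).
rewrite normrN (ger0_norm h0) => /(_ h1) k1 /(_ h1) k2.
rewrite -(ler_pM2l h0') -[X in X * `|_|](ger0_norm h0) -normrM ler_norml.
rewrite mulNr in k1; rewrite expr2 in k1 k2.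
by apply/andP; split; [move: k2|move: k1]; set y := _ * pairing x h; lra.
Qed.

Lemma sobolev_normE A x : measurable_fun [set: T] (x : T -> R) -> hld be A x ->
  (sobolev_norm gam p x < +oo)%E /\ sobolev_pow gam p x = sobI x.
Proof.
move=> mx xA.
have mD : measurable (@unit_square R) by apply: measurableX.
have int_ := density_integrable mx xA.
have E : (\int[@lebesgue_measure R]_(zeta in `[0%R, 1%R])
    \int[@lebesgue_measure R]_(eta in `[0%R, 1%R])
     (`|x zeta - x eta| `^ (2 * p) / `|zeta - eta| `^ (2 * p * gam + 2))%:E =
    (sobI x)%:E)%E.
  rewrite fineK; last exact: integrable_fin_num.
  rewrite /unit_square /mu2 tonelli_rect1//.
  - by apply/measurable_EFinP; exact: measurable_density.
  - by move=> z; rewrite lee_fin divr_ge0 ?powR_ge0.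
rewrite /sobolev_pow /sobolev_norm E poweR_EFin ltry; split=> //=.
by rewrite -powRrM mulVf ?gt_eqF// powRr1// sobI_ge0.
Qed.

End sobolev_functional.

(** * Antisymmetric kernels integrated over separated pairs *)

Section antisymmetric_kernel.
Context {R : realType}.
Local Notation T := (measurableTypeR R).
Local Notation mu := (@lebesgue_measure R).
Variables (k : R -> R -> R) (C dl : R).
Hypotheses (dl0 : 0 < dl) (dl1 : dl < 1) (C0 : 0 <= C).
Hypothesis mk : measurable_fun [set: T * T] (fun z : T * T => k z.1 z.2).
Hypothesis kC : forall u v, k u v = - k v u.
Hypothesis kB : forall u v, 0 <= u <= 1 -> 0 <= v <= 1 -> `|k u v| <= C * gap (dl - 2) u v.
Implicit Types (f h : R -> R) (s t u v B : R).

Let mD : measurable (@unit_square R). Proof. by apply: measurableX. Qed.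

(** With the density [rho] for [k] this is $\mu_s$. *)
Definition crossing s : R := \int[mu]_(eta in `[0, s]) \int[mu]_(zeta in `[s, 1]) k zeta eta.

Definition heaviside s u : R := (s < u)%R%:R.

Definition pair_with f (z : T * T) : R := k z.1 z.2 * (f z.1 - f z.2).

Lemma diff_unit (a b : R) : -1 <= a <= 0 -> -1 <= b <= 0 -> `|a - b| <= 1.
Proof. by rewrite ler_norml => /andP[? ?] /andP[? ?]; apply/andP; split; lra. Qed.

Lemma measurable_heaviside s : measurable_fun [set: T] (heaviside s : T -> R).
Proof.
rewrite (_ : heaviside s = \1_(`]s, +oo[%classic : set T)).
  by apply: measurable_indic; exact: measurable_itv.
by apply/funext => u; rewrite /heaviside indicE mem_setE in_itv/= andbT.
Qed.

Lemma measurable_pair_with f : measurable_fun [set: T] (f : T -> R) ->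
  measurable_fun [set: T * T] (pair_with f).
Proof. by move=> mf; apply: measurable_funM => //; exact: measurable_incr. Qed.

Lemma measurable_slice v : measurable_fun [set: T] (fun u : T => k u v : R).
Proof.
have m1 : measurable_fun [set: T] (fun u : T => (u, v) : T * T).
  by apply/measurable_fun_pairP; split; [exact: measurable_id|exact: measurable_cst].
exact: (measurableT_comp mk m1).
Qed.

Lemma heaviside_integrable s : 0 <= s <= 1 ->
  mu2.-integrable unit_square (EFin \o pair_with (heaviside s)).
Proof.
move=> /andP[s0 s1].
have mG := measurable_pair_with (measurable_heaviside s).
have zz : -1 < (0 : R) by rewrite oppr_lt0.
apply: (frame_region zz dl0 dl1 (lexx 0) C0 s0 s1 (lexx 1) mG _ _ _).1.
- move=> x y /andP[sx _] /andP[sy _].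
  by rewrite /pair_with/= /heaviside sx sy subrr mulr0 normr0 mul0r.
- move=> x y x01 y01; rewrite /pair_with/= normrM.
  apply: le_trans (kB x01 y01); rewrite ler_piMr// /heaviside.
  by case: (s < x); case: (s < y); rewrite ?subrr ?subr0 ?sub0r ?normrN ?normr1 ?normr0.
- move=> x y /andP[_ x1] /andP[_ y1]; rewrite x1 y1 !andbT -!ltNge => xs ys.
  by rewrite /pair_with/= /heaviside !ltNge (ltW xs) (ltW ys) subrr mulr0.
Qed.

(** Differences of Heaviside functions select the pairs separated by [s]; by
    antisymmetry both orders contribute equally. *)
Lemma crossingE s : 0 <= s <= 1 ->
  2 * crossing s = \int[mu2]_(z in unit_square) pair_with (heaviside s) z.
Proof.
move=> s01; have intH := heaviside_integrable s01; have /andP[s0 s1] := s01.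
pose L : set T := `[0%R, s]%classic; pose U : set T := `]s, 1%R]%classic.
have mL : measurable L by exact: measurable_itv.
have mU : measurable U by exact: measurable_itv.
have mUL : measurable (U `*` L) by exact: measurableX.
have mLU : measurable (L `*` U) by exact: measurableX.
have LE (u : R) : L u = (0 <= u <= s) :> Prop by rewrite /L/= in_itv.
have UE (u : R) : U u = (s < u <= 1) :> Prop by rewrite /U/= in_itv.
have disj : [disjoint (U `*` L) & (L `*` U)].
  apply/disj_setPS => -[x y] /= [[]]; rewrite UE => /andP[sx _] _ [].
  by rewrite LE => /andP[_ xs]; move: (lt_le_trans sx xs); rewrite ltxx.
have sub : (U `*` L) `|` (L `*` U) `<=` @unit_square R.
  move=> [x y] /= [] []; rewrite LE UE unit_squareE.
    by move=> /andP[sx ->] /andP[-> ys]; rewrite (le_trans s0 (ltW sx)) (le_trans ys s1).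
  by move=> /andP[-> xs] /andP[sy ->]; rewrite (le_trans s0 (ltW sy)) (le_trans xs s1).
have mS := measurableU _ _ mUL mLU.
pose rest := @unit_square R `\` ((U `*` L) `|` (L `*` U)).
have mrest : measurable rest by exact: measurableD.
have DE : @unit_square R = ((U `*` L) `|` (L `*` U)) `|` rest.
  by rewrite /rest setDUK.
have drest : [disjoint ((U `*` L) `|` (L `*` U)) & rest].
  by apply/disj_setPS => z [? []].
have intS : mu2.-integrable ((U `*` L) `|` (L `*` U)) (EFin \o pair_with (heaviside s)).
  exact: (integrableS (mu := mu2) mD mS sub intH).
have int1 : mu2.-integrable (U `*` L) (EFin \o pair_with (heaviside s)).
  by apply: (integrableS (mu := mu2) mS mUL _ intS) => z; left.
have int2 : mu2.-integrable (L `*` U) (EFin \o pair_with (heaviside s)).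
  by apply: (integrableS (mu := mu2) mS mLU _ intS) => z; right.
rewrite DE Rintegral_setU// -?DE//.
rewrite [X in _ + X](_ : _ = 0) ?addr0; last first.
  rewrite /Rintegral integral0_eq// => -[x y] [].
  rewrite unit_squareE => /andP[/andP[x0 x1] /andP[y0 y1]] nS.
  rewrite /pair_with/= /heaviside.
  have [sx|xs] := ltP s x; have [sy|ys] := ltP s y; rewrite ?subrr ?mulr0//.
    by exfalso; apply: nS; left; split=> /=; rewrite ?UE ?LE ?sx ?x1 ?y0 ?ys.
  by exfalso; apply: nS; right; split=> /=; rewrite ?UE ?LE ?sy ?y1 ?x0 ?xs.
rewrite Rintegral_setU//.
have slice v : \int[mu]_(u in `[s, 1]) k u v = \int[mu]_(u in `]s, 1]) k u v.
  rewrite /Rintegral integral_itv_obnd_cbnd//.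
  by apply/measurable_EFinP; apply: measurable_funTS; exact: measurable_slice.
have e1 : \int[mu2]_(z in U `*` L) pair_with (heaviside s) z = crossing s.
  rewrite (Rintegral_rect2 mU mL int1) /crossing; apply: eq_Rintegral => v.
  rewrite inE LE => /andP[_ vs]; rewrite slice.
  apply: eq_Rintegral => u; rewrite inE UE => /andP[su _].
  by rewrite /pair_with/= /heaviside su ltNge vs subr0 mulr1.
have e2 : \int[mu2]_(z in L `*` U) pair_with (heaviside s) z = crossing s.
  rewrite (Rintegral_rect1 mL mU int2) /crossing; apply: eq_Rintegral => v.
  rewrite inE LE => /andP[_ vs]; rewrite slice.
  apply: eq_Rintegral => u; rewrite inE UE => /andP[su _].
  by rewrite /pair_with/= /heaviside su ltNge vs sub0r mulrN1 kC opprK.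
by rewrite e1 e2; ring.
Qed.

(** Moving the level from [s] to [t] changes the Heaviside function between [s] and [t]
    only, hence the integrand only on the frame of [[s, t]]. *)
Lemma crossing_hld : hld dl (C * (8 / dl / (1 - dl))) crossing.
Proof.
move=> s t s0 st t1.
have s01 : 0 <= s <= 1 by rewrite s0 (le_trans st).
have t01 : 0 <= t <= 1 by rewrite t1 (le_trans s0).
have is_ := heaviside_integrable s01; have it_ := heaviside_integrable t01.
pose f u := heaviside t u - heaviside s u.
have mf : measurable_fun [set: T] (f : T -> R).
  by apply: measurable_funB; exact: measurable_heaviside.
have fout (u : R) : ~~ (s <= u <= t) -> f u = 0.
  rewrite negb_and -!ltNge => /orP[us|tu]; rewrite /f /heaviside.
    by rewrite !ltNge (ltW us) (le_trans (ltW us) st) subrr.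
  by rewrite tu (le_lt_trans st tu) subrr.
have E : 2 * (crossing t - crossing s) = \int[mu2]_(z in unit_square) pair_with f z.
  have bE := RintegralB (mu := mu2) mD it_ is_.
  rewrite mulrBr; apply: etrans (congr2 (fun a b => a - b) (crossingE t01) (crossingE s01)) _.
  apply: etrans (esym bE) _.
  by apply: eq_Rintegral => z _; rewrite /pair_with /f; ring.
have fb u v : `|f u - f v| <= 1.
  have f01 w : - 1 <= f w <= 0.
    rewrite /f /heaviside; have [tw|wt] := ltP t w.
      by rewrite (le_lt_trans st tw) subrr lexx lerN10.
    by rewrite sub0r lerN2 lern1 leq_b1 oppr_le0 ler0n.
  exact: diff_unit (f01 u) (f01 v).
have zz : -1 < (0 : R) by rewrite oppr_lt0.
have [] := @frame_region _ (pair_with f) 0 dl 0 C s t zz dl0 dl1 (lexx 0) C0 s0 st t1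
  (measurable_pair_with mf) _ _ _.
- move=> x y /andP[sx xt] /andP[sy yt]; rewrite /pair_with/= /f /heaviside.
  by rewrite sx sy !ltNge (ltW xt) (ltW yt) subrr mulr0 normr0 mul0r.
- move=> x y x01 y01; rewrite /pair_with/= normrM.
  by apply: le_trans (kB x01 y01); rewrite ler_piMr.
- by move=> x y _ _ /fout fx /fout fy; rewrite /pair_with/= fx fy subrr mulr0.
move=> _; rewrite -E !mul0r add0r normrM (ger0_norm (ler0n _ 2)).
by apply: le_trans; rewrite ler_peMl// ler1n.
Qed.

Section primitive.
Variables (h : R -> R) (b1 B : R).
Hypotheses (b10 : 0 < b1) (dlb : 1 < dl + b1).
Hypotheses (mh : measurable_fun [set: T] (h : T -> R)) (hB : hld b1 B h).

Let B0 : 0 <= B. Proof. exact: hld_ge0 hB. Qed.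

Definition stopped t u : R := h (Num.min u t).

Lemma measurable_stopped t : measurable_fun [set: T] (stopped t : T -> R).
Proof. by apply: (measurableT_comp mh); exact: measurable_minr. Qed.

Lemma kernel_increment u v (y : R) : 0 <= u <= 1 -> 0 <= v <= 1 ->
  `|y| <= B * `|u - v| `^ b1 -> `|k u v * y| <= C * B * gap (dl - 2 + b1) u v.
Proof.
move=> u01 v01 yB; have [uv|uv] := eqVneq u v.
  have -> : k u v = 0 by have := kC u v; rewrite uv; lra.
  by rewrite mul0r normr0 !mulr_ge0// gap_ge0.
have uv0 : `|u - v| != 0 by rewrite normr_eq0 subr_eq0.
rewrite normrM /gap powRD ?uv0 ?implybT// mulrACA ler_pM//.
exact: kB.
Qed.

Lemma stopped_integrable t : 0 <= t <= 1 ->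
  mu2.-integrable unit_square (EFin \o pair_with (stopped t)).
Proof.
move=> /andP[t0 t1]; have r1 : -1 < dl - 2 + b1 by have := dlb; lra.
apply: (unit_square_region r1 (mulr_ge0 C0 B0)
  (measurable_pair_with (measurable_stopped t)) _).1.
move=> [u v]; rewrite unit_squareE => /andP[u01 v01].
apply: kernel_increment => //.
have m01 w : 0 <= w <= 1 -> 0 <= Num.min w t <= 1.
  by move=> /andP[w0 w1]; rewrite le_min w0 t0 ge_min w1.
apply: (le_trans (hld_norm hB (m01 _ v01) (m01 _ u01))).
rewrite ler_wpM2l// powR_le_base ?(ltW b10)//.
have minE w : Num.min w t = clamp 0 t w \/ w < 0.
  have [w0|w0] := ltP w 0; first by right.
  by left; rewrite /clamp (max_idPr _)// le_min w0.
have [vu|/ltW uv] := leP v u.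
  have := clamp_lip t0 vu.
  case: (minE u) => [->|]; last by case/andP: u01 => ? ? ?; lra.
  case: (minE v) => [->|]; last by case/andP: v01 => ? ? ?; lra.
  by move=> /andP[p q]; rewrite (ger0_norm p) (le_trans q)// ler_norm.
have := clamp_lip t0 uv; rewrite distrC (distrC u).
case: (minE u) => [->|]; last by case/andP: u01 => ? ? ?; lra.
case: (minE v) => [->|]; last by case/andP: v01 => ? ? ?; lra.
by move=> /andP[p q]; rewrite (ger0_norm p) (le_trans q)// ler_norm.
Qed.

Definition stopped_pairing t : R :=
  2^-1 * \int[mu2]_(z in unit_square) pair_with (stopped t) z.

(** Stopping [h] at [t] and at [s] and replacing the increment on [[s, t]] by a jump
    at [s] costs a superlinear error: the singularity of the kernel is only met by
    pairs close to [[s, t]]. *)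
Lemma crossing_prim : prim crossing h stopped_pairing.
Proof.
pose K := C * B * (2 / (dl - 2 + b1 + 1)) + C * (2 * B) * (8 / dl / (1 - dl)).
exists K, (dl + b1); split=> // s t s0 st t1.
have s01 : 0 <= s <= 1 by rewrite s0 (le_trans st).
have t01 : 0 <= t <= 1 by rewrite t1 (le_trans s0).
pose f u := stopped t u - stopped s u - (h t - h s) * heaviside s u.
have is_ := stopped_integrable s01; have it_ := stopped_integrable t01.
have iH := heaviside_integrable s01.
have iH' := integrableZl mD (h t - h s) iH.
have iB := integrableB mD it_ is_.
have E : stopped_pairing t - stopped_pairing s - crossing s * (h t - h s) =
    2^-1 * \int[mu2]_(z in unit_square) pair_with f z.
  have -> : \int[mu2]_(z in unit_square) pair_with f z =
      \int[mu2]_(z in unit_square) pair_with (stopped t) z -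
      \int[mu2]_(z in unit_square) pair_with (stopped s) z -
      (h t - h s) * \int[mu2]_(z in unit_square) pair_with (heaviside s) z.
    rewrite -(RintegralZl (mu := mu2) _ mD iH) -(RintegralB (mu := mu2) mD it_ is_).
    rewrite -(RintegralB (mu := mu2) mD iB iH').
    by apply: eq_Rintegral => z _; rewrite /pair_with /f; ring.
  by rewrite -crossingE// /stopped_pairing; field.
have mf : measurable_fun [set: T] (f : T -> R).
  apply: measurable_funB; first by apply: measurable_funB; exact: measurable_stopped.
  by apply: measurable_funM => //; exact: measurable_heaviside.
have fin u : s < u < t -> f u = h u - h t.
  move=> /andP[su ut]; rewrite /f /stopped /heaviside su (min_idPl (ltW ut)).
  by rewrite (min_idPr (ltW su)) /= mulr1; ring.
have fout u : ~~ (s < u < t) -> f u = 0.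
  rewrite negb_and -!leNgt /f /stopped /heaviside => /orP[us|tu].
    by rewrite (min_idPl us) (min_idPl (le_trans us st)) ltNge us /= mulr0 !subrr.
  rewrite (min_idPr tu) (min_idPr (le_trans st tu)).
  move: st; rewrite le_eqVlt => /predU1P[->|st']; first by ring.
  by rewrite (lt_le_trans st' tu) /= mulr1 subrr.
have ts0 : 0 <= (t - s) `^ b1 by exact: powR_ge0.
have fB u : `|f u| <= B * (t - s) `^ b1.
  have [/andP[su ut]|out] := boolP (s < u < t); last first.
    by rewrite fout// normr0 mulr_ge0.
  rewrite fin ?su// distrC; apply: (le_trans (hB _ (ltW ut) t1)).
    by rewrite (le_trans s0)// ltW.
  by rewrite ler_wpM2l// powR_le_base ?(ltW b10) ?subr_ge0 ?(ltW ut)// lerD2l lerN2 ltW.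
have r1 : -1 < dl - 2 + b1 by have := dlb; lra.
have [] := @frame_region _ (pair_with f) (dl - 2 + b1) dl (C * B)
  (C * (2 * B * (t - s) `^ b1)) s t r1 dl0 dl1 (mulr_ge0 C0 B0) _ s0 st t1
  (measurable_pair_with mf) _ _ _.
- by rewrite !mulr_ge0.
- move=> x y xin yin; apply: kernel_increment.
  + by case/andP: xin => sx xt; rewrite (le_trans s0 (ltW sx)) (le_trans (ltW xt)).
  + by case/andP: yin => sy yt; rewrite (le_trans s0 (ltW sy)) (le_trans (ltW yt)).
  + rewrite /= !fin// (_ : _ - _ = h x - h y); last by ring.
    apply: (hld_norm hB).
      by case/andP: yin => sy yt; rewrite (le_trans s0 (ltW sy)) (le_trans (ltW yt)).
    by case/andP: xin => sx xt; rewrite (le_trans s0 (ltW sx)) (le_trans (ltW xt)).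
- move=> x y x01 y01; rewrite /pair_with/= normrM mulrAC ler_pM//; first exact: kB.
  apply: (le_trans (ler_normB _ _)).
  by have := fB x; have := fB y; lra.
- move=> x y _ _ nx ny; rewrite /pair_with/= !fout ?subrr ?mulr0//.
    by apply: contra ny => /andP[? ?]; rewrite !ltW.
  by apply: contra nx => /andP[? ?]; rewrite !ltW.
move=> _ bnd; rewrite E normrM ger0_norm ?invr_ge0//.
have tE : (t - s) `^ (dl - 2 + b1 + 2) = (t - s) `^ (dl + b1).
  by congr (_ `^ _); ring.
have tM : (t - s) `^ (dl + b1) = (t - s) `^ dl * (t - s) `^ b1.
  by apply: powR_mulD; rewrite ?subr_ge0.
rewrite ler_pdivrMl//; apply: (le_trans bnd).
rewrite tE [X in _ + X](_ : _ = C * (2 * B) * (8 / dl / (1 - dl)) * (t - s) `^ (dl + b1)); last first.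
  by rewrite tM; ring.
rewrite -mulrDl -/K.
have K0 : 0 <= K.
  by rewrite addr_ge0// !mulr_ge0// ?invr_ge0 ?subr_ge0 ?(ltW dl1) ?(ltW dl0)//;
    have := r1; lra.
by rewrite mulrA ler_wpM2r ?powR_ge0// ler_peMl// ler1n.
Qed.

End primitive.

End antisymmetric_kernel.

Section crossing_kernel_of_density.
Context {R : realType}.
Local Notation T := (measurableTypeR R).
Implicit Types (h : R -> R) (u v : R).
Variables (gam p be kap : R) (x : hoelderType be).
Hypotheses (p1 : 1 <= p) (gam0 : 0 < gam) (kap01 : 0 < kap < 1) (kg : 1 < gam + kap).
Hypotheses (gb : gam < be) (pbe : 1 < 2 * p * (be - gam)).

Let be0 : 0 < be. Proof. by have := gam0; have := gb; lra. Qed.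
Let k := rho gam p x.

Lemma pair_with_pairing h : pairing gam p x h =
  \int[mu2]_(z in unit_square) pair_with k h z.
Proof. by []. Qed.

Lemma gap_le u v a b : u != v -> 0 <= u <= 1 -> 0 <= v <= 1 -> b <= a ->
  gap a u v <= gap b u v.
Proof.
move=> uv /andP[u0 u1] /andP[v0 v1] ba; rewrite /gap -[a](subrK b).
have uv0 : `|u - v| != 0 by rewrite normr_eq0 subr_eq0.
rewrite powRD ?uv0 ?implybT// ler_piMl ?powR_ge0//.
have <- : (1 : R) `^ (a - b) = 1 by rewrite powR1.
apply: powR_le_base; rewrite ?subr_ge0//.
by rewrite ler_norml; apply/andP; split; lra.
Qed.

(** Above the regularity [1] paths are constant, so that the exponent of the
    integrator never has to exceed [1]; the kernel gains over the distance to the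
    power [-2] whatever regularity is left. *)
Lemma density_kernel_bound : exists dl b1 C, [/\ 0 < dl <= kap, 0 < b1, 1 < dl + b1,
  0 <= C & (forall u v, 0 <= u <= 1 -> 0 <= v <= 1 -> `|k u v| <= C * gap (dl - 2) u v) /\
  forall h, hold be h -> hold b1 h].
Proof.
have /andP[kap0 kap1] := kap01.
have xA := hoelder_hld x.
have k0 u : k u u = 0 by have := rhoC gam p x u u; rewrite -/k; lra.
have [be1|be1] := leP be 1.
  pose e := 2 * p * (be - gam) - be.
  have ebe : 1 < e + be by rewrite /e; have := pbe; lra.
  exists (Num.min kap e), be, (2 * p * `|x| `^ (2 * p - 1)); split.
  - by rewrite lt_min kap0 ge_min lexx andbT; have := ebe; have := be1; lra.
  - exact: be0.
  - by rewrite addr_minl lt_min ebe andbT; have := kg; have := gb; lra.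
  - by rewrite !mulr_ge0 ?powR_ge0//; have := p1; lra.
  split=> // u v u01 v01; have [->|uv] := eqVneq u v.
    by rewrite k0 normr0 !mulr_ge0 ?gap_ge0 ?powR_ge0//; have := p1; lra.
  apply: (le_trans (rho_bound p1 gam0 xA u01 v01)).
  rewrite ler_wpM2l//; first by rewrite !mulr_ge0 ?powR_ge0//; have := p1; lra.
  apply: gap_le => //; rewrite (_ : be * _ - _ = e - 2); last by rewrite /e; ring.
  by rewrite lerD2r ge_min lexx orbT.
have cst h : hold be h -> forall u v, 0 <= u <= 1 -> 0 <= v <= 1 -> h u = h v.
  move=> [c hc] u v /andP[u0 u1] /andP[v0 v1].
  have [uv|/ltW vu] := leP u v; last exact: (superlinear_cst be1 hc).
  by apply/esym; exact: (superlinear_cst be1 hc).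
exists kap, 1, 0; split=> //; [by rewrite kap0 lexx|by rewrite ltrDr|].
split=> [u v u01 v01|h [c hc]].
  rewrite mul0r /k rhoE (cst _ (hoelder_hold x) u v)// subrr /spow sgr0 !mul0r mulr0.
  by rewrite normr0.
exists 0 => s t s0 st t1; rewrite mul0r.
by rewrite (superlinear_cst be1 hc s0 st t1) subrr normr0.
Qed.

(** The directional derivative of the Sobolev functional is an integral against the
    crossing kernel: [h(zeta) - h(eta)] is the integral of [dh] over the levels which
    separate [eta] from [zeta]. *)
Lemma mu_kernel_young : exists dl b1, [/\ 0 < dl <= kap, 0 < b1, 1 < dl + b1,
  hold dl (mu_kernel gam p x) & forall h : hoelderType be, hold b1 h /\
  exists2 I, prim (mu_kernel gam p x) h I & I 1 - I 0 = 2^-1 * pairing gam p x h].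
Proof.
have [dl [b1 [C [/andP[dl0 dlk] b10 dlb C0 [kB hb]]]]] := density_kernel_bound.
have dl1 : dl < 1 by case/andP: kap01 => _; exact: le_lt_trans.
have mk := @measurable_rho _ gam p p1 x (hoelder_measurable x).
have kC := rhoC gam p x.
exists dl, b1; split=> //; first by rewrite dl0.
  exists (C * (8 / dl / (1 - dl))).
  exact: (crossing_hld dl0 dl1 C0 mk kC kB).
move=> h; split; first by apply: hb; exact: hoelder_hold.
have [B hB] := hb _ (hoelder_hold h).
have mh := hoelder_measurable h.
exists (stopped_pairing k h).
  exact: (crossing_prim dl0 dl1 C0 mk kC kB b10 dlb mh hB).
rewrite /stopped_pairing -mulrBr; congr (_ * _); rewrite pair_with_pairing.
rewrite [X in _ - X](_ : _ = 0) ?subr0; last first.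
  rewrite /Rintegral integral0_eq// => -[u v]; rewrite unit_squareE.
  by move=> /andP[/andP[u0 _] /andP[v0 _]]; rewrite /pair_with /stopped/=
    (min_idPr u0) (min_idPr v0) subrr mulr0.
apply: eq_Rintegral => -[u v]; rewrite inE unit_squareE.
by move=> /andP[/andP[_ u1] /andP[_ v1]]; rewrite /pair_with /stopped/=
  (min_idPl u1) (min_idPl v1).
Qed.

End crossing_kernel_of_density.

(** * Differentiability of the cutoff *)

Section cutoff_derivative.
Context {R : realType}.

Lemma derivable_expansion (f : R -> R) (r e : R) : derivable f r 1 -> 0 < e ->
  exists2 dl, 0 < dl & forall s, `|s| <= dl ->
    `|f (r + s) - f r - f^`()%classic r * s| <= e * `|s|.
Proof.
move=> df e0.
have c : (fun s => s^-1 *: (f (s + r) - f r)) @ 0^' --> f^`()%classic r.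
  have -> : (fun s : R => s^-1 *: (f (s + r) - f r)) =
      (fun s => s^-1 *: ((f \o shift r) (s *: (1 : R)) - f r)).
    by apply/funext => s; rewrite /= /GRing.scale/= mulr1.
  by rewrite derive1E; exact: df.
move/cvgrPdist_le : c => /(_ _ e0); rewrite near_withinE => -[dl /= dl0 near0].
exists (dl / 2) => [|s sdl]; first by rewrite divr_gt0.
have [->|s0] := eqVneq s 0; first by rewrite addr0 mulr0 !subrr normr0 mulr0.
have := near0 s; rewrite /= sub0r normrN => /(_ _ s0) H.
have {}H : `|f^`()%classic r - s^-1 * (f (s + r) - f r)| <= e.
  by apply: H; rewrite (le_lt_trans sdl)// gtr_pMr// invf_lt1// ltr1n.
rewrite (_ : _ - _ = - (s * (f^`()%classic r - s^-1 * (f (s + r) - f r)))).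
  by rewrite normrN normrM mulrC ler_wpM2r.
by rewrite [s + r]addrC; field.
Qed.

Variables (gam p be M : R) (phi : R -> R).
Hypotheses (p1 : 1 <= p) (gam0 : 0 < gam) (be0 : 0 < be).
Hypotheses (pbe : 1 < 2 * p * (be - gam)) (M0 : 0 < M) (cut : is_cutoff M phi).
Implicit Types x h : hoelderType be.

Lemma pairing_bound x : exists2 C, 0 <= C &
  forall h, `|pairing gam p x h| <= C * `|h|.
Proof.
exists (2 * p * `|x| `^ (2 * p - 1) * (2 / (2 * p * (be - gam) - 2 + 1))).
  have := p1; have := pbe => ? ?.
  by rewrite !mulr_ge0 ?powR_ge0 ?invr_ge0//; lra.
move=> h.
have [_] := pairing_region p1 gam0 be0 pbe (hoelder_measurable x) (hoelder_measurable h)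
  (hoelder_hld x) (hoelder_hld h).
by rewrite mulrAC.
Qed.

Lemma sobI_expansion x : exists2 C, 0 <= C & forall h, `|h| <= 1 ->
  `|sobI gam p (x + h) - sobI gam p x - pairing gam p x h| <= C * `|h| ^+ 2.
Proof.
have := p1; have := pbe => ? ?.
exists (2 * p * (2 * p - 1) * (`|x| + 1) `^ (2 * p - 2) *
   (2 / (2 * p * (be - gam) - 2 + 1))).
  by rewrite !mulr_ge0 ?powR_ge0 ?invr_ge0//; lra.
move=> h h1.
apply: (le_trans (sobI_taylor p1 gam0 be0 pbe (hoelder_measurable x)
  (hoelder_measurable h) (hoelder_hld x) (hoelder_hld h))).
rewrite mulrAC ler_wpM2r ?exprn_ge0// ler_wpM2r ?mulr_ge0 ?invr_ge0//; first lra.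
rewrite ler_wpM2l ?mulr_ge0//; try lra.
apply: powR_le_base; [lra|by rewrite addr_ge0|by rewrite lerD2l].
Qed.

Lemma cutoff_bounded : exists2 B, 0 <= B & forall r, 0 <= r -> `|phi r| <= B.
Proof.
case: cut => _ /(_ 0%N)[B /= hB] _ h0; exists (`|B| + 1); first by rewrite addr_ge0.
move=> r; rewrite le_eqVlt => /predU1P[<-|/hB rB].
  by rewrite h0 ?lexx ?M0// normr1 lerDr.
by apply: (le_trans rB); apply: (le_trans (ler_norm _)); rewrite lerDl.
Qed.

(** Where the functional vanishes it is minimal, so its derivative vanishes as well,
    and the cutoff is locally constant there; so the expansion holds although [phi] may
    fail to be differentiable at [0]. *)
Lemma cutoff_expansion x e : 0 < e -> exists2 dl, 0 < dl & forall h, `|h| <= dl ->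
  `|phi (sobI gam p (x + h)) - phi (sobI gam p x) -
    phi^`()%classic (sobI gam p x) * pairing gam p x h| <= e * `|h|.
Proof.
move=> e0; have [C C0 hC] := sobI_expansion x; have [D D0 hD] := pairing_bound x.
case: cut => dphi _ _ phi1.
have incr h : `|h| <= 1 -> `|sobI gam p (x + h) - sobI gam p x| <= (C + D) * `|h|.
  move=> h1; rewrite -[X in `|X|](subrK (pairing gam p x h)).
  apply: (le_trans (ler_normD _ _)); rewrite mulrDl lerD//.
  by apply: (le_trans (hC _ h1)); rewrite ler_wpM2l// expr2 ler_piMl.
have := sobI_ge0 gam p x; rewrite le_eqVlt => /predU1P[N0|N0].
  have pair0 h : pairing gam p x h = 0.
    exact: (pairing_at_zero p1 gam0 be0 pbe (hoelder_measurable x)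
      (hoelder_measurable h) (hoelder_hld x) (hoelder_hld h)).
  have CD0 : 0 < C + D + 1 by rewrite ltr_wpDl// addr_ge0.
  exists (Num.min 1 (M / (C + D + 1))) => [|h]; first by rewrite lt_min ltr01 divr_gt0.
  rewrite le_min => /andP[h1 hM]; rewrite pair0 mulr0 subr0 -N0.
  rewrite !phi1 ?subrr ?normr0 ?mulr_ge0 ?(ltW e0) ?lexx//.
  rewrite sobI_ge0/=; have := incr _ h1; rewrite -N0 subr0 ger0_norm ?sobI_ge0//.
  move=> /le_lt_trans; apply.
  have [->|hn0] := eqVneq h 0; first by rewrite normr0 mulr0.
  move: hM; rewrite ler_pdivlMr// => /(lt_le_trans _); apply.
  by rewrite mulrC ltr_pM2l ?normr_gt0// ltrDl.
have dr := dphi 0%N _ N0.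
set r := sobI gam p x in N0 dr *; set Dphi := phi^`()%classic r.
have e1 : 0 < e / (2 * (C + D + 1)) by rewrite divr_gt0// mulr_gt0// ltr_wpDl// addr_ge0.
have [d1 d10 h1] := derivable_expansion dr e1.
have cd : 0 < C + D + 1 by rewrite ltr_wpDl// addr_ge0.
have e2 : 0 < e / (2 * (`|Dphi| * C + 1)).
  by rewrite divr_gt0// mulr_gt0// ltr_wpDl// mulr_ge0.
exists (Num.min 1 (Num.min (d1 / (C + D + 1)) (e / (2 * (`|Dphi| * C + 1))))).
  by rewrite !lt_min ltr01 e2 divr_gt0.
move=> h; rewrite !le_min => /and3P[hle1 hd1 he2].
have I := incr _ hle1; pose s := sobI gam p (x + h) - r.
have sle : `|s| <= (C + D + 1) * `|h| by rewrite (le_trans I)// ler_wpM2r// lerDl.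
have sd1 : `|s| <= d1.
  by apply: (le_trans sle); move: hd1; rewrite ler_pdivlMr// mulrC.
have -> : sobI gam p (x + h) = r + s by rewrite /s; ring.
have -> : phi (r + s) - phi r - Dphi * pairing gam p x h =
  (phi (r + s) - phi r - Dphi * s) + Dphi * (s - pairing gam p x h) by ring.
apply: (le_trans (ler_normD _ _)); rewrite (splitr e) mulrDl lerD//.
  apply: (le_trans (h1 _ sd1)).
  rewrite (_ : e / 2 * `|h| = e / (2 * (C + D + 1)) * ((C + D + 1) * `|h|)).
    by rewrite ler_wpM2l// ltW.
  by field; rewrite gt_eqF.
rewrite normrM; apply: (le_trans (ler_wpM2l (normr_ge0 _) (hC _ hle1))).
rewrite expr2 !mulrA ler_wpM2r//.
move: he2; rewrite ler_pdivlMr; last by rewrite mulr_gt0// ltr_wpDl// mulr_ge0.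
by have := normr_ge0 h; lra.
Qed.

End cutoff_derivative.

(** * Divided differences *)

Section divided_differences.
Context {R : realType}.
Implicit Types (a b u v s t L th : R).

Lemma derivative_bound (g dg : R -> R) L :
  (forall th, is_derive th 1 g (dg th)) ->
  (forall th, 0 <= th <= 1 -> `|dg th| <= L) -> `|g 1 - g 0| <= L.
Proof.
move=> gdg dgL.
have cg : {within `[0, 1], continuous g}.
  apply: continuous_subspaceT => th; apply: differentiable_continuous.
  by apply/derivable1_diffP; have [] := gdg th.
have [th] := MVT_segment ler01 (fun th _ => gdg th) cg.
by rewrite in_itv/= subr0 mulr1 => th01 ->; exact: dgL.
Qed.

Lemma derivative_lip (f f' : R -> R) L : (forall y : R, is_derive y 1 f (f' y)) ->
  (forall y, `|f' y| <= L) -> forall a b, `|f a - f b| <= L * `|a - b|.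
Proof.
move=> ff' fL.
have H a b : a <= b -> `|f b - f a| <= L * `|b - a|.
  move=> ab; have cf : {within `[a, b], continuous f}.
    apply: continuous_subspaceT => y; apply: differentiable_continuous.
    by apply/derivable1_diffP; have [] := ff' y.
  have [y _ ->] := MVT_segment ab (fun y _ => ff' y) cf.
  by rewrite normrM ler_wpM2r.
move=> a b; have [/H|/ltW/H//] := leP a b.
by rewrite distrC (distrC b).
Qed.

Section first_order.
Variables (f f' : R -> R).
Hypothesis ff' : forall y : R, is_derive y 1 f (f' y).

Definition divdiff a b : R := if a == b then f' a else (f b - f a) / (b - a).

Definition segment_path a b th : R :=
  if a == b then th * f' a else f (a + th * (b - a)) / (b - a).

Lemma divdiffE a b : f b - f a = divdiff a b * (b - a).
Proof.
rewrite /divdiff; case: eqP => [->|/eqP ab]; first by rewrite !subrr mulr0.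
by rewrite divfK// subr_eq0 eq_sym.
Qed.

(** The divided difference is the mean of [f'] over the segment; this path has that
    mean as its increment and spares the integral. *)
Lemma segment_path01 a b : segment_path a b 1 - segment_path a b 0 = divdiff a b.
Proof.
rewrite /segment_path /divdiff; case: eqP => [->|_]; first by rewrite mul1r mul0r subr0.
by rewrite mul1r mul0r addr0 [a + _]addrC subrK mulrBl.
Qed.

Lemma segment_path_derive a b th :
  is_derive th 1 (segment_path a b) (f' (a + th * (b - a))).
Proof.
rewrite /segment_path; case: eqP => [->|/eqP ab].
  rewrite subrr mulr0 addr0; apply: is_derive_eq.
  by rewrite /GRing.scale/= mulr1 mulr0 add0r.
have ba0 : b - a != 0 by rewrite subr_eq0 eq_sym.
have d1 : is_derive th 1 (fun th => a + th * (b - a)) (b - a).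
  by apply: is_derive_eq; rewrite /GRing.scale/=; ring.
have d2 := @is_derive1_comp R f (fun th => a + th * (b - a)) th _ _ (ff' _) d1.
have : is_derive th 1 ((b - a)^-1 \*: (f \o (fun th => a + th * (b - a))))
   ((b - a)^-1 *: (f' (a + th * (b - a)) * (b - a))) by exact: is_deriveZ.
rewrite /GRing.scale/= mulrC mulfK//.
set F := (X in is_derive th 1 X _ -> _); set G := (X in _ -> is_derive th 1 X _).
suff -> : F = G by [].
by apply/funext => y; rewrite /F /G/=; exact: mulrC.
Qed.

Variable L : R.
Hypothesis f'L : forall a b, `|f' a - f' b| <= L * `|a - b|.

Let L0 : 0 <= L.
Proof.
have := f'L 1 0; rewrite subr0 normr1 mulr1; exact: le_trans.
Qed.

Lemma divdiff_lip a b a' b' (m : R) : `|a - a'| <= m -> `|b - b'| <= m ->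
  `|divdiff a b - divdiff a' b'| <= L * m.
Proof.
move=> am bm; rewrite -(segment_path01 a b) -(segment_path01 a' b').
set P := segment_path a b; set P' := segment_path a' b'.
rewrite (_ : _ - _ = (P \- P') 1 - (P \- P') 0); last by rewrite /=; ring.
apply: (@derivative_bound _
  (fun th => f' (a + th * (b - a)) - f' (a' + th * (b' - a')))).
  by move=> th; apply: is_deriveB; exact: segment_path_derive.
move=> th /andP[th0 th1]; apply: (le_trans (f'L _ _)); rewrite ler_wpM2l//.
rewrite (_ : _ - _ = (1 - th) * (a - a') + th * (b - b')); last by ring.
apply: (le_trans (ler_normD _ _)); rewrite !normrM.
rewrite (ger0_norm th0) ger0_norm ?subr_ge0//.
have : (1 - th) * `|a - a'| <= (1 - th) * m by rewrite ler_wpM2l// subr_ge0.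
have : th * `|b - b'| <= th * m by rewrite ler_wpM2l.
lra.
Qed.

Lemma divdiff_bound S : (forall y, `|f' y| <= S) -> forall a b, `|divdiff a b| <= S.
Proof.
move=> f'S a b; rewrite -segment_path01.
exact: (@derivative_bound _ (fun th => f' (a + th * (b - a)))
  S (segment_path_derive a b) (fun _ _ => f'S _)).
Qed.

End first_order.

Lemma divdiff_diag f f' a : divdiff f f' a a = f' a.
Proof. by rewrite /divdiff eqxx. Qed.

Section second_order.
Variables (f f1 f2 : R -> R) (L2 L3 : R).
Hypotheses (ff1 : forall y : R, is_derive y 1 f (f1 y)).
Hypotheses (f12 : forall y : R, is_derive y 1 f1 (f2 y)).
Hypotheses (f2L : forall y, `|f2 y| <= L2).
Hypotheses (f2lip : forall a b, `|f2 a - f2 b| <= L3 * `|a - b|).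

Let L20 : 0 <= L2. Proof. exact: le_trans (f2L 0). Qed.
Let L30 : 0 <= L3.
Proof.
have := f2lip 1 0; rewrite subr0 normr1 mulr1; exact: le_trans.
Qed.

(** The increment [f1 (a + u) - f1 a] is Lipschitz in the pair of base point and step,
    and its Lipschitz constant in the base point is proportional to the step. *)
Lemma four_points a u a' v :
  `|f1 (a + u) - f1 a - (f1 (a' + v) - f1 a')| <=
  L2 * `|u - v| + `|v| * (L3 * (`|a - a'| + `|u - v|)).
Proof.
rewrite !(divdiffE f1 f2) ![_ + _ - _]addrAC !subrr !add0r.
rewrite (_ : _ - _ = divdiff f1 f2 a (a + u) * (u - v) +
  v * (divdiff f1 f2 a (a + u) - divdiff f1 f2 a' (a' + v))); last by ring.
apply: (le_trans (ler_normD _ _)); rewrite !normrM lerD//.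
  by rewrite ler_wpM2r// (divdiff_bound f12).
rewrite ler_wpM2l//; apply: (divdiff_lip f12 f2lip); first by rewrite lerDl.
by rewrite opprD addrACA ler_normD.
Qed.

(** The defect is an average of the increments estimated by [four_points]. Applied along
    two paths it bounds a Hölder norm by the distance of the paths, which makes Taylor
    remainders quadratic. *)
Lemma divdiff_defect_lip a u a' v :
  `|divdiff f f1 a (a + u) - f1 a - (divdiff f f1 a' (a' + v) - f1 a')| <=
  L2 * `|u - v| + `|v| * (L3 * (`|a - a'| + `|u - v|)).
Proof.
pose P a u := segment_path f f1 a (a + u) \- segment_path f f1 a a.
have PE b w : divdiff f f1 b (b + w) - f1 b = P b w 1 - P b w 0.
  rewrite -(divdiff_diag f f1 b) -!segment_path01 /P/=.
  by rewrite /P/=; ring.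
have DE : P a u 1 - P a u 0 - (P a' v 1 - P a' v 0) =
    (P a u \- P a' v) 1 - (P a u \- P a' v) 0.
  by move: (P a u) (P a' v) => A B /=; ring.
rewrite !PE DE.
apply: (@derivative_bound _ (fun th =>
  (f1 (a + th * (a + u - a)) - f1 (a + th * (a - a))) -
  (f1 (a' + th * (a' + v - a')) - f1 (a' + th * (a' - a'))))).
  by move=> th; apply: is_deriveB; apply: is_deriveB; exact: segment_path_derive.
have sh (b w : R) : b + w - b = w by ring.
move=> th /andP[th0 th1]; rewrite (sh a u) (sh a' v) !subrr mulr0 !addr0.
apply: (le_trans (four_points _ _ _ _)).
have tu : `|th * u - th * v| <= `|u - v|.
  by rewrite -mulrBr normrM (ger0_norm th0) ler_piMl.
have tv : `|th * v| <= `|v| by rewrite normrM (ger0_norm th0) ler_piMl.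
rewrite lerD// ?ler_wpM2l//.
by rewrite ler_pM// ?mulr_ge0 ?addr_ge0// ler_wpM2l// lerD2l.
Qed.

End second_order.

End divided_differences.

(** * The linear equation in the Hölder space *)

Section hoelder_operators.
Context {R : realType}.
Variables (gam kap be : R).
Hypotheses (kap0 : 0 < kap) (kap1 : kap <= 1) (gam0 : 0 < gam) (kg1 : 1 < kap + gam).
Hypothesis gb : gam <= be.
Implicit Types (x h : hoelderType be) (f g w y b : hoelderType kap) (k t : R).

Lemma hoelder_linE a k (f g : hoelderType a) t : (k *: f + g) t = k * f t + g t.
Proof. by []. Qed.

Lemma control_hld x : hld gam `|x| x.
Proof. exact: hldW gam0 gb (hoelder_hld x). Qed.

Lemma control_hold x : hold gam x. Proof. by exists `|x|; exact: control_hld. Qed.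

Definition mulh f g : hoelderType kap := restr kap (fun t => f t * g t).

Lemma mulhE f g t : 0 <= t <= 1 -> mulh f g t = f t * g t.
Proof. by apply: restrE => //; apply: holdM => //; exact: hoelder_hold. Qed.

Lemma mulh_norm f g : `|mulh f g| <= 3 * `|f| * `|g|.
Proof.
apply: (@le_trans _ _ (`|f| * `|g| + (`|f| * `|g| + `|g| * `|f|))); last by lra.
apply: restr_norm => //.
  by apply: hldM; (exact: hoelder_hld || exact: hoelder_sup).
by move=> t t01; rewrite normrM ler_pM ?hoelder_sup.
Qed.

Definition Loph x f : hoelderType kap := restr kap (Lop x f).

Lemma LophE x f t : 0 <= t <= 1 -> Loph x f t = Lop x f t.
Proof.
apply: restrE => //; apply: (Lop_hold kap0 kap1 gam0 kg1) (control_hold x).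
exact: hoelder_hold.
Qed.

Lemma Loph_bound : exists2 K, 0 <= K & forall x f, `|Loph x f| <= K * `|x| * `|f|.
Proof.
have [K K0 hK] := Lop_bound kap0 kap1 gam0 kg1.
exists (4 * K) => [|x f]; first by rewrite mulr_ge0.
have [h1 h2] := hK x f _ _ _ (hoelder_sup f) (hoelder_hld f) (control_hld x).
apply: (@le_trans _ _ (K * (`|f| + `|f|) * `|x| + K * (`|f| + `|f|) * `|x|)); last lra.
by apply: restr_norm => //; exact: hldW h1.
Qed.

Lemma Loph_linl k x h f : Loph (k *: x + h) f = k *: Loph x f + Loph h f.
Proof.
apply: hoelder_ext => t t01; rewrite hoelder_linE !LophE//.
have := Lop_linx kap0 kap1 gam0 kg1 k 1 (hoelder_hold f) (control_hold x) (control_hold h) t01.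
rewrite mul1r => <-; apply: (eq_Lop kap0 kap1 gam0 kg1) => //.
- exact: hoelder_hold.
- exact: control_hold.
- by move=> s _; rewrite mul1r.
Qed.

Lemma Loph_linr k x f g : Loph x (k *: f + g) = k *: Loph x f + Loph x g.
Proof.
apply: hoelder_ext => t t01; rewrite hoelder_linE !LophE//.
have := Lop_linq kap0 kap1 gam0 kg1 k 1 (hoelder_hold f) (hoelder_hold g) (control_hold x) t01.
rewrite mul1r => <-; apply: (eq_Lop kap0 kap1 gam0 kg1) => //.
- exact: hoelder_hold.
- exact: control_hold.
- by move=> s _; rewrite mul1r.
Qed.

Lemma mulh_linr k b f g : mulh b (k *: f + g) = k *: mulh b f + mulh b g.
Proof.
by apply: hoelder_ext => t t01; rewrite hoelder_linE !mulhE// hoelder_linE; ring.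
Qed.

Lemma mulh_linl k b f g : mulh (k *: f + g) b = k *: mulh f b + mulh g b.
Proof.
by apply: hoelder_ext => t t01; rewrite hoelder_linE !mulhE// hoelder_linE; ring.
Qed.

Lemma LophD x h f : Loph (x + h) f = Loph x f + Loph h f.
Proof. by rewrite -[x in LHS]scale1r Loph_linl scale1r. Qed.

Lemma LophB x f g : Loph x (f - g) = Loph x f - Loph x g.
Proof. by rewrite addrC -scaleN1r Loph_linr scaleN1r addrC. Qed.

Lemma mulhBr b f g : mulh b (f - g) = mulh b f - mulh b g.
Proof. by rewrite addrC -scaleN1r mulh_linr scaleN1r addrC. Qed.

Lemma mulhBl b f g : mulh (f - g) b = mulh f b - mulh g b.
Proof. by rewrite addrC -scaleN1r mulh_linl scaleN1r addrC. Qed.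

Section solver.
Variables (M p c2 : R) (phi : R -> R).
Hypotheses (p1 : 1 <= p) (pbe : 1 < 2 * p * (be - gam)).
Hypothesis lin : linear_constant M gam kap p phi c2.

Definition trunc x : R := cutoff gam p phi x.

(** The sign of the linear equation is absorbed in the coefficient [b], which then is
    the derivative of the nonlinearity. *)
Definition is_solution x b w y := y = w + trunc x *: Loph x (mulh b y).

Lemma is_solutionP x b w y :
  solves_linear gam p phi x (- b) w y <-> is_solution x b w y.
Proof.
have E t : 0 <= t <= 1 -> \young_(xi = 0 to 1) (green t xi * (- b) xi * y xi) d x =
    - Loph x (mulh b y) t.
  move=> t01; rewrite LophE//.
  have hb := hoelder_hold (mulh b y).
  have hx := control_hold x.
  have := Lop_linq kap0 kap1 gam0 kg1 (-1) 0 hb hb hx t01.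
  rewrite mul0r addr0 mulN1r => <-.
  apply: (eq_young kap0 gam0 kg1) => //; last first.
    move=> s s01; rewrite mulhE// (_ : (- b) s = - b s)//; ring.
  apply: holdM => //; last exact: hoelder_hold.
  apply: holdM => //; last exact: hoelder_hold.
  by exists 2; apply: hldW (hld_green t01).
split=> [sol|e t t01].
  by apply: hoelder_ext => t t01; rewrite sol// E//= mulrN opprK.
have -> : y t = (w + trunc x *: Loph x (mulh b y)) t by rewrite -e.
by rewrite E// mulrN opprK.
Qed.

(** The assumption on the linear equation becomes a bounded linear solution operator,
    with the same bound for all controls and all admissible coefficients. *)
Lemma linear_solver : exists2 c, 0 < c & forall x b, `|b| < c2 / (M + 1) ->
  exists S : hoelderType kap -> hoelderType kap,
  [/\ forall w, is_solution x b w (S w),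
      forall w y, is_solution x b w y -> y = S w,
      forall w, `|S w| <= c * `|w| &
      forall k w w', S (k *: w + w') = k *: S w + S w'].
Proof.
case: lin => c c0 H; exists c => // x b bc.
have [x' x'E] : exists x' : hoelderType gam, hoelder_fun x' = x :> (R -> R).
  have [F FE] := hoelder_build gam0 (control_hold x); exists F; apply/funext => t.
  have [t01|t01] := boolP (0 <= t <= 1); first exact: FE.
  have out a (f : hoelderType a) : f t = 0.
    have := hoelderP f; rewrite inE/= => -[<- _]; rewrite patchE.
    by rewrite mem_setE in_itv/= (negbTE t01).
  by rewrite !out.
have be0 : 0 < be by exact: lt_le_trans gam0 gb.
have fin : (sobolev_norm gam p x' < +oo)%E.
  rewrite x'E.
  by have [] := sobolev_normE p1 gam0 pbe (hoelder_measurable x) (hoelder_hld x).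
have bN : `|- b| < c2 / (M + 1) by rewrite normrN.
have {}H w : exists y, [/\ is_solution x b w y,
    forall y', is_solution x b w y' -> y' = y & `|y| <= c * `|w|].
  have [y [y1 y2 y3]] := H x' w (- b) fin bN.
  rewrite x'E in y1 y2; exists y; split=> //; first exact/is_solutionP.
  by move=> y' /is_solutionP; exact: y2.
pose S w := xget 0 [set y | [/\ is_solution x b w y,
    forall y', is_solution x b w y' -> y' = y & `|y| <= c * `|w|]].
have SP w : [/\ is_solution x b w (S w),
    forall y', is_solution x b w y' -> y' = S w & `|S w| <= c * `|w|].
  exact: (xgetPex 0 (H w)).
exists S; split=> [w|w|w|k w w']; try by case: (SP w).
have [s1 _ _] := SP w; have [s2 _ _] := SP w'; have [_ u _] := SP (k *: w + w').
apply/esym/u; rewrite /is_solution mulh_linr Loph_linr {1}s1 {1}s2.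
by rewrite !scalerDr !scalerA [k * _]mulrC addrACA.
Qed.

End solver.
End hoelder_operators.

(** * Differentiability of the solution map *)

(** A first-order expansion by a bounded linear map determines the differential, which
    is otherwise only specified by choice. *)
Lemma diff_of_expansion (R : realType) (V W : normedModType R) (f df : V -> W)
    (x : V) (C : R) :
  (forall k u v, df (k *: u + v) = k *: df u + df v) ->
  (forall v, `|df v| <= C * `|v|) ->
  (forall e, 0 < e -> exists2 dl, 0 < dl & forall h, `|h| <= dl ->
     `|f (x + h) - f x - df h| <= e * `|h|) ->
  differentiable f x /\ 'd f x = df :> (V -> W).
Proof.
move=> dflin dfC dfe.
pose F : {linear V -> W} := HB.pack df (GRing.isLinear.Build R V W *:%R df dflin).
have cF : continuous F.
  apply/linear_bounded_continuous/linear_boundedP; exists C; split=> [|r /ltW Cr v].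
    exact: num_real.
  by apply: (le_trans (dfC v)); rewrite ler_wpM2r.
have FE : f \o shift x = cst (f x) + F +o_ 0 id.
  apply/eqaddoP => e e0; have [dl dl0 H] := dfe e e0.
  near=> h; rewrite (_ : _ h = f (x + h) - f x - df h); last first.
    by rewrite -addrA -opprD [x + h]addrC.
  apply: H.
  near: h; apply/nbhs_normP; exists dl => //= h; rewrite /= sub0r normrN; exact: ltW.
have dE := diff_unique cF FE; split=> //.
by apply/diff_locallyP; rewrite dE.
Unshelve. all: by end_near. Qed.

(** * Composition with a smooth function *)

Section composition.
Context {R : realType}.
Variables (kap : R).
Hypothesis kap0 : 0 < kap.
Implicit Types (y : hoelderType kap) (f : R -> R) (t L S B : R).

Definition comph f y : hoelderType kap := restr kap (fun t => f (y t)).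

Lemma hld_comp f L y : 0 <= L -> (forall a b, `|f a - f b| <= L * `|a - b|) ->
  hld kap (L * `|y|) (fun t => f (y t)).
Proof.
move=> L0 fL s t s0 st t1; apply: (le_trans (fL _ _)); rewrite -mulrA ler_wpM2l//.
exact: hoelder_hld.
Qed.

Lemma comphE f L y t : 0 <= L -> (forall a b, `|f a - f b| <= L * `|a - b|) ->
  0 <= t <= 1 -> comph f y t = f (y t).
Proof. by move=> L0 fL; apply: restrE => //; exists (L * `|y|); exact: hld_comp. Qed.

Lemma comph_norm f L S y : 0 <= L -> (forall a b, `|f a - f b| <= L * `|a - b|) ->
  (forall a, `|f a| <= S) -> `|comph f y| <= S + L * `|y|.
Proof. by move=> L0 fL fS; apply: restr_norm => //; exact: hld_comp. Qed.

Variables (f f1 f2 : R -> R) (c L3 : R).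
Hypotheses (ff1 : forall a : R, is_derive a 1 f (f1 a)).
Hypotheses (f12 : forall a : R, is_derive a 1 f1 (f2 a)).
Hypotheses (f0c : forall a, `|f a| <= c) (f1c : forall a, `|f1 a| <= c).
Hypotheses (f2c : forall a, `|f2 a| <= c).
Hypotheses (f2L : forall a b, `|f2 a - f2 b| <= L3 * `|a - b|).

Let c0 : 0 <= c. Proof. exact: le_trans (f1c 0). Qed.
Let L30 : 0 <= L3.
Proof. by have := f2L 1 0; rewrite subr0 normr1 mulr1; exact: le_trans. Qed.
Let fL a b : `|f a - f b| <= c * `|a - b|. Proof. exact: derivative_lip ff1 f1c a b. Qed.
Let f1L a b : `|f1 a - f1 b| <= c * `|a - b|. Proof. exact: derivative_lip f12 f2c a b. Qed.

Definition slope y0 y1 : hoelderType kap :=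
  restr kap (fun t => divdiff f f1 (y0 t) (y1 t)).

Variables (B : R) (y0 y1 : hoelderType kap).
Hypotheses (y0B : `|y0| <= B) (y1B : `|y1| <= B).

Let slope_hld : hld kap (c * B) (fun t => divdiff f f1 (y0 t) (y1 t)).
Proof.
move=> s t s0 st t1; rewrite -mulrA; apply: (divdiff_lip ff1 f1L).
  by apply: (le_trans (hoelder_hld y0 s0 st t1)); rewrite ler_wpM2r ?powR_ge0.
by apply: (le_trans (hoelder_hld y1 s0 st t1)); rewrite ler_wpM2r ?powR_ge0.
Qed.

Lemma slopeE t : 0 <= t <= 1 -> slope y0 y1 t = divdiff f f1 (y0 t) (y1 t).
Proof. by apply: restrE => //; exists (c * B). Qed.

(** The Hölder constant of a divided difference is governed by the larger of the two
    constants, not by their sum: the smallness condition of the linear equation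
    therefore holds for it exactly as it does for [f1] itself. *)
Lemma slope_norm : `|slope y0 y1| <= c * (1 + B).
Proof.
rewrite mulrDr mulr1; apply: restr_norm => //.
by move=> t _; exact: (divdiff_bound ff1).
Qed.

Lemma comph_norm1 : `|comph f1 y0| <= c * (1 + B).
Proof.
apply: (le_trans (comph_norm y0 c0 f1L f1c)).
by rewrite mulrDr mulr1 lerD2l ler_wpM2l.
Qed.

Lemma comph_slope : comph f y1 - comph f y0 = mulh (slope y0 y1) (y1 - y0).
Proof.
apply: hoelder_ext => t t01; rewrite mulhE// slopeE//.
rewrite -[LHS]/(comph f y1 t - comph f y0 t) -[(y1 - y0) t]/(y1 t - y0 t).
by rewrite -(divdiffE f f1) !(comphE _ c0 fL).
Qed.

(** The constant of the first summand comes from the supremum, the other ones from the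
    Hölder seminorm; the paths contribute at most [B] and their difference [2 * B]. *)
Lemma slope_near : `|slope y0 y1 - comph f1 y0| <=
  (c + (c + L3 * (B + 2 * B))) * `|y1 - y0|.
Proof.
have B0 : 0 <= B by exact: le_trans (normr_ge0 _) y0B.
have inc t : y1 t = y0 t + (y1 - y0) t by rewrite -[(y1 - y0) t]/(y1 t - y0 t); ring.
have E t : 0 <= t <= 1 -> (slope y0 y1 - comph f1 y0) t =
    divdiff f f1 (y0 t) (y0 t + (y1 - y0) t) - f1 (y0 t).
  move=> t01; rewrite -[LHS]/(slope y0 y1 t - comph f1 y0 t) slopeE// (comphE _ c0 f1L)//.
  by rewrite -inc.
set D := y1 - y0 in inc E *.
have D2 : `|D| <= 2 * B by apply: (le_trans (ler_normB _ _)); have := y0B; have := y1B; lra.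
rewrite mulrDl; apply: hoelder_norm_le => // [s t s0 st t1|t t01]; last first.
  rewrite E//; have := divdiff_defect_lip ff1 f12 f2c f2L (y0 t) (D t) (y0 t) 0.
  rewrite addr0 divdiff_diag !subrr normr0 mul0r addr0 !subr0 => /le_trans; apply.
  by rewrite ler_wpM2l// hoelder_sup.
have t01 : 0 <= t <= 1 by rewrite t1 (le_trans s0).
have s01 : 0 <= s <= 1 by rewrite s0 (le_trans st).
rewrite !E//; apply: (le_trans (divdiff_defect_lip ff1 f12 f2c f2L _ _ _ _)).
have h1 := hoelder_hld D s0 st t1; have h2 := hoelder_hld y0 s0 st t1.
have h3 := hoelder_sup D s01; set T := (t - s) `^ kap in h1 h2 *.
have T0 : 0 <= T by exact: powR_ge0.
rewrite [leRHS](_ : _ = c * (`|D| * T) + `|D| * (L3 * (B * T + 2 * B * T))); last by ring.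
rewrite lerD ?ler_wpM2l// ler_pM ?mulr_ge0 ?addr_ge0// ler_wpM2l// lerD//.
  by apply: (le_trans h2); rewrite ler_wpM2r.
by apply: (le_trans h1); rewrite ler_wpM2r.
Qed.

End composition.

(** * The increments of the solution *)

Section solution_map.
Context {R : realType}.
Variables (gam kap be M p c c2 CM L3 : R) (phi f f1 f2 : R -> R).
Variable z : hoelderType be -> hoelderType kap.
Hypotheses (kap0 : 0 < kap) (kap1 : kap <= 1) (gam0 : 0 < gam) (kg1 : 1 < kap + gam).
Hypotheses (gb : gam <= be) (p1 : 1 <= p) (pbe : 1 < 2 * p * (be - gam)).
Hypotheses (M0 : 0 < M) (cut : is_cutoff M phi).
Hypothesis lin : linear_constant M gam kap p phi c2.
Hypotheses (ff1 : forall a : R, is_derive a 1 f (f1 a)).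
Hypotheses (f12 : forall a : R, is_derive a 1 f1 (f2 a)).
Hypotheses (f0c : forall a, `|f a| <= c) (f1c : forall a, `|f1 a| <= c).
Hypotheses (f2c : forall a, `|f2 a| <= c).
Hypotheses (f2L : forall a b, `|f2 a - f2 b| <= L3 * `|a - b|).
Hypotheses (CM0 : 0 < CM) (cCM : c * (1 + CM) < c2 / (M + 1)).
Implicit Types (x h : hoelderType be) (w y b : hoelderType kap) (k t : R).
Local Notation G := (trunc gam p phi).
Local Notation L := (@Loph R kap be).
Hypotheses (zCM : forall x, `|z x| <= CM).
Hypotheses (zE : forall x, z x = G x *: L x (comph f (z x))).

Let be0 : 0 < be. Proof. exact: lt_le_trans gb. Qed.
Let c0 : 0 <= c. Proof. exact: le_trans (f1c 0). Qed.
Let fL (a a' : R) : `|f a - f a'| <= c * `|a - a'|. Proof. exact: derivative_lip ff1 f1c a a'. Qed.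
Let LD x h w : L (x + h) w = L x w + L h w.
Proof. exact: (LophD kap0 kap1 gam0 kg1 gb). Qed.
Let LB x w y : L x (w - y) = L x w - L x y.
Proof. exact: (LophB kap0 kap1 gam0 kg1 gb). Qed.

Lemma truncE x : G x = phi (sobI gam p x).
Proof.
rewrite /trunc /cutoff.
by have [_ ->] := sobolev_normE p1 gam0 pbe (hoelder_measurable x) (hoelder_hld x).
Qed.

Lemma trunc_bounded : exists2 B, 0 <= B & forall x, `|G x| <= B.
Proof.
have [B B0 H] := cutoff_bounded M0 cut; exists B => // x.
by rewrite truncE; apply: H; exact: sobI_ge0.
Qed.

Definition dtrunc x h : R := phi^`()%classic (sobI gam p x) * pairing gam p x h.

Lemma dtrunc_bound x : exists2 C, 0 <= C & forall h, `|dtrunc x h| <= C * `|h|.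
Proof.
have [C C0 H] := pairing_bound p1 gam0 be0 pbe x.
exists (`|phi^`()%classic (sobI gam p x)| * C) => [|h]; first by rewrite mulr_ge0.
by rewrite normrM -mulrA ler_wpM2l.
Qed.

Lemma trunc_expansion x e : 0 < e -> exists2 dl, 0 < dl & forall h, `|h| <= dl ->
  `|G (x + h) - G x - dtrunc x h| <= e * `|h|.
Proof.
move=> e0; have [dl dl0 H] := cutoff_expansion p1 gam0 be0 pbe M0 cut x e0.
by exists dl => // h hdl; rewrite !truncE; exact: H.
Qed.

Lemma trunc_lip x : exists2 C, 0 <= C & exists2 dl, 0 < dl & forall h, `|h| <= dl ->
  `|G (x + h) - G x| <= C * `|h|.
Proof.
have [C C0 H] := dtrunc_bound x; have [dl dl0 hdl] := trunc_expansion x ltr01.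
exists (1 + C); [by rewrite addr_ge0|exists dl => // h hh].
rewrite -[X in `|X|](subrK (dtrunc x h)) mulrDl.
by apply: (le_trans (ler_normD _ _)); rewrite lerD ?hdl.
Qed.

Lemma nonlin_norm x : `|comph f (z x)| <= c * (1 + CM).
Proof.
apply: (le_trans (comph_norm kap0 (z x) c0 fL f0c)).
by rewrite mulrDr mulr1 lerD2l ler_wpM2l.
Qed.

Fact ler_norm_sum5 (W : normedModType R) (v1 v2 v3 v4 v5 : W) (n1 n2 n3 n4 n5 : R) :
  `|v1| <= n1 -> `|v2| <= n2 -> `|v3| <= n3 -> `|v4| <= n4 -> `|v5| <= n5 ->
  `|v1 + v2 + v3 + v4 + v5| <= n1 + n2 + n3 + n4 + n5.
Proof.
by move=> *; do 4?[apply: (le_trans (ler_normD _ _)); rewrite lerD//].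
Qed.

Fact increment_split (a b' a' g g' : R) :
  g' * (a + b') - g * a' = (g' - g) * a + g' * b' + g * (a - a').
Proof. by ring. Qed.

Fact remainder_split (a b' a' w1 w0 g : R) :
  w1 + g * a - (w0 + g * b') = w1 - w0 + g * (a - a') + g * (a' - b').
Proof. by ring. Qed.

Fact source_split (a b' a' e q q' g1 g0 D : R) :
  (g1 - g0) * a + g1 * b' - (D * a' + g0 * e) + g0 * (q - q') =
  (g1 - g0 - D) * a' + (g1 - g0) * (a - a') + (g1 - g0) * b' +
  g0 * (b' - e) + g0 * (q - q').
Proof. by ring. Qed.

Fact variation_split (k' d1 d2 a b1 b2 g : R) :
  (k' * d1 + d2) * a + g * (k' * b1 + b2) =
  k' * (d1 * a + g * b1) + (d2 * a + g * b2).
Proof. by ring. Qed.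

Definition increment_source x h : hoelderType kap :=
  (G (x + h) - G x) *: L x (comph f (z (x + h))) + G (x + h) *: L h (comph f (z (x + h))).

(** Linearizing by divided differences is exact, so the increment of the solution solves
    a linear equation of the same kind, whose coefficient is as small as required. *)
Lemma increment_solution x h :
  is_solution gam p phi x (slope f f1 (z x) (z (x + h))) (increment_source x h)
    (z (x + h) - z x).
Proof.
rewrite /is_solution -(comph_slope kap0 ff1 f12 f1c f2c (zCM x) (zCM (x + h))) LB.
rewrite {1}(zE (x + h)) {1}(zE x) LD /increment_source.
apply: hoelder_ext => t _.
set A := L x (comph f (z (x + h))); set B := L h _; set C := L x _.
rewrite -[LHS]/(G (x + h) * (A t + B t) - G x * C t).
rewrite -[RHS]/((G (x + h) - G x) * A t + G (x + h) * B t + G x * (A t - C t)).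
exact: increment_split.
Qed.

Lemma increment_lip x : exists2 C, 0 <= C & exists2 dl, 0 < dl & forall h, `|h| <= dl ->
  `|z (x + h) - z x| <= C * `|h|.
Proof.
have [K K0 LK] := Loph_bound kap0 kap1 gam0 kg1 gb.
have [B B0 GB] := trunc_bounded; have [D D0 [dl dl0 GD]] := trunc_lip x.
have [cS cS0 solver] := linear_solver kap0 kap1 gam0 kg1 gb p1 pbe lin.
have s0 : 0 <= c * (1 + CM) by rewrite mulr_ge0// addr_ge0// ltW.
exists (cS * (D * (K * `|x| * (c * (1 + CM))) + B * (K * (c * (1 + CM))))).
  by rewrite mulr_ge0 ?(ltW cS0)// addr_ge0// mulr_ge0// mulr_ge0// mulr_ge0.
exists dl => // h hdl; have hs := nonlin_norm (x + h).
have [|S [_ u Sn _]] := solver x (slope f f1 (z x) (z (x + h))).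
  by apply: le_lt_trans cCM; exact: (slope_norm kap0 ff1 f12 f1c f2c (zCM x) (zCM _)).
rewrite (u _ _ (increment_solution x h)) -mulrA; apply: (le_trans (Sn _)).
rewrite ler_wpM2l ?(ltW cS0)// mulrDl /increment_source.
apply: (le_trans (ler_normD _ _)); rewrite !normrZ lerD//.
  rewrite mulrAC ler_pM// ?GD//; apply: (le_trans (LK _ _)).
  by rewrite ler_wpM2l// mulr_ge0.
rewrite -mulrA ler_pM//; apply: (le_trans (LK _ _)).
by rewrite mulrAC ler_wpM2r// ler_wpM2l.
Qed.

Definition variation_source x h : hoelderType kap :=
  dtrunc x h *: L x (comph f (z x)) + G x *: L h (comph f (z x)).

Lemma small_combination (a Q m e : R) : 0 <= a -> 0 <= Q -> 0 <= m -> 0 < e ->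
  exists2 e1, 0 < e1 & exists2 dl, 0 < dl & forall n, 0 <= n <= dl ->
    m * (e1 * n * a + Q * n ^+ 2) <= e * n.
Proof.
move=> a0 Q0 m0 e0.
have ma : 0 < 2 * (m * a + 1) by rewrite mulr_gt0// ltr_wpDl// mulr_ge0.
have mQ : 0 < 2 * (m * Q + 1) by rewrite mulr_gt0// ltr_wpDl// mulr_ge0.
exists (e / (2 * (m * a + 1))); first by rewrite divr_gt0.
exists (e / (2 * (m * Q + 1))); first by rewrite divr_gt0.
move=> n /andP[n0]; rewrite ler_pdivlMr// => nd.
rewrite (_ : m * _ = (m * (e / (2 * (m * a + 1))) * a + m * Q * n) * n); last by ring.
rewrite ler_wpM2r// (splitr e) lerD//.
  rewrite (_ : m * _ * a = e / 2 * (m * a / (m * a + 1))); last first.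
    by field; rewrite gt_eqF// ltr_wpDl// mulr_ge0.
  rewrite ler_piMr ?divr_ge0 ?(ltW e0)// ler_pdivrMr ?mul1r ?lerDl//.
  by rewrite ltr_wpDl// mulr_ge0.
lra.
Qed.

Section at_control.
Variables (x : hoelderType be) (S : hoelderType kap -> hoelderType kap) (cS : R).
Hypotheses (cS0 : 0 < cS).
Hypothesis Ssol : forall w, is_solution gam p phi x (comph f1 (z x)) w (S w).
Hypothesis Suniq : forall w y, is_solution gam p phi x (comph f1 (z x)) w y -> y = S w.
Hypothesis Snorm : forall w, `|S w| <= cS * `|w|.
Hypothesis Slin : forall k w w', S (k *: w + w') = k *: S w + S w'.

Definition variation h : hoelderType kap := S (variation_source x h).

Let remainder_source h : hoelderType kap :=
  increment_source x h - variation_source x h +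
  G x *: (L x (mulh (slope f f1 (z x) (z (x + h))) (z (x + h) - z x)) -
          L x (mulh (comph f1 (z x)) (z (x + h) - z x))).

Let remainder_solution h :
  is_solution gam p phi x (comph f1 (z x)) (remainder_source h)
    (z (x + h) - z x - variation h).
Proof.
rewrite /is_solution (mulhBr kap0) LB {1}(increment_solution x h).
rewrite {1}/variation {1}(Ssol _) -/(variation h) /remainder_source.
apply: hoelder_ext => t _.
set A := L x (mulh (slope _ _ _ _) _); set B := L x (mulh _ (variation h)).
set C := L x (mulh (comph f1 _) (z (x + h) - z x)).
set w1 := increment_source x h; set w0 := variation_source x h.
rewrite -[LHS]/(w1 t + G x * A t - (w0 t + G x * B t)).
rewrite -[RHS]/(w1 t - w0 t + G x * (A t - C t) + G x * (C t - B t)).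
exact: remainder_split.
Qed.

Let remainder_source_split h : remainder_source h =
  (G (x + h) - G x - dtrunc x h) *: L x (comph f (z x)) +
  (G (x + h) - G x) *: L x (comph f (z (x + h)) - comph f (z x)) +
  (G (x + h) - G x) *: L h (comph f (z (x + h))) +
  G x *: L h (comph f (z (x + h)) - comph f (z x)) +
  G x *: L x (mulh (slope f f1 (z x) (z (x + h)) - comph f1 (z x)) (z (x + h) - z x)).
Proof.
rewrite /remainder_source (mulhBl kap0) !LB /increment_source /variation_source.
apply: hoelder_ext => t _.
set A := L x (comph f (z (x + h))); set B := L h (comph f (z (x + h))).
set C := L x (comph f (z x)); set E := L h (comph f (z x)).
set A' := L x (mulh _ _); set B' := L x (mulh _ _).
set g1 := G (x + h); set g0 := G x; set D := dtrunc x h.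
rewrite -[LHS]/((g1 - g0) * A t + g1 * B t - (D * C t + g0 * E t) + g0 * (A' t - B' t)).
rewrite -[RHS]/((g1 - g0 - D) * C t + (g1 - g0) * (A t - C t) + (g1 - g0) * B t +
  g0 * (B t - E t) + g0 * (A' t - B' t)).
exact: source_split.
Qed.

(** The source of the equation solved by the remainder is a sum of five terms: the first
    is the remainder in the expansion of the cutoff, each of the others has two factors
    of the order of [h]. *)
Lemma solution_expansion e : 0 < e -> exists2 dl, 0 < dl & forall h, `|h| <= dl ->
  `|z (x + h) - z x - variation h| <= e * `|h|.
Proof.
move=> e0.
have [K K0 LK] := Loph_bound kap0 kap1 gam0 kg1 gb.
have [B B0 GB] := trunc_bounded; have [D D0 [d1 d10 GD]] := trunc_lip x.
have [C C0 [d2 d20 zC]] := increment_lip x.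
have [s sE s0] : exists2 s, s = c * (1 + CM) & 0 <= s.
  by eexists; [reflexivity|rewrite mulr_ge0// addr_ge0// ltW].
have nonlin_s x' : `|comph f (z x')| <= s by rewrite sE nonlin_norm.
have L30 : 0 <= L3.
  by have := f2L 1 0; rewrite subr0 normr1 mulr1; exact: le_trans.
have [H HE H0] : exists2 H, H = c + (c + L3 * (CM + 2 * CM)) & 0 <= H.
  eexists; first reflexivity.
  by rewrite !addr_ge0// mulr_ge0// addr_ge0 ?mulr_ge0// ltW.
pose Q := D * (K * `|x| * (3 * s * C)) + D * (K * s) + B * (K * (3 * s * C)) +
  B * (K * `|x| * (3 * (H * C) * C)).
have Q0 : 0 <= Q by rewrite /Q !addr_ge0// !mulr_ge0.
have a0 : 0 <= K * `|x| * s by rewrite !mulr_ge0.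
have [e1 e10 [d3 d30 small]] := small_combination a0 Q0 (ltW cS0) e0.
have [d4 d40 GE] := trunc_expansion x e10.
exists (Num.min (Num.min d1 d2) (Num.min d3 d4)) => [|h].
  by rewrite !lt_min d10 d20 d30.
rewrite !le_min => /andP[/andP[h1 h2] /andP[h3 h4]].
rewrite (Suniq (remainder_solution h)); apply: (le_trans (Snorm _)).
apply: le_trans (small `|h| _); last by rewrite normr_ge0.
rewrite ler_wpM2l ?(ltW cS0)// remainder_source_split.
have zh := zC _ h2.
have dsC : `|comph f (z (x + h)) - comph f (z x)| <= 3 * s * C * `|h|.
  rewrite (comph_slope kap0 ff1 f12 f1c f2c (zCM x) (zCM (x + h))).
  apply: (le_trans (mulh_norm kap0 _ _)); rewrite -[leRHS]mulrA ler_pM ?mulr_ge0//.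
  by rewrite ler_wpM2l// sE (slope_norm kap0 ff1 f12 f1c f2c (zCM x) (zCM _)).
have LS x' (w : hoelderType kap) a n : `|x'| <= a -> `|w| <= n ->
    `|L x' w| <= K * a * n.
  by move=> xa wn; apply: (le_trans (LK _ _)); rewrite ler_pM ?mulr_ge0// ler_wpM2l.
have term (g g' w' : R) (w : hoelderType kap) : `|g| <= g' -> `|w| <= w' ->
    `|g *: w| <= g' * w' by move=> *; rewrite normrZ ler_pM.
rewrite (_ : Q * `|h| ^+ 2 = D * `|h| * (K * `|x| * (3 * s * C * `|h|)) +
    D * `|h| * (K * `|h| * s) + B * (K * `|h| * (3 * s * C * `|h|)) +
    B * (K * `|x| * (3 * (H * (C * `|h|)) * (C * `|h|)))); last by rewrite /Q; ring.
rewrite !addrA; apply: ler_norm_sum5.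
- by apply: term; [exact: GE|apply: LS => //; exact: nonlin_s].
- by apply: term; [exact: GD|exact: LS].
- by apply: term; [exact: GD|apply: LS => //; exact: nonlin_s].
- by apply: term; [exact: GB|exact: LS].
- apply: term; [exact: GB|apply: LS => //].
  apply: (le_trans (mulh_norm kap0 _ _)); rewrite ler_pM ?mulr_ge0// ler_wpM2l//.
  apply: (le_trans (slope_near kap0 ff1 f12 f1c f2c f2L (zCM x) (zCM _))).
  by rewrite -HE ler_wpM2l.
Qed.

Lemma variation_lin k h h' : variation (k *: h + h') = k *: variation h + variation h'.
Proof.
apply: etrans (Slin k _ _); congr S; rewrite /variation_source.
rewrite (Loph_linl kap0 kap1 gam0 kg1 gb).
have -> : dtrunc x (k *: h + h') = k * dtrunc x h + dtrunc x h'.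
  rewrite /dtrunc.
  have := pairing_lin p1 gam0 be0 pbe k 1 (hoelder_measurable x) (hoelder_measurable h)
    (hoelder_measurable h') (hoelder_hld x) (hoelder_hld h) (hoelder_hld h').
  rewrite mul1r (_ : (fun s => k * h s + 1 * h' s) = k *: h + h'); last first.
    by apply/funext => s; rewrite mul1r.
  by move=> ->; ring.
set A := L x _; set B := L h _; set B' := L h' _.
move: (dtrunc x h) (dtrunc x h') => d1 d2; apply: hoelder_ext => t _.
rewrite -[LHS]/((k * d1 + d2) * A t + G x * (k * B t + B' t)).
rewrite -[RHS]/(k * (d1 * A t + G x * B t) + (d2 * A t + G x * B' t)).
exact: variation_split.
Qed.

Lemma variation_bound : exists C, forall h, `|variation h| <= C * `|h|.
Proof.
have [K K0 LK] := Loph_bound kap0 kap1 gam0 kg1 gb.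
have [B B0 GB] := trunc_bounded; have [D D0 GD] := dtrunc_bound x.
pose s := c * (1 + CM).
exists (cS * (D * (K * `|x| * s) + B * (K * s))) => h; rewrite /variation.
apply: (le_trans (Snorm _)); rewrite -[leRHS]mulrA ler_wpM2l ?(ltW cS0)// mulrDl.
apply: (le_trans (ler_normD _ _)); apply: lerD; rewrite normrZ.
  rewrite mulrAC ler_pM ?GD//; apply: (le_trans (LK _ _)).
  by rewrite ler_wpM2l ?mulr_ge0// nonlin_norm.
rewrite -mulrA ler_pM//; apply: (le_trans (LK _ _)).
by rewrite mulrAC ler_wpM2r// ler_wpM2l// nonlin_norm.
Qed.

Lemma solution_differentiable : differentiable z x /\ 'd z x = variation :> (_ -> _).
Proof.
have [C hC] := variation_bound.
exact: (diff_of_expansion variation_lin hC solution_expansion).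
Qed.

End at_control.
End solution_map.

(** * Kernels representing the derivative *)

Section derivative_kernel.
Context {R : realType}.
Variables (gam kap be p : R) (phi : R -> R).
Hypotheses (kap0 : 0 < kap) (kap1 : kap < 1) (gam0 : 0 < gam) (kg1 : 1 < kap + gam).
Hypotheses (gb : gam < be) (p1 : 1 <= p) (pbe : 1 < 2 * p * (be - gam)).
Variables (x : hoelderType be) (b q : hoelderType kap) (v : R).
Variable S : hoelderType kap -> hoelderType kap.
Local Notation G := (trunc gam p phi x).
Local Notation L := (@Loph R kap be).
Hypothesis Ssol : forall w, is_solution gam p phi x b w (S w).
Hypothesis Slin : forall k w w', S (k *: w + w') = k *: S w + S w'.
Implicit Types (h : hoelderType be) (w y : hoelderType kap) (s t : R).

Let kap1' : kap <= 1. Proof. exact: ltW. Qed.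
Let gb' : gam <= be. Proof. exact: ltW. Qed.
Let S0 : S 0 = 0.
Proof. by have := Slin (-1) 0 0; rewrite scaleN1r addNr scaleN1r addNr. Qed.
Let SZ k w : S (k *: w) = k *: S w.
Proof. by have := Slin k w 0; rewrite !addr0 S0 addr0. Qed.

Definition point_response s : hoelderType kap := S (restr kap (green s)).
Definition source_response : hoelderType kap := S (L x q).

(** The kernel solves the linear equation with source $\Psi_s$. Spelling it out in the
    responses to the two parts of $\Psi_s$ shows how it depends on [s]. *)
Definition kernel s : hoelderType kap :=
  (G * q s) *: point_response s + (2 * v * mu_kernel gam p x s) *: source_response.

Let greenE s t : 0 <= s <= 1 -> 0 <= t <= 1 -> restr kap (green s) t = green s t.
Proof.
move=> s01; apply: restrE => //.
by exists 2; apply: hldW (hld_green s01).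
Qed.

Lemma solution_Lop w y t : is_solution gam p phi x b w y -> 0 <= t <= 1 ->
  y t = w t + Lop x (fun r => G * b r * y r) t.
Proof.
move=> sol t01; have -> : y t = w t + G * L x (mulh b y) t by rewrite {1}sol.
rewrite (LophE kap0 kap1' gam0 kg1 gb')//; congr (_ + _).
have hb := hoelder_hold (mulh b y); have hx := control_hold gam0 gb' x.
have := Lop_linq kap0 kap1' gam0 kg1 G 0 hb hb hx t01.
rewrite mul0r addr0 => <-; apply: (eq_Lop kap0 kap1' gam0 kg1) => //.
  by apply: holdD; apply: holdZ.
by move=> r r01; rewrite mulhE//; ring.
Qed.

Lemma point_responseE s t : 0 <= s <= 1 -> 0 <= t <= 1 ->
  point_response s t = green s t + Lop x (fun r => G * b r * point_response s r) t.
Proof. by move=> s01 t01; rewrite (solution_Lop (Ssol _) t01) greenE. Qed.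

(** Regularity in [t] is that of solutions; by symmetry it is also regularity in [s],
    which makes the kernel a legitimate integrand. *)
Lemma point_response_sym s t : 0 <= s <= 1 -> 0 <= t <= 1 ->
  point_response s t = point_response t s.
Proof.
move=> s01 t01; have hb : hold kap (fun r => G * b r) by apply: holdZ; exact: hoelder_hold.
apply: (resolvent_sym kap0 kap1' gam0 kg1 (control_hold gam0 gb' x) hb
  (hoelder_hold _) (hoelder_hold _) s01 t01) => r r01; exact: point_responseE.
Qed.

Lemma kernel_solution s t : 0 <= s <= 1 -> 0 <= t <= 1 -> kernel s t =
  G * q s * green t s + 2 * v * mu_kernel gam p x s * L x q t +
  G * L x (mulh b (kernel s)) t.
Proof.
move=> s01 t01; have -> : kernel s = S ((G * q s) *: restr kap (green s) +
    (2 * v * mu_kernel gam p x s) *: L x q) by rewrite Slin SZ.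
rewrite {1}Ssol green_sym -(greenE s01 t01).
by [].
Qed.

(** Pairing the source with the response to a unit source at [t] evaluates the solution
    at [t]: this is [duality], the source being [lam] of the primitive of [q dh]. *)
Lemma forcing_response h t : 0 <= t <= 1 ->
  S (L h q) t = \young_(s = 0 to 1) (point_response t s * q s) d h.
Proof.
move=> t01; have hx := control_hold gam0 gb' x; have hh := control_hold gam0 gb' h.
have hq := hoelder_hold q.
rewrite (young_assoc kap0 gam0 kg1 (hoelder_hold _) hq hh).
have hb : hold kap (fun r => G * b r) by apply: holdZ; exact: hoelder_hold.
apply: (duality kap0 kap1' gam0 kg1 hx hb (hoelder_hold _) (hoelder_hold _) _ t01).
- exact: (yprim_hold kap0 gam0 kg1).
- by move=> s s01; exact: point_responseE.
- move=> s s01; rewrite (solution_Lop (Ssol _) s01); congr (_ + _).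
  by rewrite (LophE kap0 kap1' gam0 kg1 gb')// (Lop_lam kap0 kap1' gam0 kg1).
Qed.

(** The part of the kernel coming from the cutoff is only as regular as $\mu$, whose
    exponent complements that of [h]; its integral is half the derivative of the Sobolev
    functional, which accounts for the factor [2] in $\Psi$. *)
Lemma kernel_young h t : 0 <= t <= 1 ->
  is_young_integral (fun s => kernel s t) h 0 1
    (S ((v * pairing gam p x h) *: L x q + G *: L h q) t).
Proof.
move=> t01; have kap01 : 0 < kap < 1 by rewrite kap0.
have kg : 1 < gam + kap by rewrite addrC.
have [dl [b1 [/andP[dl0 dlk] b10 dlb hmu muI]]] :=
  mu_kernel_young x p1 gam0 kap01 kg gb pbe.
have [hb1 [I Ip IE]] := muI h.
pose g s := point_response t s * q s.
have hg : hold kap g by apply: holdM => //; exact: hoelder_hold.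
have hh := control_hold gam0 gb' h.
pose k := 2 * v * source_response t.
have E s : 0 <= s <= 1 -> G * g s + k * mu_kernel gam p x s = kernel s t.
  move=> s01; rewrite -[RHS]/(G * q s * point_response s t +
    2 * v * mu_kernel gam p x s * source_response t).
  by rewrite (point_response_sym s01 t01) /g /k; ring.
have P := prim_addl (prim_scalel G (yprimP kap0 gam0 kg1 hg hh)) (prim_scalel k Ip).
have P' : prim (fun s => kernel s t) h (fun s => G * yprim g h s + k * I s).
  by apply: eq_prim P => // s s01; exact: E.
have hk : hold dl (fun s => kernel s t).
  apply: (eq_hold E); apply: holdD; apply: holdZ => //.
  exact: holdW dl0 dlk hg.
have := prim_is_young dl0 b10 dlb hk hb1 P' (lexx 0) ler01 (lexx 1).
congr is_young_integral.
have -> : S ((v * pairing gam p x h) *: L x q + G *: L h q) t =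
    v * pairing gam p x h * source_response t + G * S (L h q) t.
  by rewrite Slin SZ.
rewrite (forcing_response h t01) -/g.
rewrite (young_yprim kap0 gam0 kg1 hg hh (lexx 0) ler01 (lexx 1)) /k.
have -> : pairing gam p x h = 2 * (I 1 - I 0) by rewrite IE mulrA divff ?mul1r.
move: (yprim g h 1) (yprim g h 0) (I 1) (I 0) (source_response t) => *; ring.
Qed.

End derivative_kernel.

Theorem theorem3p7 (R : realType) (M gamma kappa eps p : R)
    (phi sigma : R -> R) (c1 c2 CM c3 : R)
    (z : hoelderType (gamma + eps) -> hoelderType kappa) :
  0 < M ->
  0 < gamma < 1 -> 0 < kappa < 1 -> 1 < gamma + kappa ->
  0 < eps -> 1 <= p -> (2 * p)^-1 < eps ->
  is_cutoff M phi ->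
  0 < c1 < 1 -> 0 < CM -> bvp_constants M gamma kappa eps p phi c1 CM ->
  0 < c2 < 1 -> linear_constant M gamma kappa p phi c2 ->
  c3 < Num.min (c2 / (1 + CM)) c1 ->
  Cb 4 sigma -> C2_bound sigma (c3 / (M + 1)) ->
  (forall x : hoelderType (gamma + eps), solves_bvp gamma p phi sigma x (z x)) ->
  forall x : hoelderType (gamma + eps),
    differentiable z x /\
    exists Phi : R -> hoelderType kappa,
      (forall s t : R, 0 <= s <= 1 -> 0 <= t <= 1 ->
        Phi s t = Psi gamma p phi sigma x (z x) s t +
          cutoff gamma p phi x *
          \young_(xi = 0 to 1) (green t xi * sigma^`()%classic (z x xi) * Phi s xi) d x) /\
      (forall (h : hoelderType (gamma + eps)) (t : R), 0 <= t <= 1 ->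
        is_young_integral (fun s => Phi s t) h 0 1 ('d z x h t)).
Proof.
move=> M0 /andP[gam0 _] kap01 gk eps0 p1 pe cut /andP[c10 _] CM0 bvp _ lin c3lt Cb4 C2b
  zsol x.
have /andP[kap0 kap1] := kap01; have kap1' := ltW kap1.
have kg1 : 1 < kappa + gamma by rewrite addrC.
have gb : gamma < gamma + eps by rewrite ltrDl.
have gb' := ltW gb.
have pbe : 1 < 2 * p * (gamma + eps - gamma).
  rewrite [gamma + eps]addrC addrK; have p20 : 0 < 2 * p by lra.
  by rewrite -(ltr_pdivrMl _ _ p20) mulr1.
have M1 : 0 < M + 1 by rewrite addr_gt0.
have /andP[c32 c31] : (c3 < c2 / (1 + CM)) && (c3 < c1) by rewrite -lt_min.
pose c := c3 / (M + 1).
(* The norm of [slope] and of the linearized coefficient is at most [c * (1 + CM)]. *)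
have cCM : c * (1 + CM) < c2 / (M + 1).
  rewrite /c mulrAC ltr_pM2r ?invr_gt0//.
  by move: c32; rewrite ltr_pdivlMr// addr_gt0.
have [derv cont bnd] := Cb4.
pose f1 := sigma^`()%classic; pose f2 := sigma^`(2)%classic.
have ff1 (a : R) : is_derive a 1 sigma (f1 a).
  by split; [exact: derv 0%N isT a|rewrite /f1 derive1E].
have f12 (a : R) : is_derive a 1 f1 (f2 a).
  by split; [exact: derv 1%N isT a|rewrite /f2 derive1nS/= derive1E].
have f23 (a : R) : is_derive a 1 f2 (sigma^`(3)%classic a).
  by split; [exact: derv 2%N isT a|rewrite /f2 derive1nS/= derive1E].
have f0c a : `|sigma a| <= c by exact: C2b 0%N isT a.
have f1c a : `|f1 a| <= c by exact: C2b 1%N isT a.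
have f2c a : `|f2 a| <= c by exact: C2b 2%N isT a.
have [L3 f3L] := bnd 3%N isT.
have f2L a b : `|f2 a - f2 b| <= L3 * `|a - b| by exact: derivative_lip f23 f3L a b.
have c0 : 0 <= c by exact: le_trans (f1c 0).
have fL a b : `|sigma a - sigma b| <= c * `|a - b| by exact: derivative_lip ff1 f1c a b.
have f1L a b : `|f1 a - f1 b| <= c * `|a - b| by exact: derivative_lip f12 f2c a b.
(* Uniqueness in the existence result makes its bound apply to the given [z]. *)
have zCM x' : `|z x'| <= CM.
  have Cb2 : Cb 2 sigma.
    split; first by move=> k k2; apply: derv; exact: ltn_trans k2 _.
      move=> a; apply: differentiable_continuous; apply/derivable1_diffP.
      exact: derv 2%N isT a.
    by move=> k k2; apply: bnd; exact: leq_trans k2 _.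
  have C2 : C2_bound sigma (c1 / (M + 1)).
    move=> j j2 y; apply: (le_trans (C2b j j2 y)).
    by rewrite ler_pM2r ?invr_gt0// ltW.
  by have [z' [_ /(_ _ (zsol x')) -> ]] := bvp sigma x' Cb2 C2.
have compE (y : hoelderType kappa) t : 0 <= t <= 1 -> comph sigma y t = sigma (y t).
  exact: (comphE kap0 y c0 fL).
have zE x' : z x' = trunc gamma p phi x' *: Loph x' (comph sigma (z x')).
  apply: hoelder_ext => t t01; rewrite [RHS](_ : _ =
    trunc gamma p phi x' * Loph x' (comph sigma (z x')) t)//.
  have hx := control_hold gam0 gb' x'.
  have hs : hold kappa (fun s => sigma (z x' s)).
    by exists (c * `|z x'|); exact: hld_comp.
  rewrite (bvp_Lop kap0 kap1' gam0 kg1 hs hx (zsol x') t01); congr (_ * _).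
  rewrite (LophE kap0 kap1' gam0 kg1 gb')//.
  apply: (eq_Lop kap0 kap1' gam0 kg1) => // s s01; exact/esym/compE.
have [cS cS0 solver] := linear_solver kap0 kap1' gam0 kg1 gb' p1 pbe lin.
have [|S [Ssol Suniq Snorm Slin]] := solver x (comph f1 (z x)).
  by apply: le_lt_trans cCM; exact: (comph_norm1 kap0 f12 f1c f2c (zCM x)).
have [dz dzE] := solution_differentiable kap0 kap1' gam0 kg1 gb' p1 pbe M0 cut lin
  ff1 f12 f0c f1c f2c f2L CM0 cCM zCM zE cS0 Ssol Suniq Snorm Slin.
split=> //; pose v := phi^`()%classic (sobI gamma p x).
have hx := control_hold gam0 gb' x.
exists (kernel gamma p phi x (comph sigma (z x)) v S); split=> [s t s01 t01|h t t01].
  rewrite (kernel_solution kap0 kap1 _ _ Ssol Slin s01 t01) compE//.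
  rewrite !(LophE kap0 kap1' gam0 kg1 gb')//.
  rewrite /Psi /v -[phi^`()%classic _](_ : phi^`()%classic (sobolev_pow gamma p x) = _).
    congr (_ + _ * _ + _ * _).
      apply: (eq_Lop kap0 kap1' gam0 kg1) => // [|r r01]; first exact: hoelder_hold.
      exact: compE.
    set Phi := kernel _ _ _ _ _ _ _ _.
    have hm := hoelder_hold (mulh (comph f1 (z x)) Phi).
    apply: (eq_young kap0 gam0 kg1) => // [|r r01].
      apply: holdM => //; by exists 2; apply: hldW (hld_green t01).
    by rewrite mulhE// (comphE kap0 _ c0 f1L)// mulrA.
  have [_ ->//] := sobolev_normE p1 gam0 pbe (hoelder_measurable x) (hoelder_hld x).
rewrite dzE.
exact: (kernel_young kap0 kap1 gam0 kg1 gb p1 pbe (comph sigma (z x)) v Ssol Slin h t01).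
Qed.
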